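(* Let $s=\sigma+it$ be a complex number with $\sigma<1$. As a function of $\alpha$ on the unit interval $[0,1]$, the Hurwitz zeta function $\zeta(s,\alpha)$ has the Fourier series $\Gamma(1-s)\sum_{|n|\ge 1}(2\pi i n)^{s-1}e^{2\pi i n\alpha}$, with $$\zeta(s,\alpha)=\Gamma(1-s)\sum_{|n|\ge 1}(2\pi i n)^{s-1}e^{2\pi i n\alpha}\qquad(0<\alpha<1),$$ so that $$\int_0^1\zeta(s,\alpha)\,d\alpha=0,\qquad \int_0^1\zeta(s,\alpha)e^{-2\pi i n\alpha}\,d\alpha=(2\pi i n)^{s-1}\Gamma(1-s)\quad(n\in\mathbb Z,\ n\ne 0).$$ If moreover $\sigma<\frac12$, then Parseval's equation holds: $$\int_0^1|\zeta(s,\alpha)|^2\,d\alpha=|\Gamma(1-s)|^2\sum_{|n|\ge1}\left|(2\pi i n)^{s-1}\right|^2=2^{2\sigma-1}\pi^{2\sigma-2}\cosh(\pi t)\,|\Gamma(1-s)|^2\,\zeta(2-2\sigma).$$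
   Context: The Hurwitz zeta function $\zeta(s,\alpha)$ is defined by $\zeta(s,\alpha)=\sum_{n\ge 0}(n+\alpha)^{-s}$ for $\operatorname{Re}s>1$ and by analytic continuation in $s$; $\zeta(s)=\zeta(s,1)$ is the Riemann zeta function. Complex powers $(2\pi i n)^{s-1}$ use the principal value of the logarithm. The Fourier series on $[0,1]$ of an integrable function $f$ is $\sum_{n\in\mathbb Z}c_n e^{2\pi i n\alpha}$ with $c_n=\int_0^1 f(\alpha)e^{-2\pi i n\alpha}\,d\alpha$; sums over $|n|\ge1$ run over all nonzero integers and are limits of symmetric partial sums. *)

(* Defs.v *)
From mathcomp Require Import all_boot all_order all_algebra.
From mathcomp Require Export complex.
From mathcomp Require Import all_classical all_reals all_analysis.

Set Implicit Arguments.
Unset Strict Implicit.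
Unset Printing Implicit Defensive.

Import Order.TTheory GRing.Theory Num.Theory.
Import numFieldNormedType.Exports.
Local Open Scope classical_set_scope.
Local Open Scope ring_scope.
Local Open Scope complex_scope.

(* The modulus of [z : R[i]] as an element of [R] (in MathComp, [`|z|] lives
   in [R[i]]). The topology of [R[i]] is carried by its alias [R[i]^o]. *)
Notation cmod := ComplexField.Normc.normc.

Section ComplexFunctions.
Variable R : realType.
Implicit Types (z w : R[i]) (x : R).

Definition cosh x : R := (expR x + expR (- x)) / 2.

Definition cexp z : R[i] :=
  (expR (complex.Re z) * cos (complex.Im z)) +i*
  (expR (complex.Re z) * sin (complex.Im z)).

(* Principal argument, in ]-pi, pi]; the value at [z = 0] is meaningless. *)
Definition carg z : R :=
  let theta := acos (complex.Re z / cmod z) in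
  if 0 <= complex.Im z then theta else - theta.

Definition clog z : R[i] := ln (cmod z) +i* carg z.

Definition cpow z w : R[i] :=
  if z == 0 then (w == 0)%:R else cexp (w * clog z).

Definition cintegrable (D : set R) (f : R -> R[i]) : Prop :=
  lebesgue_measure.-integrable D (fun x => (complex.Re (f x))%:E) /\
  lebesgue_measure.-integrable D (fun x => (complex.Im (f x))%:E).

(* Lebesgue integral of a complex-valued function, meaningful when
   [cintegrable D f]. *)
Definition cintegral (D : set R) (f : R -> R[i]) : R[i] :=
  (\int[lebesgue_measure]_(x in D) complex.Re (f x)) +i*
  (\int[lebesgue_measure]_(x in D) complex.Im (f x)).

(* Euler's integral: this is the Gamma function on the half-plane 0 < Re z
   only. *)
Definition cgamma z : R[i] :=
  cintegral `]0, +oo[ (fun x => cpow x%:C (z - 1) * (expR (- x))%:C).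

Definition analytic_on (D : set R[i]) (f : R[i] -> R[i]) : Prop :=
  forall z, D z -> exists (a : nat -> R[i]) (r : R), 0 < r /\
    forall w, cmod (w - z) < r ->
      (series (fun n => a n * (w - z) ^+ n) : nat -> R[i]^o) @ \oo -->
        (f w : R[i]^o).

(* [F] is the analytic continuation to the complex plane minus 1 of
   [s |-> \sum_(n >= 0) (n + alpha) ^ (- s)], given for 1 < Re s. *)
Definition hurwitz_continuation (alpha : R) (F : R[i] -> R[i]) : Prop :=
  analytic_on [set s | s != 1] F /\
  forall s, 1 < complex.Re s ->
    (series (fun n => cpow (n%:R + alpha)%:C (- s)) : nat -> R[i]^o) @ \oo -->
      (F s : R[i]^o).

(* For [0 <= alpha] such a continuation exists and is unique away from the
   pole [s = 1], where the value chosen is arbitrary. For [alpha = 0] the term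
   [n = 0] of the series is 0. *)
Definition hurwitz_zeta (s : R[i]) (alpha : R) : R[i] :=
  xget (fun=> 0) [set F | hurwitz_continuation alpha F] s.

Definition riemann_zeta (s : R[i]) : R[i] := hurwitz_zeta s 1.

Definition two_pi_i (n : int) : R[i] := 0 +i* (2 * pi * n%:~R).

Definition fourier_coeff (f : R -> R[i]) (n : int) : R[i] :=
  cintegral `[0, 1] (fun alpha => f alpha * cexp (- (two_pi_i n * alpha%:C))).

Definition has_fourier_series (f : R -> R[i]) (c : int -> R[i]) : Prop :=
  cintegrable `[0, 1] f /\ forall n, fourier_coeff f n = c n.

End ComplexFunctions.

(* [N]-th symmetric partial sum of [c n] over the nonzero integers [n]. *)
Definition sym_psum (V : zmodType) (c : int -> V) (N : nat) : V :=
  \sum_(1 <= n < N.+1) (c n%:Z + c (- n%:Z)).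

(* Main.v *)
(* Euler-Maclaurin summation continues zeta(s, a) to Re s > -1. For -1 < Re s < 1
   its Fourier coefficients are computed by unfolding: the n-th one is
   \int_0^oo x^(-s) e^(-2 pi i n x) dx, and rotating the ray of integration turns it
   into Gamma(1 - s) (2 pi i n)^(s - 1). Pointwise convergence on 0 < a < 1 is Dini's
   criterion; for -1 < Re s < 0 it also holds at a = 1, because zeta(s, 0) = zeta(s, 1)
   there. For Re s < 0 the Fourier series converges absolutely and is analytic in s,
   so gluing the two descriptions along the strip -1 < Re s < 0 produces the analytic
   continuation, unique by the identity theorem. Parseval follows from Bessel's
   inequality in one direction and Fatou's lemma in the other. *)
Require Import Defs.
From mathcomp Require Import all_boot all_order all_algebra.
From mathcomp Require Import all_classical all_reals all_analysis.
From mathcomp Require Import measurable_realfun ring lra.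

Set Implicit Arguments.
Unset Strict Implicit.
Unset Printing Implicit Defensive.

Import Order.TTheory GRing.Theory Num.Theory.
Import numFieldNormedType.Exports.
Local Open Scope classical_set_scope.
Local Open Scope ring_scope.
Local Open Scope complex_scope.

(** The trapezoidal rule stops at Re s = -1, while the Fourier series converges absolutely only for
    Re s < 0: the strip between them is where the two descriptions can be compared. The value a = 1
    has to be carried along because [riemann_zeta] is that case, and since [hurwitz_zeta] is a
    choice among continuations, nothing is known about it before one has been exhibited. As
    [analytic_on] asks for power series, holomorphy is handled without complex derivatives or
    contour integrals: Cauchy's estimates come from orthogonality of characters on a circle and give
    Weierstrass' theorem for sums and integrals depending on s. The rotation of the ray is likewise
    a differentiation in a real parameter, in which an integration by parts removes the integral.
    For nonzero n the truncated integral \int_0^N x^(-s) e^(-2 pi i n x) dx has no suitable limit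
    when Re s <= 0; the Euler-Maclaurin corrections supply, up to a vanishing term, exactly the
    boundary term that repairs this. *)

Notation cRe := complex.Re.
Notation cIm := complex.Im.

(** * The modulus of complex numbers *)

Section Modulus.
Variable R : realType.
Implicit Types (z w : R[i]) (x y : R).

Lemma cReD z w : cRe (z + w) = cRe z + cRe w. Proof. by case: z; case: w. Qed.
Lemma cImD z w : cIm (z + w) = cIm z + cIm w. Proof. by case: z; case: w. Qed.
Lemma cReN z : cRe (- z) = - cRe z. Proof. by case: z. Qed.
Lemma cImN z : cIm (- z) = - cIm z. Proof. by case: z. Qed.
Lemma cReM z w : cRe (z * w) = cRe z * cRe w - cIm z * cIm w.
Proof. by case: z; case: w. Qed.
Lemma cImM z w : cIm (z * w) = cRe z * cIm w + cIm z * cRe w.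
Proof. by case: z => a b; case: w => c d. Qed.

Lemma complexP z w : cRe z = cRe w -> cIm z = cIm w -> z = w.
Proof. by case: z => a b; case: w => c d /= -> ->. Qed.

Lemma cRe_sum (I : Type) (r : seq I) (F : I -> R[i]) :
  cRe (\sum_(i <- r) F i) = \sum_(i <- r) cRe (F i).
Proof. by elim: r => [|i r IH]; rewrite ?big_nil// !big_cons cReD IH. Qed.
Lemma cIm_sum (I : Type) (r : seq I) (F : I -> R[i]) :
  cIm (\sum_(i <- r) F i) = \sum_(i <- r) cIm (F i).
Proof. by elim: r => [|i r IH]; rewrite ?big_nil// !big_cons cImD IH. Qed.

Lemma cmod_ge0 z : 0 <= cmod z.
Proof. by case: z => a b; exact: sqrtr_ge0. Qed.
Hint Resolve cmod_ge0 : core.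

Lemma cmod_sqr z : cmod z ^+ 2 = cRe z ^+ 2 + cIm z ^+ 2.
Proof. by case: z => a b /=; rewrite sqr_sqrtr// addr_ge0 ?sqr_ge0. Qed.

Lemma cmod0 : cmod (0 : R[i]) = 0. Proof. exact: ComplexField.Normc.normc0. Qed.
Lemma cmod1 : cmod (1 : R[i]) = 1. Proof. exact: ComplexField.Normc.normc1. Qed.
Lemma cmodM z w : cmod (z * w) = cmod z * cmod w.
Proof. exact: ComplexField.Normc.normcM. Qed.
Lemma cmodV z : cmod z^-1 = (cmod z)^-1.
Proof. exact: ComplexField.Normc.normcV. Qed.
Lemma cmodN z : cmod (- z) = cmod z.
Proof. by case: z => a b /=; rewrite !sqrrN. Qed.
Lemma cmodD z w : cmod (z + w) <= cmod z + cmod w.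
Proof. exact: (@le_normcD R). Qed.
Lemma cmodBC z w : cmod (z - w) = cmod (w - z).
Proof. by rewrite -cmodN opprB. Qed.
Lemma cmodB z w : cmod (z - w) <= cmod z + cmod w.
Proof. by rewrite (le_trans (cmodD _ _))// cmodN. Qed.
Lemma cmod_real x : cmod x%:C = `|x|.
Proof. by rewrite /= expr0n/= addr0 sqrtr_sqr. Qed.
Lemma cmodX z n : cmod (z ^+ n) = cmod z ^+ n.
Proof. by elim: n => [|n IH]; rewrite ?expr0 ?cmod1// !exprS cmodM IH. Qed.
Lemma cmod_eq0 z : (cmod z == 0) = (z == 0).
Proof.
apply/eqP/eqP => [/ComplexField.Normc.eq0_normc//|->]; exact: cmod0.
Qed.
Lemma cmod_gt0 z : (0 < cmod z) = (z != 0).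
Proof. by rewrite lt_def cmod_ge0 andbT cmod_eq0. Qed.
Lemma cRe_cmod z : `|cRe z| <= cmod z.
Proof.
by rewrite -(ler_pXn2r (n:=2))// ?nnegrE// cmod_sqr real_normK ?num_real// lerDl sqr_ge0.
Qed.
Lemma cIm_cmod z : `|cIm z| <= cmod z.
Proof.
by rewrite -(ler_pXn2r (n:=2))// ?nnegrE// cmod_sqr real_normK ?num_real// lerDr sqr_ge0.
Qed.
Lemma cmod_le z : cmod z <= `|cRe z| + `|cIm z|.
Proof.
rewrite -(ler_pXn2r (n:=2))// ?nnegrE ?addr_ge0// cmod_sqr sqrrD.
by rewrite !real_normK ?num_real// lerD2r lerDl mulrn_wge0// mulr_ge0.
Qed.
Lemma cmod_nat n : cmod (n%:R : R[i]) = n%:R.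
Proof.
have -> : (n%:R : R[i]) = (n%:R : R)%:C by rewrite rmorph_nat.
by rewrite cmod_real ger0_norm.
Qed.
Lemma cmod_sum (I : Type) (r : seq I) (F : I -> R[i]) :
  cmod (\sum_(i <- r) F i) <= \sum_(i <- r) cmod (F i).
Proof.
elim: r => [|i r IH]; first by rewrite !big_nil cmod0.
by rewrite !big_cons (le_trans (cmodD _ _))// lerD2l.
Qed.
Lemma cmod_lerB z w : cmod z - cmod w <= cmod (z - w).
Proof. by rewrite lerBlDr -{1}(subrK w z) cmodD. Qed.

(** Multiplying by a unimodular number puts z on the nonnegative real axis. This reduces bounds on
    complex increments and integrals to bounds on one real part, without losing a constant. *)
Lemma cmod_rotate z : exists2 u, cmod u = 1 & cmod z = cRe (u * z).
Proof.
have [->|z0] := eqVneq z 0; first by exists 1; rewrite ?cmod1// mulr0 cmod0.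
have m0 : cmod z != 0 by rewrite cmod_eq0.
exists ((cmod z)^-1%:C * z^*%C).
  rewrite cmodM cmod_real normfV ger0_norm//.
  by case: z z0 m0 => a b z0 m0 /=; rewrite sqrrN mulVf.
have -> : cRe ((cmod z)^-1%:C * z^*%C * z) = (cmod z)^-1 * cmod z ^+ 2.
  by rewrite cmod_sqr; case: z {z0 m0} => a b /=; ring.
by rewrite expr2 mulrA mulVf// mul1r.
Qed.

End Modulus.
#[export] Hint Resolve cmod_ge0 : core.
#[export] Hint Extern 0 (is_true (@Order.le _ _ _ (ComplexField.Normc.normc _))) => solve [apply: cmod_ge0] : core.

(** * Limits and series of complex numbers *)

Section ComplexLimits.
Variable R : realType.
Implicit Types (u v : nat -> R[i]) (l m z : R[i]).

(** The norm of [R[i]] takes values in [R[i]], so the topological definition of convergence has a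
    complex epsilon. Going through the real number [cmod] makes real squeezing arguments available;
    [ccvgE] translates. *)
Definition ccvg u l := (fun n => cmod (u n - l)) @ \oo --> (0 : R).

Lemma ccvgP u l : ccvg u l <-> forall e, 0 < e -> \forall n \near \oo, cmod (u n - l) < e.
Proof.
rewrite /ccvg; split.
  move=> /cvgr0Pnorm_lt H e e0; have := H e e0; apply: filterS => n /=.
  by rewrite ger0_norm.
move=> H; apply/cvgr0Pnorm_lt => e e0; have := H e e0; apply: filterS => n.
by rewrite ger0_norm.
Qed.

Lemma ccvgE u l : ccvg u l <-> (u : nat -> R[i]^o) @ \oo --> (l : R[i]^o).
Proof.
rewrite ccvgP; split => H.
  apply/cvgrPdist_lt => e e0.
  (* A positive element of [R[i]] is real, so the complex epsilon is its own real part. *)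
  have [er ei] : 0 < cRe e /\ cIm e = 0.
    by move: e0; rewrite ltcE/= => /andP[/eqP-> ->].
  have := H _ er; apply: filterS => n; rewrite cmodBC => Hn.
  by rewrite /Num.norm/= ltcE/= ei eqxx.
move=> e e0; move/cvgrPdist_lt: H => /(_ e%:C).
rewrite ltcR => /(_ e0); apply: filterS => n; rewrite cmodBC.
by rewrite /Num.norm/= ltcR.
Qed.

Lemma ccvg_squeeze u l (b : nat -> R) :
  (\forall n \near \oo, cmod (u n - l) <= b n) -> b @ \oo --> (0 : R) -> ccvg u l.
Proof.
move=> ub b0; apply: (squeeze_cvgr (f := cst 0) _ (@cvg_cst _ _ _ _ _) b0).
by near=> n; rewrite cmod_ge0/=; near: n; exact: ub.
Unshelve. all: by end_near. Qed.

Lemma ccvg_parts u l : ccvg u l <->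
  (fun n => cRe (u n)) @ \oo --> cRe l /\ (fun n => cIm (u n)) @ \oo --> cIm l.
Proof.
split=> [H|[/cvgrPdist_le Hr /cvgrPdist_le Hi]].
  split; apply/cvgrPdist_lt => e e0; move/ccvgP: H => /(_ _ e0);
    apply: filterS => n; apply: le_lt_trans; rewrite cmodBC.
    by rewrite -cReN -cReD cRe_cmod.
  by rewrite -cImN -cImD cIm_cmod.
apply/ccvgP => e e0; have e3 : 0 < e / 3 by rewrite divr_gt0.
near=> n; have A : `|cRe l - cRe (u n)| <= e / 3 by near: n; exact: Hr.
have B : `|cIm l - cIm (u n)| <= e / 3 by near: n; exact: Hi.
rewrite cmodBC (le_lt_trans (cmod_le _))// cReD cImD cReN cImN.
by rewrite (le_lt_trans (lerD A B))//; lra.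
Unshelve. all: by end_near. Qed.

Lemma ccvg_unique u l m : ccvg u l -> ccvg u m -> l = m.
Proof.
move=> /ccvg_parts[a b] /ccvg_parts[c d]; apply: complexP.
  exact: (cvg_unique _ a c).
exact: (cvg_unique _ b d).
Qed.

Lemma ccvg_cst l : ccvg (fun=> l) l.
Proof. by apply/ccvg_parts; split; exact: cvg_cst. Qed.

Lemma ccvgD u v l m : ccvg u l -> ccvg v m -> ccvg (fun n => u n + v n) (l + m).
Proof.
move=> /ccvgE a /ccvgE b; apply/ccvgE; exact: cvgD a b.
Qed.

Lemma ccvgN u l : ccvg u l -> ccvg (fun n => - u n) (- l).
Proof. by move=> /ccvgE a; apply/ccvgE; exact: cvgN a. Qed.

Lemma ccvgB u v l m : ccvg u l -> ccvg v m -> ccvg (fun n => u n - v n) (l - m).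
Proof. by move=> a b; apply: ccvgD => //; exact: ccvgN. Qed.

Lemma ccvgM u v l m : ccvg u l -> ccvg v m -> ccvg (fun n => u n * v n) (l * m).
Proof.
move=> /ccvg_parts[a b] /ccvg_parts[c d]; apply/ccvg_parts; split.
  rewrite cReM; under eq_fun do rewrite cReM.
  by apply: cvgB; exact: cvgM.
rewrite cImM; under eq_fun do rewrite cImM.
by apply: cvgD; exact: cvgM.
Qed.

Lemma ccvgZ l u m : ccvg u m -> ccvg (fun n => l * u n) (l * m).
Proof. by move=> h; apply: ccvgM => //; exact: ccvg_cst. Qed.

Lemma ccvg_shiftS u l : ccvg (fun n => u n.+1) l <-> ccvg u l.
Proof. by rewrite /ccvg (cvg_shiftS (fun n => cmod (u n - l))). Qed.

Lemma ccvg_mod u l : ccvg u l -> (fun n => cmod (u n)) @ \oo --> cmod l.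
Proof.
move=> h; apply/cvgrPdist_lt => e e0; move/ccvgP: h => /(_ _ e0).
apply: filterS => n; apply: le_lt_trans; rewrite ler_norml.
by rewrite lerNl opprB cmod_lerB cmodBC cmod_lerB.
Qed.

Lemma ccvg_le u l (B : R) : ccvg u l -> (\forall n \near \oo, cmod (u n) <= B) -> cmod l <= B.
Proof.
move=> /ccvg_mod h hB; rewrite -(cvg_lim _ h)//; apply: limr_le => //.
by apply/cvg_ex; exists (cmod l).
Qed.

Definition psum (u : nat -> R[i]) (n : nat) : R[i] := \sum_(k < n) u k.
Definition has_csum u l := ccvg (psum u) l.

Lemma psumE u n : psum u n = series u n.
Proof. by rewrite /psum seriesEord. Qed.

Lemma has_csum_dominated u (b : nat -> R) : (forall n, cmod (u n) <= b n) ->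
  cvgn (series b) ->
  exists2 l, has_csum u l & cmod l <= limn (series b).
Proof.
move=> ub cb.
have part (p : R[i] -> R) : (forall z, `|p z| <= cmod z) ->
    cvgn (series (fun n => p (u n))).
  move=> hp; apply: normed_cvg; apply: series_le_cvg cb => n //=.
    exact: le_trans (ub n).
  exact: le_trans (ub n).
have /cvg_ex[lr hr] := part _ (@cRe_cmod R).
have /cvg_ex[li hi] := part _ (@cIm_cmod R).
have h : has_csum u (lr +i* li).
  apply/ccvg_parts; split => /=.
    rewrite (_ : (fun n => _) = series (fun n => cRe (u n)))//.
    by apply/funext => n; rewrite seriesEord cRe_sum.
  rewrite (_ : (fun n => _) = series (fun n => cIm (u n)))//.
  by apply/funext => n; rewrite seriesEord cIm_sum.
exists (lr +i* li) => //; apply: (ccvg_le h); near=> n.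
apply: (le_trans (cmod_sum _ _)); apply: (@le_trans _ _ (series b n)).
  by rewrite seriesEord ler_sum.
apply: nondecreasing_cvgn_le => //; apply: nondecreasing_series => k _ _.
exact: le_trans (ub k).
Unshelve. all: by end_near. Qed.

Lemma has_csumD u v l m : has_csum u l -> has_csum v m ->
  has_csum (fun n => u n + v n) (l + m).
Proof.
move=> a b; rewrite /has_csum (_ : psum _ = fun n => psum u n + psum v n).
  exact: ccvgD.
by apply/funext => n; rewrite /psum big_split.
Qed.

Lemma has_csumZ c u l : has_csum u l -> has_csum (fun n => c * u n) (c * l).
Proof.
move=> a; rewrite /has_csum (_ : psum _ = fun n => c * psum u n).
  exact: ccvgZ.
by apply/funext => n; rewrite /psum mulr_sumr.
Qed.

End ComplexLimits.

(** * Derivatives along the real line, the exponential series, complex powers *)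

Section ComplexExp.
Variable R : realType.
Implicit Types (z w : R[i]) (x y : R).

Lemma cexpD z w : cexp (z + w) = cexp z * cexp w.
Proof.
case: z => a b; case: w => c d; apply: complexP => /=.
  by rewrite expRD cosD; ring.
by rewrite expRD sinD; ring.
Qed.
Lemma cexp0 : cexp (0 : R[i]) = 1.
Proof. by apply: complexP => /=; rewrite expR0 ?cos0 ?sin0 ?mulr0 ?mul1r. Qed.
Lemma cmod_cexp z : cmod (cexp z) = expR (cRe z).
Proof.
rewrite /cexp /= !exprMn -mulrDr cos2Dsin2 mulr1 sqrtr_sqr.
by rewrite ger0_norm ?expR_ge0.
Qed.
Lemma cexp_neq0 z : cexp z != 0.
Proof. by rewrite -cmod_gt0 cmod_cexp expR_gt0. Qed.
Lemma cexpN z : cexp (- z) = (cexp z)^-1.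
Proof.
apply: (mulfI (cexp_neq0 z)); rewrite -cexpD subrr cexp0 mulfV//.
exact: cexp_neq0.
Qed.
Lemma cexp_real x : cexp x%:C = (expR x)%:C.
Proof. by apply: complexP => /=; rewrite ?cos0 ?sin0 ?mulr0 ?mulr1. Qed.
Lemma cexpM_natl n z : cexp (n%:R * z) = cexp z ^+ n.
Proof.
elim: n => [|n IH]; first by rewrite mul0r cexp0 expr0.
by rewrite -natr1 mulrDl mul1r cexpD IH exprSr.
Qed.
Lemma cmod_cexp_le z : cmod (cexp z) <= expR (cmod z).
Proof. by rewrite cmod_cexp ler_expR (le_trans (ler_norm _))// cRe_cmod. Qed.

(** Derivative in a real variable, taken componentwise. No derivative in a complex variable is used
    anywhere: dependence on s is always expressed by power series. *)
Definition cderive (F : R -> R[i]) x (l : R[i]) :=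
  is_derive x 1 (fun y => cRe (F y)) (cRe l) /\
  is_derive x 1 (fun y => cIm (F y)) (cIm l).

Lemma is_derive_eq' (f : R -> R) x l l' : is_derive x 1 f l -> l = l' ->
  is_derive x 1 f l'.
Proof. by move=> h <-. Qed.

Lemma cderive_eq F x l l' : cderive F x l -> l = l' -> cderive F x l'.
Proof. by move=> h <-. Qed.

Lemma cderive_ext F G x l : F =1 G -> cderive F x l -> cderive G x l.
Proof. by move/funext => ->. Qed.

Lemma cderive_cst z x : cderive (fun=> z) x 0.
Proof. by split; exact: is_derive_cst. Qed.

Lemma cderive_real (f : R -> R) x l : is_derive x 1 f l ->
  cderive (fun y => (f y)%:C) x l%:C.
Proof. by move=> h; split => //=; exact: is_derive_cst. Qed.

Lemma cderive_id x : cderive (fun y => y%:C) x 1.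
Proof. by apply: (@cderive_real id); exact: is_derive_id. Qed.

Lemma cderiveD F G x l m : cderive F x l -> cderive G x m ->
  cderive (fun y => F y + G y) x (l + m).
Proof.
move=> [a b] [c d]; split.
  rewrite cReD (_ : (fun y => _) = (fun y => cRe (F y)) + (fun y => cRe (G y))).
    exact: is_deriveD.
  by apply/funext => y; rewrite cReD.
rewrite cImD (_ : (fun y => _) = (fun y => cIm (F y)) + (fun y => cIm (G y))).
  exact: is_deriveD.
by apply/funext => y; rewrite cImD.
Qed.

Lemma cderiveM F G x l m : cderive F x l -> cderive G x m ->
  cderive (fun y => F y * G y) x (l * G x + F x * m).
Proof.
move=> [a b] [c d]; split.
  rewrite (_ : (fun y => _) = (fun y => cRe (F y)) * (fun y => cRe (G y)) -
     (fun y => cIm (F y)) * (fun y => cIm (G y))).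
    apply: is_derive_eq.
    by rewrite cReD !cReM /GRing.scale/=; ring.
  by apply/funext => y; rewrite cReM.
rewrite (_ : (fun y => _) = (fun y => cRe (F y)) * (fun y => cIm (G y)) +
     (fun y => cIm (F y)) * (fun y => cRe (G y))).
  apply: is_derive_eq.
  by rewrite cImD !cImM /GRing.scale/=; ring.
by apply/funext => y; rewrite cImM.
Qed.

Lemma cderiveZ z F x l : cderive F x l -> cderive (fun y => z * F y) x (z * l).
Proof.
move=> h; apply: (cderive_eq (cderiveM (cderive_cst z x) h)).
by rewrite mul0r add0r.
Qed.

Lemma cderiveN F x l : cderive F x l -> cderive (fun y => - F y) x (- l).
Proof.
move=> h; rewrite (_ : (fun y => _) = fun y => -1 * F y).
  by rewrite -[- l]mulN1r; exact: cderiveZ.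
by apply/funext => y; rewrite mulN1r.
Qed.

Lemma cderiveB F G x l m : cderive F x l -> cderive G x m ->
  cderive (fun y => F y - G y) x (l - m).
Proof. by move=> a b; apply: cderiveD => //; exact: cderiveN. Qed.

Lemma cderive_cexp F x l : cderive F x l ->
  cderive (fun y => cexp (F y)) x (l * cexp (F x)).
Proof.
move=> [a b]; rewrite /cexp.
set f := (fun y => cRe (F y)) in a *; set g := (fun y => cIm (F y)) in b *.
have e : is_derive x 1 (expR \o f) (cRe l * expR (f x)).
  by apply: is_derive_eq; rewrite mulrC.
have c : is_derive x 1 (cos \o g) (- (cIm l * sin (g x))).
  by apply: is_derive_eq; rewrite mulrC mulrN.
have s : is_derive x 1 (sin \o g) (cIm l * cos (g x)).
  by apply: is_derive_eq; rewrite mulrC.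
split => /=.
  rewrite (_ : (fun y => _) = (expR \o f) * (cos \o g))//.
  apply: is_derive_eq; rewrite cReM /GRing.scale/=.
  by rewrite -/(f x) -/(g x); ring.
rewrite (_ : (fun y => _) = (expR \o f) * (sin \o g))//.
apply: is_derive_eq; rewrite cImM /GRing.scale/=.
by rewrite -/(f x) -/(g x); ring.
Qed.

Lemma cderive_sum n (F : nat -> R -> R[i]) x (l : nat -> R[i]) :
  (forall k, cderive (F k) x (l k)) ->
  cderive (fun y => \sum_(k < n) F k y) x (\sum_(k < n) l k).
Proof.
move=> h; elim: n => [|n IH].
  rewrite big_ord0 (_ : (fun y => _) = fun=> 0); first exact: cderive_cst.
  by apply/funext => y; rewrite big_ord0.
rewrite big_ord_recr/= (_ : (fun y => _) = fun y => \sum_(k < n) F k y + F n y).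
  exact: cderiveD.
by apply/funext => y; rewrite big_ord_recr.
Qed.

Lemma cderiveX F x l n : cderive F x l ->
  cderive (fun y => F y ^+ n.+1) x (n.+1%:R * l * F x ^+ n).
Proof.
move=> h; elim: n => [|n IH].
  by rewrite expr0 mulr1 mul1r; exact: h.
rewrite (_ : (fun y => _) = fun y => F y * F y ^+ n.+1).
  apply: (cderive_eq (cderiveM h IH)).
  by rewrite exprS -[in RHS]natr1; ring.
by apply/funext => y; rewrite exprS.
Qed.

Lemma cderive_continuous F x l : cderive F x l ->
  {for x, continuous (fun y => cRe (F y))} /\ {for x, continuous (fun y => cIm (F y))}.
Proof.
by case=> a b; split; apply: differentiable_continuous; apply/derivable1_diffP.
Qed.

(** After a rotation the left side is the real part of u (F b - F a), and the real function G - Re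
    (u F) has a nonnegative derivative. The majorant G may vary, which Jordan's lemma exploits
    below. *)
Lemma mean_value_le (F : R -> R[i]) (G : R -> R) (F' : R -> R[i]) (G' : R -> R) a b :
  a <= b ->
  (forall x, a <= x <= b -> cderive F x (F' x)) ->
  (forall x, a <= x <= b -> is_derive x 1 G (G' x)) ->
  (forall x, a <= x <= b -> cmod (F' x) <= G' x) ->
  cmod (F b - F a) <= G b - G a.
Proof.
move=> ab dF dG FG; have [u u1 ->] := cmod_rotate (F b - F a).
pose H y := G y - cRe (u * F y); pose H' y := G' y - cRe (u * F' y).
suff : 0 <= H b - H a by rewrite /H mulrBr cReD cReN; lra.
have dH x : a <= x <= b -> is_derive x 1 H (H' x).
  move=> xab; have [h _] := cderiveZ u (dF _ xab).
  by have := dG _ xab => h2; apply: is_deriveB.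
have [||c /[!in_itv]/= cab ->] := @MVT_segment _ H H' a b ab.
- by move=> x /[!in_itv]/= /andP[ax xb]; apply: dH; rewrite !ltW.
- apply: derivable_within_continuous => x /[!in_itv]/= xab.
  by have [] := dH _ xab.
rewrite mulr_ge0 ?subr_ge0//.
rewrite (le_trans (ler_norm _))// (le_trans (cRe_cmod _))// cmodM u1 mul1r.
exact: FG.
Qed.

Definition expc (z : R[i]) (k : nat) : R[i] := z ^+ k / k`!%:R.

Lemma cmod_expc z k : cmod (expc z k) = exp_coeff (cmod z) k.
Proof. by rewrite /expc /exp_coeff/= cmodM cmodX cmodV cmod_nat. Qed.

(** [cexp] is built from real functions, so its power series has to be proved. The derivative in u
    of e^(-u z) times the truncated series at u z telescopes to the single monomial - z e^(-u z) (u
    z)^n / n!, and the mean value inequality on [0, 1] bounds the error by the n-th coefficient. *)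
Lemma cexp_csum z : has_csum (expc z) (cexp z).
Proof.
apply/ccvg_shiftS.
pose F n (u : R) := cexp (- (u%:C * z)) * \sum_(k < n.+1) expc (u%:C * z) k.
have dl u : cderive (fun u : R => u%:C * z) u z.
  apply: (cderive_eq (cderiveM (cderive_id u) (cderive_cst z u))).
  by rewrite mulr0 addr0 mul1r.
have dF n u : cderive (F n) u (- z * cexp (- (u%:C * z)) * expc (u%:C * z) n).
  have dE k : cderive (fun u : R => expc (u%:C * z) k) u
      (if k is k'.+1 then z * expc (u%:C * z) k' else 0).
    case: k => [|k].
      rewrite (_ : (fun u => _) = fun=> 1); first exact: cderive_cst.
      by apply/funext => y; rewrite /expc expr0 fact0 divr1.
    rewrite /expc; apply: (cderive_eq (cderiveM (cderiveX k (dl u)) (cderive_cst _ u))).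
    rewrite mulr0 addr0 factS natrM invfM.
    have kn0 : (k.+1%:R : R[i]) != 0 by rewrite pnatr_eq0.
    have kf0 : (k`!%:R : R[i]) != 0 by rewrite pnatr_eq0 -lt0n fact_gt0.
    by field; rewrite kf0 addrC natr1 kn0.
  have dS := cderive_sum n.+1 dE.
  apply: (cderive_eq (cderiveM (cderive_cexp (cderiveN (dl u))) dS)).
  rewrite [in X in _ + X]big_ord_recl/= add0r big_ord_recr/=.
  rewrite -mulr_sumr; ring.
have bnd n : cmod (psum (expc z) n.+1 - cexp z) <=
    expR (cmod z) ^+ 2 * cmod z * exp_coeff (cmod z) n.
  have F0 : F n 0 = 1.
    rewrite /F mul0r oppr0 cexp0 mul1r big_ord_recl/= big1.
      by rewrite addr0 /expc expr0 fact0 divr1.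
    by move=> i _; rewrite /expc exprS !mul0r.
  have -> : psum (expc z) n.+1 - cexp z = cexp z * (F n 1 - F n 0).
    rewrite F0 /F mul1r mulrBr mulr1 mulrA -cexpD subrr cexp0 mul1r.
    by congr (_ - _); apply: eq_bigr => i _; rewrite mul1r.
  rewrite cmodM expr2 -!mulrA ler_pM ?cmod_cexp_le//.
  set C := (X in _ <= X).
  have -> : C = C * 1 - C * 0 by rewrite mulr0 subr0 mulr1.
  apply: (@mean_value_le (F n) (fun x => C * x) _ (fun=> C) _ _ ler01 (fun x _ => dF n x)).
    move=> x _; rewrite (_ : (fun _ => _) = C *: (@id R))//.
    by apply: is_derive_eq; rewrite /GRing.scale/= mulr1.
  move=> x /andP[x0 x1].
  have le1 : cmod (x%:C * z) <= cmod z.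
    by rewrite cmodM cmod_real ger0_norm// ler_piMl.
  rewrite cmodM cmodM cmodN /C [cmod z * _]mulrC -mulrA ler_pM ?mulr_ge0//.
    by rewrite (le_trans (cmod_cexp_le _))// ler_expR cmodN.
  rewrite cmod_expc /exp_coeff/= ler_wpM2l// ler_wpM2r ?invr_ge0//.
  by rewrite lerXn2r ?nnegrE.
apply: (ccvg_squeeze (b := fun n => expR (cmod z) ^+ 2 * cmod z * exp_coeff (cmod z) n)).
  by near=> n.
rewrite -(mulr0 (expR (cmod z) ^+ 2 * cmod z)).
by apply: cvgM; [exact: cvg_cst|exact: cvg_exp_coeff].
Unshelve. all: by end_near. Qed.

(* [x ^ z] for [0 < x]; the value for [x <= 0] is 1. *)
Definition rpow (x : R) (z : R[i]) : R[i] := cexp (z * (ln x)%:C).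

Lemma carg_pos x : 0 < x -> carg (x%:C) = 0.
Proof.
move=> x0; rewrite /carg cmod_real /= lexx gtr0_norm// divff ?gt_eqF//.
exact: acos1.
Qed.

Lemma cpow_pos x z : 0 < x -> cpow (x%:C) z = rpow x z.
Proof.
move=> x0; rewrite /cpow ifF; last first.
  by rewrite eq_complex/= eqxx andbT gt_eqF.
by rewrite /rpow /clog carg_pos// cmod_real gtr0_norm.
Qed.

Lemma cmod_rpow x z : 0 < x -> cmod (rpow x z) = x `^ (cRe z).
Proof.
move=> x0; rewrite /rpow cmod_cexp cReM/= mulr0 subr0 /powR ifF//.
by rewrite gt_eqF.
Qed.

Lemma rpowD x z w : rpow x (z + w) = rpow x z * rpow x w.
Proof. by rewrite /rpow mulrDl cexpD. Qed.

Lemma rpow1 x : 0 < x -> rpow x 1 = x%:C.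
Proof. by move=> x0; rewrite /rpow mul1r cexp_real lnK. Qed.

Lemma rpowS x z : 0 < x -> rpow x (z + 1) = x%:C * rpow x z.
Proof. by move=> x0; rewrite rpowD rpow1// mulrC. Qed.

Lemma cderive_rpow x z : 0 < x -> cderive (fun y => rpow y z) x (z * rpow x (z - 1)).
Proof.
move=> x0; have dl := is_derive1_ln x0.
apply: (cderive_eq (cderive_cexp (cderiveZ z (cderive_real dl)))).
rewrite -[LHS]/(z * x^-1%:C * rpow x z) -[in LHS](subrK 1 z) rpowS//.
rewrite subrK -mulrA; congr (_ * _).
by rewrite mulrA -rmorphM/= mulVf ?gt_eqF// mul1r.
Qed.

End ComplexExp.

(** * Measurability of complex-valued functions *)

Section ComplexMeasurable.
Variable R : realType.
Notation mu := (@lebesgue_measure R).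
Notation T := (measurableTypeR R).
Implicit Types (D E : set T) (f g : R -> R[i]) (c : R[i]).

Definition cmeasurable (D : set T) (f : R -> R[i]) :=
  measurable_fun D (fun x => cRe (f x)) /\ measurable_fun D (fun x => cIm (f x)).

Lemma cmeasurable_cst D c : cmeasurable D (fun=> c).
Proof. by split; exact: measurable_cst. Qed.

Lemma cmeasurable_real D (h : R -> R) : measurable_fun D h ->
  cmeasurable D (fun x => (h x)%:C).
Proof. by move=> mh; split => //=; exact: measurable_cst. Qed.

Lemma cmeasurable_id D : cmeasurable D (fun x => x%:C).
Proof. by apply: (@cmeasurable_real _ id); exact: measurable_id. Qed.

Lemma cmeasurableD D f g : cmeasurable D f -> cmeasurable D g ->
  cmeasurable D (fun x => f x + g x).
Proof.
move=> [a b] [c d]; split.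
  by under eq_fun do rewrite cReD; exact: measurable_funD.
by under eq_fun do rewrite cImD; exact: measurable_funD.
Qed.

Lemma cmeasurableM D f g : cmeasurable D f -> cmeasurable D g ->
  cmeasurable D (fun x => f x * g x).
Proof.
move=> [a b] [c d]; split.
  under eq_fun do rewrite cReM.
  by apply: measurable_funB; exact: measurable_funM.
under eq_fun do rewrite cImM.
by apply: measurable_funD; exact: measurable_funM.
Qed.

Lemma cmeasurableZ D c f : cmeasurable D f -> cmeasurable D (fun x => c * f x).
Proof. by apply: cmeasurableM; exact: cmeasurable_cst. Qed.

Lemma cmeasurableN D f : cmeasurable D f -> cmeasurable D (fun x => - f x).
Proof.
by move=> h; under eq_fun do rewrite -mulN1r; exact: cmeasurableZ.
Qed.

Lemma cmeasurableB D f g : cmeasurable D f -> cmeasurable D g ->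
  cmeasurable D (fun x => f x - g x).
Proof. by move=> a b; apply: cmeasurableD => //; exact: cmeasurableN. Qed.

Lemma cmeasurableX D f n : cmeasurable D f -> cmeasurable D (fun x => f x ^+ n).
Proof.
move=> h; elim: n => [|n IH]; first exact: cmeasurable_cst.
by under eq_fun do rewrite exprS; exact: cmeasurableM.
Qed.

Lemma cmeasurable_cexp D f : cmeasurable D f -> cmeasurable D (fun x => cexp (f x)).
Proof.
move=> [a b]; rewrite /cexp; split => /=; apply: measurable_funM.
- exact: measurableT_comp.
- by apply: measurableT_comp => //; apply: continuous_measurable_fun; exact: continuous_cos.
- exact: measurableT_comp.
- by apply: measurableT_comp => //; apply: continuous_measurable_fun; exact: continuous_sin.
Qed.

Lemma cmeasurable_rpow D z : cmeasurable D (fun x => rpow x z).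
Proof.
apply: cmeasurable_cexp; apply: cmeasurableZ; apply: cmeasurable_real.
apply: measurable_funTS; exact: measurable_ln.
Qed.

Lemma cmeasurable_shift z a : cmeasurable (setT : set T) (fun x => rpow (a + x) z).
Proof.
apply: cmeasurable_cexp; apply: cmeasurableZ; apply: cmeasurable_real.
apply: (measurableT_comp (@measurable_ln R)).
by apply: (@measurable_funD _ _ _ _ (cst a) id).
Qed.

Lemma cmeasurable_cvg D (F : nat -> R -> R[i]) f : measurable D ->
  (forall n, cmeasurable D (F n)) ->
  (forall x, D x -> ccvg (F ^~ x) (f x)) -> cmeasurable D f.
Proof.
move=> mD mF Ff; split.
  apply: (@measurable_fun_cvg _ _ _ _ (fun n x => cRe (F n x))) => [n|x Dx].
    by case: (mF n).
  by have /ccvg_parts[] := Ff x Dx.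
apply: (@measurable_fun_cvg _ _ _ _ (fun n x => cIm (F n x))) => [n|x Dx].
  by case: (mF n).
by have /ccvg_parts[] := Ff x Dx.
Qed.

Lemma cmeasurableS D E f : measurable D -> E `<=` D -> cmeasurable D f ->
  cmeasurable E f.
Proof. by move=> mD ED [a b]; split; apply: measurable_funS mD ED _. Qed.

Lemma measurable_cmod D f : measurable D -> cmeasurable D f ->
  measurable_fun D (fun x => cmod (f x)).
Proof.
move=> mD [a b].
rewrite (_ : (fun x => _) = Num.sqrt \o (fun x => cRe (f x) ^+ 2 + cIm (f x) ^+ 2)).
  apply: measurableT_comp; last by apply: measurable_funD; exact: measurable_funX.
  by apply: continuous_measurable_fun; exact: sqrt_continuous.
by apply/funext => x /=; case: (f x).
Qed.

End ComplexMeasurable.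

(** * Integration of complex-valued functions *)

Section ComplexIntegral.
Variable R : realType.
Notation mu := (@lebesgue_measure R).
Notation T := (measurableTypeR R).
Implicit Types (D E : set T) (f g : R -> R[i]) (c : R[i]).

Lemma cintegrable_le D f (h : R -> R) : measurable D -> cmeasurable D f ->
  mu.-integrable D (EFin \o h) -> (forall x, D x -> cmod (f x) <= h x) ->
  cintegrable D f.
Proof.
move=> mD [a b] ih fh; split.
  apply: (le_integrable mD _ _ ih) => [|x Dx]; first exact/measurable_EFinP.
  rewrite /= lee_fin (le_trans (cRe_cmod _))//.
  by rewrite (le_trans (fh _ Dx))// ler_norm.
apply: (le_integrable mD _ _ ih) => [|x Dx]; first exact/measurable_EFinP.
rewrite /= lee_fin (le_trans (cIm_cmod _))//.
by rewrite (le_trans (fh _ Dx))// ler_norm.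
Qed.

Lemma cintegrable_measurable D f : cintegrable D f -> cmeasurable D f.
Proof.
by move=> [/(measurable_int mu) a /(measurable_int mu) b]; split;
  exact/measurable_EFinP.
Qed.

Lemma integrable_cmod D f : measurable D -> cintegrable D f ->
  mu.-integrable D (EFin \o (fun x => cmod (f x))).
Proof.
move=> mD fi; have [ir ii] := fi.
have ih := integrableD mD (integrable_abse ir) (integrable_abse ii).
apply: (le_integrable mD _ _ ih).
  by apply/measurable_EFinP; apply: measurable_cmod => //; exact: cintegrable_measurable.
move=> x Dx /=; rewrite lee_fin ger0_norm ?cmod_ge0//.
by rewrite (le_trans (cmod_le _))// ler_norm.
Qed.

Lemma cintegrableS D E f : measurable D -> measurable E -> E `<=` D ->
  cintegrable D f -> cintegrable E f.
Proof. by move=> mD mE ED [a b]; split; exact: integrableS ED _. Qed.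

Lemma eq_cintegrable D f g : measurable D -> {in D, f =1 g} ->
  cintegrable D f -> cintegrable D g.
Proof.
move=> mD fg [a b]; split; [move: a|move: b]; apply: eq_integrable => // x xD;
  by rewrite fg.
Qed.

Lemma eq_cintegral D f g : {in D, f =1 g} -> cintegral D f = cintegral D g.
Proof.
by move=> fg; rewrite /cintegral; congr (_ +i* _); apply: eq_Rintegral => x xD;
  rewrite fg.
Qed.

Lemma cintegrableD D f g : measurable D -> cintegrable D f -> cintegrable D g ->
  cintegrable D (fun x => f x + g x).
Proof.
move=> mD [a b] [c d]; split.
  by under eq_fun do rewrite cReD EFinD; exact: integrableD.
by under eq_fun do rewrite cImD EFinD; exact: integrableD.
Qed.

Lemma cintegralD D f g : measurable D -> cintegrable D f -> cintegrable D g ->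
  cintegral D (fun x => f x + g x) = cintegral D f + cintegral D g.
Proof.
move=> mD [a b] [c d]; apply: complexP => /=.
  by under eq_Rintegral do rewrite cReD; rewrite RintegralD.
by under eq_Rintegral do rewrite cImD; rewrite RintegralD.
Qed.

Lemma cintegrableZ D c f : measurable D -> cintegrable D f ->
  cintegrable D (fun x => c * f x).
Proof.
move=> mD fi; have ih := integrableZl mD (cmod c) (integrable_cmod mD fi).
apply: (cintegrable_le mD _ ih); first exact/cmeasurableZ/cintegrable_measurable.
by move=> x Dx /=; rewrite cmodM.
Qed.

Lemma cintegralZ D c f : measurable D -> cintegrable D f ->
  cintegral D (fun x => c * f x) = c * cintegral D f.
Proof.
move=> mD [a b].
have zl (k : R) (h : R -> R) : mu.-integrable D (EFin \o h) ->
    mu.-integrable D (EFin \o (fun x => k * h x)).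
  by move=> ih; exact: (integrableZl mD k ih).
apply: complexP.
  rewrite cReM /=; under eq_Rintegral do rewrite cReM.
  by rewrite RintegralB ?RintegralZl//; exact: zl.
rewrite cImM /=; under eq_Rintegral do rewrite cImM.
by rewrite RintegralD ?RintegralZl//; exact: zl.
Qed.

Lemma cintegrableN D f : measurable D -> cintegrable D f ->
  cintegrable D (fun x => - f x).
Proof.
by move=> mD fi; under eq_fun do rewrite -mulN1r; exact: cintegrableZ.
Qed.

Lemma cintegrableB D f g : measurable D -> cintegrable D f -> cintegrable D g ->
  cintegrable D (fun x => f x - g x).
Proof. by move=> mD a b; apply: cintegrableD => //; exact: cintegrableN. Qed.

Lemma cintegralB D f g : measurable D -> cintegrable D f -> cintegrable D g ->
  cintegral D (fun x => f x - g x) = cintegral D f - cintegral D g.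
Proof.
move=> mD a b; rewrite cintegralD//; last exact: cintegrableN.
congr (_ + _); rewrite -mulN1r -cintegralZ//; apply: eq_cintegral => x _.
by rewrite mulN1r.
Qed.

Lemma cintegrable0 D : cintegrable D (fun=> 0).
Proof. by split; exact: integrable0. Qed.

Lemma cintegral0 D : measurable D -> cintegral D (fun=> 0) = 0 :> R[i].
Proof.
move=> mD.
have := cintegralZ 0 mD (cintegrable0 D).
by rewrite (mul0r (cintegral _ _)) => {2}<-; apply: eq_cintegral => x _; rewrite mul0r.
Qed.

Lemma cintegrable_sum D (I : Type) (r : seq I) (F : I -> R -> R[i]) : measurable D ->
  (forall i, cintegrable D (F i)) -> cintegrable D (fun x => \sum_(i <- r) F i x).
Proof.
move=> mD h; elim: r => [|i r IH].
  by under eq_fun do rewrite big_nil; exact: cintegrable0.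
by under eq_fun do rewrite big_cons; exact: cintegrableD.
Qed.

Lemma cintegral_sum D (I : Type) (r : seq I) (F : I -> R -> R[i]) : measurable D ->
  (forall i, cintegrable D (F i)) ->
  cintegral D (fun x => \sum_(i <- r) F i x) = \sum_(i <- r) cintegral D (F i).
Proof.
move=> mD h; elim: r => [|i r IH].
  rewrite big_nil -[RHS](cintegral0 mD); apply: eq_cintegral => x _.
  by rewrite big_nil.
rewrite big_cons -IH -cintegralD//; last exact: cintegrable_sum.
by apply: eq_cintegral => x _; rewrite big_cons.
Qed.

Lemma le_cintegral D f (h : R -> R) : measurable D -> cintegrable D f ->
  mu.-integrable D (EFin \o h) -> (forall x, D x -> cmod (f x) <= h x) ->
  cmod (cintegral D f) <= \int[mu]_(x in D) h x.
Proof.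
move=> mD fi ih fh; have [u u1 ->] := cmod_rotate (cintegral D f).
rewrite -cintegralZ//=; have [ur _] := cintegrableZ u mD fi.
apply: le_Rintegral => // x Dx.
by rewrite (le_trans (ler_norm _))// (le_trans (cRe_cmod _))// cmodM u1 mul1r fh.
Qed.

Lemma cintegrableMl D f g (C : R) : measurable D -> cintegrable D f ->
  cmeasurable D g -> (forall x, D x -> cmod (g x) <= C) ->
  cintegrable D (fun x => f x * g x).
Proof.
move=> mD fi mg gC; have ih := integrableZl mD C (integrable_cmod mD fi).
apply: (cintegrable_le mD _ ih).
  by apply: cmeasurableM => //; exact: cintegrable_measurable.
by move=> x Dx /=; rewrite cmodM mulrC ler_wpM2r// gC.
Qed.

Lemma integrable_cst_itv (a b : R) (ba bb : bool) (c : R) :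
  mu.-integrable [set` Interval (BSide ba a) (BSide bb b)] (EFin \o fun=> c).
Proof.
have ci : mu.-integrable `[a, b] (EFin \o fun=> c).
  apply: continuous_compact_integrable; first exact: segment_compact.
  by apply: continuous_subspaceT => x; exact: cvg_cst.
apply: integrableS ci => //.
by move=> x /=; apply: subitvP; rewrite subitvE !bnd_simp; case: ba; case: bb.
Qed.

Lemma cintegrable_bounded (a b : R) (ba bb : bool) f (C : R) :
  let D := [set` Interval (BSide ba a) (BSide bb b)] in
  cmeasurable D f -> (forall x, D x -> cmod (f x) <= C) -> cintegrable D f.
Proof.
move=> D mf fC; have mD : measurable (D : set T) by exact: measurable_itv.
exact: (cintegrable_le mD mf (integrable_cst_itv a b ba bb C)).
Qed.

Definition ccontinuous (f : R -> R[i]) (x : R) :=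
  {for x, continuous (fun y => cRe (f y))} /\ {for x, continuous (fun y => cIm (f y))}.

Lemma integrable_set1 (a : R) (h : R -> \bar R) : mu.-integrable [set a] h.
Proof.
apply: null_set_integrable => //; first exact: measurable_fun_set1.
exact: lebesgue_measure_set1.
Qed.

Lemma cintegral_FTC (a b : R) F f : a <= b ->
  (forall x, a <= x <= b -> cderive F x (f x)) ->
  (forall x, a <= x <= b -> ccontinuous f x) ->
  cintegrable `[a, b] f /\ cintegral `[a, b] f = F b - F a.
Proof.
rewrite le_eqVlt => /predU1P[<- _ _|ab dF cf].
  rewrite set_itv1 subrr; split; last by rewrite /cintegral !Rintegral_set1.
  by split; exact: integrable_set1.
have wc (h : R -> R) : (forall x, a <= x <= b -> {for x, continuous h}) ->
    {within `[a, b], continuous h}.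
  move=> ch; apply: continuous_in_subspaceT => x; rewrite inE/= in_itv/=.
  exact: ch.
have ci (h : R -> R) : (forall x, a <= x <= b -> {for x, continuous h}) ->
    mu.-integrable `[a, b] (EFin \o h).
  by move=> ch; apply: continuous_compact_integrable;
    [exact: segment_compact|exact: wc].
have ftc (H h : R -> R) : (forall x, a <= x <= b -> is_derive x 1 H (h x)) ->
    (forall x, a <= x <= b -> {for x, continuous h}) ->
    \int[mu]_(x in `[a, b]) h x = H b - H a.
  move=> dH ch; rewrite /Rintegral (continuous_FTC2 ab (F := H))//.
  - exact: wc.
  - have cH x : a <= x <= b -> {for x, continuous H}.
      move=> /dH [h1 _]; apply: differentiable_continuous.
      exact/derivable1_diffP.
    split => [x /[!in_itv]/= /andP[ax xb]||].
    + by have [] := dH x; rewrite ?(ltW ax) ?(ltW xb).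
    + by apply: cvg_at_right_filter; apply: cH; rewrite lexx ltW.
    + by apply: cvg_at_left_filter; apply: cH; rewrite lexx ltW.
  - move=> x /[!in_itv]/= /andP[ax xb]; have xab : a <= x <= b by rewrite !ltW.
    by rewrite derive1E; have [_ ->] := dH x xab.
split; first by split; apply: ci => x /cf[].
apply: complexP => /=.
  rewrite cReD cReN; apply: (ftc (fun x => cRe (F x)) (fun x => cRe (f x))) => x xab; first by have [] := dF x xab.
  by have [] := cf x xab.
rewrite cImD cImN; apply: (ftc (fun x => cIm (F x)) (fun x => cIm (f x))) => x xab; first by have [] := dF x xab.
by have [] := cf x xab.
Qed.

Lemma cderive_ccontinuous F x l : cderive F x l -> ccontinuous F x.
Proof. exact: cderive_continuous. Qed.

(** The endpoints form a null set. Estimates are made on the open interval, whereas the theorem and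
    the fundamental theorem of calculus speak of the closed one. *)
Lemma cintegral_itvoo (a b : R) f : a < b -> cintegrable `]a, b[ f ->
  cintegrable `[a, b] f /\ cintegral `[a, b] f = cintegral `]a, b[ f.
Proof.
move=> ab [ir ii].
have key (h : R -> R) : mu.-integrable `]a, b[ (EFin \o h) ->
  mu.-integrable `[a, b] (EFin \o h) /\
  \int[mu]_(x in `[a, b]) h x = \int[mu]_(x in `]a, b[) h x.
  move=> ih.
  have ab1 : mu.-integrable `[a, b] (EFin \o h).
    have mh : measurable_fun `[a, b] (EFin \o h).
      apply/measurable_EFinP; apply: measurable_fun_itv_cc.
      by move/(measurable_int mu)/measurable_EFinP: ih; exact.
    have mN : measurable ([set a; b] : set T).
      by apply: measurableU; exact: measurable_set1.
    have mI : measurable (`[a, b]%classic : set T) by exact: measurable_itv.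
    have N0 : mu [set a; b] = 0%E.
      by rewrite measureU0//; exact: lebesgue_measure_set1.
    apply/(negligible_integrable mN mI mh N0).
    apply: integrableS ih => //; first exact: measurableD.
    move=> x /= [/[!in_itv]/= /andP[ax xb] /not_orP[/eqP xa /eqP xb']].
    by rewrite !lt_def ax xb xa eq_sym xb'.
  split => //; rewrite -Rintegral_itv_obnd_cbnd; last first.
    by apply: integrableS ab1 => //; apply: subset_itvr; rewrite bnd_simp.
  by rewrite -Rintegral_itv_bndo_bndc.
by have [a1 a2] := key _ ir; have [b1 b2] := key _ ii; rewrite /cintegral a2 b2.
Qed.

Lemma cintegral_uniform (a b : R) (F : nat -> R -> R[i]) f (e : nat -> R) : a < b ->
  (forall n, cintegrable `]a, b[ (F n)) ->
  (forall n x, a < x < b -> cmod (F n x - f x) <= e n) -> e @ \oo --> (0 : R) ->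
  cintegrable `]a, b[ f /\ ccvg (fun n => cintegral `]a, b[ (F n)) (cintegral `]a, b[ f).
Proof.
move=> ab iF Fe e0; have mI : measurable (`]a, b[%classic : set T) by [].
have fm : cmeasurable `]a, b[ f.
  apply: (cmeasurable_cvg (F := F)) => // [n|x /= /[!in_itv]/= xab].
    exact: cintegrable_measurable.
  by apply: (ccvg_squeeze _ e0); near=> n; exact: Fe.
have ib n : mu.-integrable `]a, b[ (EFin \o fun=> e n) by exact: integrable_cst_itv.
have iD n : cintegrable `]a, b[ (fun x => F n x - f x).
  apply: (cintegrable_le mI _ (ib n)).
    by apply: cmeasurableB => //; exact: cintegrable_measurable.
  by move=> x /= /[!in_itv]/= xab; exact: Fe.
(* No bound on f itself is given, but f is [F 0] minus a function bounded by [e 0]. *)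
have fi : cintegrable `]a, b[ f.
  have := cintegrableB mI (iF 0%N) (iD 0%N); apply: eq_cintegrable => // x _.
  by rewrite opprB addrC subrK.
split => //; apply: (ccvg_squeeze (b := fun n => e n * (b - a))); last first.
  by rewrite -(mul0r (b - a)); apply: cvgM => //; exact: cvg_cst.
near=> n; rewrite -cintegralB//.
apply: le_trans (le_cintegral mI (iD n) (ib n) _) _.
  by move=> x /= /[!in_itv]/= xab; exact: Fe.
rewrite Rintegral_cst//.
suff -> : fine (mu `]a, b[%classic) = b - a by [].
by have -> := @lebesgue_measure_itv R `]a, b[; rewrite /= lte_fin ab.
Unshelve. all: by end_near. Qed.

End ComplexIntegral.

(** * The characters e^(2 pi i n x) and their orthogonality *)

Section FourierCharacters.
Variable R : realType.
Notation T := (measurableTypeR R).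

Definition echar (n : int) (x : R) : R[i] := cexp (two_pi_i R n * x%:C).

Lemma two_pi_i_eq0 n : (two_pi_i R n == 0) = (n == 0).
Proof.
rewrite eq_complex/= eqxx/= !mulf_eq0 pnatr_eq0/= intr_eq0.
by rewrite (gt_eqF (pi_gt0 R)).
Qed.

Lemma two_pi_iD m n : two_pi_i R (m + n) = two_pi_i R m + two_pi_i R n.
Proof. by apply: complexP => /=; rewrite ?addr0// intrD mulrDr. Qed.
Lemma two_pi_iN n : two_pi_i R (- n) = - two_pi_i R n.
Proof. by apply: complexP => /=; rewrite ?oppr0// intrN mulrN. Qed.

Lemma cmod_two_pi_i n : cmod (two_pi_i R n) = 2 * pi * `|n%:~R|.
Proof.
rewrite /two_pi_i /= expr0n/= add0r sqrtr_sqr !normrM.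
by rewrite (ger0_norm (pi_ge0 R)) ger0_norm.
Qed.

Lemma echarD m n x : echar (m + n) x = echar m x * echar n x.
Proof. by rewrite /echar two_pi_iD mulrDl cexpD. Qed.
Lemma echar0 x : echar 0 x = 1.
Proof.
rewrite /echar (_ : two_pi_i R 0 = 0) ?mul0r ?cexp0//.
by apply/eqP; rewrite two_pi_i_eq0.
Qed.
Lemma echarx0 n : echar n 0 = 1.
Proof. by rewrite /echar mulr0 cexp0. Qed.
Lemma cexp_two_pi_i n : cexp (two_pi_i R n) = 1.
Proof.
have pos (m : nat) : cexp (two_pi_i R m) = 1.
  have -> : two_pi_i R m = m%:R * two_pi_i R 1.
    apply: complexP; rewrite ?cReM ?cImM/=; last first.
      have -> : cRe (m%:R : R[i]) = m%:R by rewrite -(rmorph_nat (real_complex R)).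
      by rewrite !mulr0 addr0 mulr1 mulrC.
    have -> : cIm (m%:R : R[i]) = 0 by rewrite -(rmorph_nat (real_complex R)).
    by rewrite mulr0 mul0r subr0.
  rewrite cexpM_natl (_ : cexp _ = 1) ?expr1n//.
  apply: complexP => /=; rewrite expR0 mul1r mulr1.
    by rewrite mulrC -[2]/(1 *+ 2) mulrnAr mulr1 cos2pi.
  by rewrite mulrC -[2]/(1 *+ 2) mulrnAr mulr1 sin2pi.
case: n => n; first exact: pos.
by rewrite NegzE two_pi_iN cexpN pos invr1.
Qed.
Lemma echarx1 n : echar n 1 = 1.
Proof. by rewrite /echar mulr1 cexp_two_pi_i. Qed.
Lemma cmod_echar n x : cmod (echar n x) = 1.
Proof. by rewrite /echar cmod_cexp cReM/= mul0r mulr0 subr0 expR0. Qed.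
Lemma echar_conj n x : (echar n x)^*%C = echar (- n) x.
Proof.
rewrite /echar two_pi_iN /cexp !cReM !cImM/=.
by apply: complexP => /=; rewrite !oppr0 !mul0r !mulr0 !add0r ?subr0 ?oppr0 mulNr ?cosN ?sinN ?mulrN.
Qed.

Lemma cderive_echar n x : cderive (echar n) x (two_pi_i R n * echar n x).
Proof.
apply: cderive_eq.
  exact: (cderive_cexp (cderiveZ (two_pi_i R n) (cderive_id x))).
by rewrite mulr1.
Qed.

Lemma cmeasurable_echar D n : cmeasurable D (echar n).
Proof. exact: cmeasurable_cexp (cmeasurableZ _ (cmeasurable_id _)). Qed.

Lemma cintegrable_echar n : cintegrable `]0, 1[ (echar n).
Proof.
apply: (cintegrable_bounded (C := 1)); first exact: cmeasurable_echar.
by move=> x _; rewrite cmod_echar.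
Qed.

Lemma cintegral_echar n : cintegral `]0, 1[ (echar n) = (n == 0)%:R.
Proof.
have [_ <-] := cintegral_itvoo (@ltr01 R) (cintegrable_echar n).
case: eqVneq => [->|n0].
  have [_] := @cintegral_FTC R 0 1 (fun x => x%:C) (fun=> 1) ler01
    (fun x _ => cderive_id x) (fun x _ => cderive_ccontinuous (cderive_cst 1 x)).
  rewrite subr0 => h; rewrite -[RHS]h.
  by apply: eq_cintegral => x _; exact: echar0.
have [||_] := @cintegral_FTC R 0 1 (fun x => (two_pi_i R n)^-1 * echar n x)
    (echar n) ler01.
- move=> x _; apply: (cderive_eq (cderiveZ _ (cderive_echar n x))).
  by rewrite mulKf// two_pi_i_eq0.
- by move=> x _; exact: cderive_ccontinuous (cderive_echar n x).
- by move=> ->; rewrite echarx0 echarx1 subrr.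
Qed.

End FourierCharacters.

(** * Functions with a power series on a closed disc *)

Section PowerSeries.
Variable R : realType.
Implicit Types (f g : R[i] -> R[i]) (z w : R[i]) (r : R) (a b : nat -> R[i]).
Notation mu := (@lebesgue_measure R).
Notation T := (measurableTypeR R).

Lemma csum_tail (u : nat -> R[i]) l (b : nat -> R) n : has_csum u l ->
  (forall k, cmod (u k) <= b k) -> cvgn (series b) ->
  cmod (l - psum u n) <= limn (series b) - series b n.
Proof.
move=> ul ub cb; apply: (@ccvg_le _ (fun m => psum u m - psum u n)).
  by apply: ccvgB ul _; exact: ccvg_cst.
near=> m; have nm : (n <= m)%N by near: m; exact: nbhs_infty_ge.
apply: (@le_trans _ _ (series b m - series b n)).
  rewrite !psumE !sub_series_geq// (le_trans (cmod_sum _ _))//.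
  exact: ler_sum.
rewrite lerD2r; apply: nondecreasing_cvgn_le => //.
by apply: nondecreasing_series => k _ _; exact: le_trans (ub k).
Unshelve. all: by end_near. Qed.

(** Absolute convergence at the radius r itself is recorded so that products can be expanded and so
    that the series converges uniformly on the circle of radius r. The coefficients are an explicit
    argument because [is_pser_integral] has to integrate them. *)
Definition pser f z r a := [/\ 0 < r, cvgn (series (fun k => cmod (a k) * r ^+ k)) &
  forall w, cmod (w - z) <= r -> has_csum (fun k => a k * (w - z) ^+ k) (f w)].

Definition is_pser f z r := exists a, pser f z r a.

Lemma pser_ext f g z r a : (forall w, cmod (w - z) <= r -> f w = g w) ->
  pser f z r a -> pser g z r a.
Proof. by move=> fg [r0 ca sa]; split => // w wr; rewrite -fg//; exact: sa. Qed.

Lemma is_pser_ext f g z r : (forall w, cmod (w - z) <= r -> f w = g w) ->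
  is_pser f z r -> is_pser g z r.
Proof. by move=> fg [a fa]; exists a; exact: pser_ext fa. Qed.

Lemma is_pser_shrink f z r r' : 0 < r' <= r -> is_pser f z r -> is_pser f z r'.
Proof.
move=> /andP[r0 rr] [a [_ ca sa]]; exists a; split => //; last first.
  by move=> w wr; apply: sa; exact: le_trans rr.
have r'0 := ltW r0; have rp := le_trans r'0 rr.
apply: series_le_cvg ca => n /=; [by rewrite mulr_ge0// exprn_ge0|by rewrite mulr_ge0// exprn_ge0|].
by rewrite ler_wpM2l// lerXn2r ?nnegrE.
Qed.

Lemma analytic_on_pser (D : set R[i]) F :
  (forall z, D z -> exists f r, is_pser f z r /\ forall w, cmod (w - z) < r -> F w = f w) ->
  analytic_on D F.
Proof.
move=> h z /h[f [r [[a [r0 _ sa]] Ff]]]; exists a, r; split => // w wr.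
rewrite Ff//; have /ccvgE := sa w (ltW wr).
by rewrite (_ : psum _ = series (fun n => a n * (w - z) ^+ n))//; apply/funext => n; rewrite psumE.
Qed.

Lemma is_pserD f g z r : is_pser f z r -> is_pser g z r -> is_pser (fun w => f w + g w) z r.
Proof.
move=> [a [r0 ca sa]] [b [_ cb sb]]; exists (fun k => a k + b k); split => //.
  apply: (@series_le_cvg _ _ (fun k => cmod (a k) * r ^+ k + cmod (b k) * r ^+ k)).
  - by move=> n; rewrite mulr_ge0// exprn_ge0// ltW.
  - by move=> n; rewrite addr_ge0// mulr_ge0// exprn_ge0// ltW.
  - by move=> n; rewrite -mulrDl ler_wpM2r ?cmodD// exprn_ge0// ltW.
  - rewrite (_ : series _ = series (fun k => cmod (a k) * r ^+ k) +
       series (fun k => cmod (b k) * r ^+ k)); first exact: is_cvgD.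
    by apply/funext => n; rewrite /series/= big_split.
move=> w wr; have := has_csumD (sa w wr) (sb w wr).
by under [X in has_csum X]eq_fun do rewrite -mulrDl.
Qed.

Lemma pserZ c f z r a : pser f z r a -> pser (fun w => c * f w) z r (fun k => c * a k).
Proof.
move=> [r0 ca sa]; split => //.
  rewrite (_ : series _ = cmod c *: series (fun k => cmod (a k) * r ^+ k)).
    exact: is_cvgZr.
  apply/funext => n; rewrite /series/= fctE /GRing.scale/= mulr_sumr.
  by apply: eq_bigr => i _; rewrite cmodM mulrA.
move=> w wr; have := has_csumZ c (sa w wr).
by under [X in has_csum X]eq_fun do rewrite mulrA.
Qed.

Lemma is_pserZ c f z r : is_pser f z r -> is_pser (fun w => c * f w) z r.
Proof. by move=> [a fa]; exists (fun k => c * a k); exact: pserZ. Qed.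

Lemma pser_cexp c z r : 0 < r ->
  pser (fun w => cexp (c * w)) z r (fun k => cexp (c * z) * expc c k).
Proof.
move=> r0; split => //.
  rewrite (_ : (fun k => _) = cmod (cexp (c * z)) *: exp_coeff (cmod c * r)).
    by apply: is_cvg_seriesZ; exact: is_cvg_series_exp_coeff.
  apply/funext => k; rewrite fctE /GRing.scale/= cmodM cmod_expc -mulrA.
  by congr (_ * _); rewrite /exp_coeff/= exprMn; ring.
move=> w _; have := has_csumZ (cexp (c * z)) (cexp_csum (c * (w - z))).
rewrite -cexpD -mulrDr [z + _]addrC subrK; rewrite (_ : (fun k => cexp (c * z) * expc (c * (w - z)) k) =
  fun k => cexp (c * z) * expc c k * (w - z) ^+ k)//.
by apply/funext => k; rewrite /expc exprMn; ring.
Qed.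

Lemma is_pser_cexp c z r : 0 < r -> is_pser (fun w => cexp (c * w)) z r.
Proof. by move=> r0; eexists; exact: pser_cexp. Qed.

Lemma geometric_csum (q : R[i]) : cmod q < 1 -> has_csum (fun k => q ^+ k) (1 - q)^-1.
Proof.
move=> q1; have q0 : 1 - q != 0.
  by apply: contraTneq q1 => /subr0_eq <-; rewrite cmod1 ltxx.
have e n : psum (fun k => q ^+ k) n - (1 - q)^-1 = - (1 - q)^-1 * q ^+ n.
  have -> : psum (fun k => q ^+ k) n = (1 - q ^+ n) / (1 - q).
    apply: (mulIf q0); rewrite divfK//.
    have := subrXX 1 q n; rewrite expr1n => ->; rewrite mulrC; congr (_ * _).
    by apply: eq_bigr => i _; rewrite expr1n mul1r.
  by field.
rewrite /has_csum /ccvg; under eq_fun do rewrite e cmodM cmodX.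
rewrite -(mulr0 (cmod (- (1 - q)^-1))); apply: cvgM; first exact: cvg_cst.
by apply: cvg_expr; rewrite ger0_norm.
Qed.

(** Geometric series of ratio - (w - z) / (z - 1); keeping to half the distance from the pole bounds
    this ratio by 1/2 on the closed disc. *)
Lemma is_pser_inv z : z != 1 -> is_pser (fun w => (w - 1)^-1) z (cmod (z - 1) / 2).
Proof.
rewrite -subr_eq0 => z1; have m0 : 0 < cmod (z - 1) by rewrite cmod_gt0.
exists (fun k => (z - 1)^-1 * (- (z - 1)^-1) ^+ k); split.
- by rewrite divr_gt0.
- rewrite (_ : (fun k => _) = geometric (cmod (z - 1))^-1 2^-1).
    by apply: is_cvg_geometric_series; rewrite ger0_norm ?invr_ge0//; lra.
  apply/funext => k; rewrite /geometric/= cmodM cmodX cmodN cmodV -mulrA -exprMn.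
  by rewrite mulKf ?gt_eqF.
move=> w wr; have wz : cmod (- ((w - z) / (z - 1))) < 1.
  rewrite cmodN cmodM cmodV ltr_pdivrMr// mul1r (le_lt_trans wr)//.
  by rewrite ltr_pdivrMr// ltr_pMr//; lra.
have := has_csumZ (z - 1)^-1 (geometric_csum wz).
have w1 : w - 1 != 0.
  apply: contraTneq wr => /subr0_eq ->; rewrite -ltNge cmodBC.
  by rewrite ltr_pdivrMr// ltr_pMr//; lra.
rewrite (_ : (z - 1)^-1 / _ = (w - 1)^-1); last first.
  by field; rewrite w1 z1.
rewrite (_ : (fun k => (z - 1)^-1 * (- ((w - z) / (z - 1))) ^+ k) =
  fun k => (z - 1)^-1 * (- (z - 1)^-1) ^+ k * (w - z) ^+ k)//.
by apply/funext => k; rewrite -mulrA -exprMn mulNr [_ * (w - z)]mulrC.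
Qed.

End PowerSeries.

(** * Cauchy products of absolutely convergent series *)

Section CauchyProduct.

Lemma triangle_sum (V : zmodType) (f : nat -> nat -> V) n :
  \sum_(k < n) \sum_(i < k.+1) f i (k - i)%N = \sum_(i < n) \sum_(j < n - i) f i j.
Proof.
elim: n => [|n IH]; first by rewrite !big_ord0.
rewrite big_ord_recr/= IH [RHS]big_ord_recr/= subSnn big_ord1 big_ord_recr/= subnn.
rewrite addrA -big_split/=; congr (_ + _); apply: eq_bigr => i _.
by rewrite subSn ?(ltnW (ltn_ord i))// big_ord_recr.
Qed.

Variable R : realType.
Implicit Types (a b : nat -> R[i]).

(** Both differences run over the same indices, those of the square outside the triangle, so the
    triangle inequality compares them. This carries the convergence of the series of moduli over to
    the complex series. *)
Lemma square_triangle_le (f : nat -> nat -> R[i]) n :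
  cmod (\sum_(i < n) \sum_(j < n) f i j - \sum_(i < n) \sum_(j < n - i) f i j) <=
  \sum_(i < n) \sum_(j < n) cmod (f i j) - \sum_(i < n) \sum_(j < n - i) cmod (f i j).
Proof.
have split_sum (V : zmodType) (g : nat -> V) m i : (i <= m)%N ->
    \sum_(j < m) g j - \sum_(j < m - i) g j = \sum_(m - i <= j < m) g j.
  move=> im; apply/eqP; rewrite subr_eq -!(big_mkord xpredT g) addrC.
  by rewrite -big_cat_nat//= leq_subr.
rewrite -!sumrB (le_trans (cmod_sum _ _))//; apply: ler_sum => i _.
have im := ltnW (ltn_ord i).
rewrite (split_sum _ (f i) _ _ im) (split_sum _ (fun j => cmod (f i j)) _ _ im).
exact: cmod_sum.
Qed.

(** A triangle of side n lies in the square of side n, which lies in the triangle of side 2n. Hence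
    the product series of moduli converges to the product of the two sums, and the part of the
    square outside the triangle tends to 0. *)
Lemma cauchy_product a b A B : has_csum a A -> has_csum b B ->
  cvgn (series (fun k => cmod (a k))) -> cvgn (series (fun k => cmod (b k))) ->
  has_csum (fun n => \sum_(i < n.+1) a i * b (n - i)%N) (A * B) /\
  cvgn (series (fun n => \sum_(i < n.+1) cmod (a i) * cmod (b (n - i)%N))).
Proof.
move=> aA bB ca cb.
set c := fun n => _; set gam := fun n => \sum_(i < n.+1) cmod (a i) * _.
set al := series (fun k => cmod (a k)) in ca *.
set be := series (fun k => cmod (b k)) in cb *.
have gam0 n : 0 <= gam n by apply: sumr_ge0 => i _; rewrite mulr_ge0.
have ge (n : nat) : series gam n = \sum_(i < n) \sum_(j < n - i) cmod (a i) * cmod (b j).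
  by rewrite seriesEord -(triangle_sum (fun i j => cmod (a i) * cmod (b j))).
have abe n : al n * be n = \sum_(i < n) \sum_(j < n) cmod (a i) * cmod (b j).
  by rewrite /al /be !seriesEord big_distrlr.
have up n : series gam n <= al n * be n.
  rewrite ge abe; apply: ler_sum => i _.
  rewrite -!(big_mkord xpredT (fun j => cmod (a i) * cmod (b j))).
  rewrite [leRHS](big_cat_nat (n := (n - i)%N))//= ?leq_subr// lerDl.
  by apply: sumr_ge0 => j _; rewrite mulr_ge0.
have lo n : al n * be n <= series gam (n + n)%N.
  rewrite ge abe big_split_ord/= -[leLHS]addr0 lerD//; last first.
    by apply: sumr_ge0 => i _; apply: sumr_ge0 => j _; rewrite mulr_ge0.
  apply: ler_sum => i _.
  rewrite -!(big_mkord xpredT (fun j => cmod (a i) * cmod (b j))).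
  rewrite [leRHS](big_cat_nat (n := n))//= ?lerDl.
    by apply: sumr_ge0 => j _; rewrite mulr_ge0.
  by rewrite -addnBA ?leq_addr// ltnW.
have cab : (fun n => al n * be n) @ \oo --> limn al * limn be by exact: cvgM.
have ndgam : nondecreasing_seq (series gam).
  by apply: nondecreasing_series => k _ _; exact: gam0.
have ndal : nondecreasing_seq al by apply: nondecreasing_series => k _ _.
have ndbe : nondecreasing_seq be by apply: nondecreasing_series => k _ _.
have al0 n : 0 <= al n by rewrite /al seriesEord sumr_ge0.
have be0 n : 0 <= be n by rewrite /be seriesEord sumr_ge0.
have ubab n : al n * be n <= limn al * limn be.
  by apply: ler_pM => //; exact: nondecreasing_cvgn_le.
have cg : cvgn (series gam).
  apply: nondecreasing_is_cvgn => //; exists (limn al * limn be).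
  by move=> _ [n _ <-]; exact: le_trans (up n) (ubab n).
have lg : limn (series gam) = limn al * limn be.
  apply/eqP; rewrite eq_le; apply/andP; split.
    by apply: limr_le => //; near=> n; exact: le_trans (up n) (ubab n).
  rewrite -(cvg_lim _ cab)//; apply: limr_le; first by apply/cvg_ex; exists (limn al * limn be).
  near=> n; apply: (le_trans (lo n)); exact: nondecreasing_cvgn_le.
split=> //.
have sq n : psum a n * psum b n = \sum_(i < n) \sum_(j < n) a i * b j.
  by rewrite /psum big_distrlr.
have tr n : psum c n = \sum_(i < n) \sum_(j < n - i) a i * b j.
  by rewrite /psum -(triangle_sum (fun i j => a i * b j)).
have AB := ccvgM aA bB.
have : ccvg (fun n => psum a n * psum b n - psum c n) 0.
  apply: (ccvg_squeeze (b := fun n => al n * be n - series gam n)).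
    near=> n; rewrite subr0 sq tr abe ge.
    apply: (le_trans (square_triangle_le (fun i j => a i * b j) n)).
    by rewrite le_eqVlt; apply/orP; left; apply/eqP; congr (_ - _);
      apply: eq_bigr => i _; apply: eq_bigr => j _; rewrite cmodM.
  by rewrite -(subrr (limn al * limn be)) -{2}lg; apply: cvgB.
move=> /(ccvgB AB); rewrite subr0; congr ccvg; apply/funext => n.
by rewrite opprB addrC subrK.
Unshelve. all: by end_near. Qed.

Lemma is_pserM (f g : R[i] -> R[i]) z r : is_pser f z r -> is_pser g z r ->
  is_pser (fun w => f w * g w) z r.
Proof.
move=> [a [r0 ca sa]] [b [_ cb sb]].
exists (fun n => \sum_(i < n.+1) a i * b (n - i)%N).
have xpow (V : comNzRingType) (u v : nat -> V) x n :
    (\sum_(i < n.+1) u i * v (n - i)%N) * x ^+ n =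
    \sum_(i < n.+1) (u i * x ^+ i) * (v (n - i)%N * x ^+ (n - i)).
  rewrite mulr_suml; apply: eq_bigr => i _; rewrite mulrACA -exprD subnKC//.
  by rewrite -ltnS.
have P w : cmod (w - z) <= r ->
    cvgn (series (fun k => cmod (a k * (w - z) ^+ k))) /\
    cvgn (series (fun k => cmod (b k * (w - z) ^+ k))).
  move=> wr; have le (u : nat -> R[i]) :
      cvgn (series (fun k => cmod (u k) * r ^+ k)) ->
      cvgn (series (fun k => cmod (u k * (w - z) ^+ k))).
    apply: series_le_cvg => n //=; first by rewrite mulr_ge0// exprn_ge0// ltW.
    by rewrite cmodM cmodX ler_wpM2l// lerXn2r ?nnegrE// ltW.
  by split; exact: le.
split => //.
  have zr : cmod ((z + r%:C) - z) = r.
    by rewrite addrC addKr cmod_real ger0_norm// ltW.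
  have zr' : cmod (z + r%:C - z) <= r by rewrite zr.
  have [pa pb] := P _ zr'.
  have [_] := cauchy_product (sa _ zr') (sb _ zr') pa pb.
  apply: series_le_cvg => n //=.
  - by rewrite mulr_ge0// exprn_ge0// ltW.
  - by apply: sumr_ge0 => i _; rewrite mulr_ge0.
  - have -> : r ^+ n = cmod (((z + r%:C) - z) ^+ n) by rewrite cmodX zr.
    rewrite -cmodM xpow (le_trans (cmod_sum _ _))//.
    by apply: ler_sum => i _; rewrite [leLHS]cmodM lexx.
move=> w wr; have [pa pb] := P w wr.
have [+ _] := cauchy_product (sa w wr) (sb w wr) pa pb.
by under [X in has_csum X]eq_fun do rewrite -xpow.
Qed.

End CauchyProduct.

(** * Cauchy's estimates and Weierstrass' theorem for sums and integrals *)

Section Weierstrass.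
Variable R : realType.
Notation mu := (@lebesgue_measure R).
Notation T := (measurableTypeR R).
Implicit Types (f : R[i] -> R[i]) (z w : R[i]) (r : R).

Lemma ccvg_sum (u : nat -> nat -> R[i]) (l : nat -> R[i]) K :
  (forall k, ccvg (u k) (l k)) ->
  ccvg (fun n => \sum_(k < K) u k n) (\sum_(k < K) l k).
Proof.
move=> ul; elim: K => [|K IH].
  by under eq_fun do rewrite big_ord0; rewrite big_ord0; exact: ccvg_cst.
by under eq_fun do rewrite big_ord_recr/=; rewrite big_ord_recr/=; exact: ccvgD.
Qed.

Lemma cvg_tail (b : nat -> R) : cvgn (series b) ->
  (fun n => limn (series b) - series b n) @ \oo --> (0 : R).
Proof.
by move=> cb; rewrite -(subrr (limn (series b))); apply: cvgB => //; exact: cvg_cst.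
Qed.

(** On the circle x |-> z + r e^(2 pi i x) the series of f converges uniformly and becomes a Fourier
    series, so by orthogonality a_k r^k is its k-th Fourier coefficient, bounded by the supremum of
    |f|. *)
Lemma cauchy_estimate f z r a (M : R) : pser f z r a ->
  (forall w, cmod (w - z) <= r -> cmod (f w) <= M) ->
  forall k, cmod (a k) * r ^+ k <= M.
Proof.
move=> [r0 ca sa] fM k.
pose w (x : R) := z + r%:C * echar 1 x.
have wz x : w x - z = r%:C * echar 1 x by rewrite /w addrC addKr.
have wr x : cmod (w x - z) <= r.
  by rewrite wz cmodM cmod_echar mulr1 cmod_real ger0_norm// ltW.
pose F n x := \sum_(j < n) a j * r%:C ^+ j * echar (j%:Z - k%:Z) x.
pose f0 x := f (w x) * echar (- k%:Z) x.
pose e n := limn (series (fun k => cmod (a k) * r ^+ k)) -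
  series (fun k => cmod (a k) * r ^+ k) n.
have Fe n x : 0 < x < 1 -> cmod (F n x - f0 x) <= e n.
  move=> _; have -> : F n x = psum (fun k => a k * (w x - z) ^+ k) n * echar (- k%:Z) x.
    rewrite /F /psum mulr_suml; apply: eq_bigr => j _.
    rewrite echarD wz exprMn !mulrA; congr (_ * _ * _).
    by rewrite /echar -cexpM_natl -[j%:Z]mulr1n; congr cexp; rewrite mulrA; congr (_ * _);
      apply: complexP; rewrite ?cReM ?cImM -(rmorph_nat (real_complex R))/=; ring.
  rewrite -mulrBl cmodM cmod_echar mulr1 cmodBC.
  apply: (csum_tail _ (sa _ (wr x))) => // j.
  rewrite cmodM cmodX ler_wpM2l// lerXn2r ?nnegrE ?(ltW r0)//.
have iF n : cintegrable `]0, 1[ (F n).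
  by apply: cintegrable_sum => // j; apply: cintegrableZ => //; exact: cintegrable_echar.
have e0 : e @ \oo --> (0 : R) by exact: cvg_tail.
have [if0 cf0] := cintegral_uniform (@ltr01 R) iF Fe e0.
have -> : cmod (a k) * r ^+ k = cmod (cintegral `]0, 1[ f0).
  have cE n : (k < n)%N -> cintegral `]0, 1[ (F n) = a k * r%:C ^+ k.
    move=> kn; rewrite cintegral_sum//; last first.
      by move=> j; apply: cintegrableZ => //; exact: cintegrable_echar.
    rewrite (bigD1 (Ordinal kn))//= big1 ?addr0.
      rewrite cintegralZ//; last exact: cintegrable_echar.
      by rewrite cintegral_echar subrr eqxx mulr1.
    move=> j jk; rewrite cintegralZ//; last exact: cintegrable_echar.
    rewrite cintegral_echar subr_eq0 eqz_nat (_ : (_ == _)%N = false) ?mulr0//.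
    by apply: contra_neqF jk => /eqP jk; exact/val_inj.
  have <- : a k * r%:C ^+ k = cintegral `]0, 1[ f0.
    apply: ccvg_unique cf0; apply: (ccvg_squeeze (b := fun=> 0)); last exact: cvg_cst.
    near=> n; rewrite cE ?subrr ?cmod0//; near: n; exact: nbhs_infty_gt.
  by rewrite cmodM cmodX cmod_real ger0_norm// ltW.
apply: (le_trans (le_cintegral _ if0 (integrable_cst_itv 0 1 false true M) _)) => //.
  by move=> x _; rewrite cmodM cmod_echar mulr1; exact: fM.
rewrite Rintegral_cst//.
suff -> : fine (mu `]0%R, 1%R[%classic) = 1 by rewrite mulr1.
by have -> := @lebesgue_measure_itv R `]0, 1[; rewrite /= lte_fin ltr01 oppr0 adde0.
Unshelve. all: by end_near. Qed.

(** The factor 2 * 2^-K is the tail of a geometric series of ratio 1/2. That ratio arises by using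
    on the disc of radius r / 2 a coefficient bound M / r^k obtained at radius r. *)
Lemma half_tail (u : nat -> R[i]) l (M : R) K : has_csum u l ->
  (forall k, cmod (u k) <= M * 2^-1 ^+ k) -> cmod (psum u K - l) <= M * (2 * 2^-1 ^+ K).
Proof.
move=> ul uM; rewrite cmodBC.
have h1 : `|2^-1 : R| < 1 by rewrite ger0_norm ?invr_ge0//; lra.
have cg := cvg_geometric_series (a := M) h1.
have := csum_tail K ul (b := geometric M 2^-1) uM.
move=> /(_ (cvgP _ cg)) /le_trans; apply.
rewrite (cvg_lim _ cg)// geometric_seriesE; last by lra.
by rewrite le_eqVlt/=; apply/orP; left; apply/eqP; set x := _ ^+ K; field.
Qed.

Lemma pser_coef_le f z r a (M : R) w k : pser f z r a ->
  cmod (a k) * r ^+ k <= M -> cmod (w - z) <= r / 2 ->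
  cmod (a k * (w - z) ^+ k) <= M * 2^-1 ^+ k.
Proof.
move=> [r0 _ _] aM wr; rewrite cmodM cmodX.
apply: (@le_trans _ _ (cmod (a k) * (r / 2) ^+ k)).
  by rewrite ler_wpM2l// lerXn2r ?nnegrE// divr_ge0// ltW.
by rewrite exprMn mulrA ler_wpM2r// exprn_ge0// invr_ge0.
Qed.

Lemma half_cvg0 (M : R) : (fun K => M * (2 * 2^-1 ^+ K)) @ \oo --> (0 : R).
Proof.
rewrite -(mulr0 M); apply: cvgM; first exact: cvg_cst.
rewrite -(mulr0 2); apply: cvgM; first exact: cvg_cst.
by apply: cvg_expr; rewrite ger0_norm ?invr_ge0//; lra.
Qed.

Lemma half_series_cvg (M : R) (a : nat -> R[i]) r : 0 < r ->
  (forall k, cmod (a k) * r ^+ k <= M) ->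
  cvgn (series (fun k => cmod (a k) * (r / 2) ^+ k)).
Proof.
move=> r0 aM.
apply: (@series_le_cvg _ _ (geometric M 2^-1)) => [n|n|n|] /=.
- by rewrite mulr_ge0// exprn_ge0// divr_ge0// ltW.
- rewrite mulr_ge0// ?exprn_ge0 ?invr_ge0//.
  by apply: le_trans (aM 0%N); rewrite mulr_ge0.
- by rewrite exprMn mulrA ler_wpM2r// exprn_ge0// invr_ge0.
- by apply: is_cvg_geometric_series; rewrite ger0_norm ?invr_ge0//; lra.
Qed.

(** By Cauchy's estimates the k-th coefficients of the F n are dominated by M n / r^k and can be
    summed over n. Truncating every expansion at order K costs at most 2 * 2^-K times the sum of the
    M n, uniformly in the number of functions, so only finite sums are ever exchanged. *)
Lemma is_pser_sum (F : nat -> R[i] -> R[i]) (M : nat -> R) f z r :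
  (forall n, is_pser (F n) z r) ->
  (forall n w, cmod (w - z) <= r -> cmod (F n w) <= M n) -> cvgn (series M) ->
  (forall w, cmod (w - z) <= r -> has_csum (fun n => F n w) (f w)) ->
  is_pser f z (r / 2).
Proof.
move=> /choice[a pa] FM cM Ff.
have r0 : 0 < r by have [] := pa 0%N.
have est n k : cmod (a n k) * r ^+ k <= M n by exact: cauchy_estimate (pa n) (FM n) k.
have M0 n : 0 <= M n by apply: le_trans (est n 0%N); rewrite mulr_ge0.
have ndM : nondecreasing_seq (series M) by exact: nondecreasing_series.
have : forall k, exists A, has_csum (fun n => a n k) A /\ cmod A * r ^+ k <= limn (series M).
  move=> k; have rk : 0 < r ^+ k by rewrite exprn_gt0.
  have [||A hA lA] := @has_csum_dominated R (fun n => a n k) (fun n => M n * (r ^+ k)^-1).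
  - by move=> n; rewrite ler_pdivlMr.
  - rewrite (_ : (fun n => _) = (r ^+ k)^-1 *: M); first exact: is_cvg_seriesZ.
    by apply/funext => n; rewrite fctE /GRing.scale/= mulrC.
  exists A; split => //; rewrite -ler_pdivlMr// (le_trans lA)//.
  apply: limr_le.
    rewrite (_ : (fun n => _) = (r ^+ k)^-1 *: M); first exact: is_cvg_seriesZ.
    by apply/funext => n; rewrite fctE /GRing.scale/= mulrC.
  near=> n; rewrite seriesEord/= -mulr_suml ler_wpM2r ?invr_ge0 ?(ltW rk)//.
  by have := nondecreasing_cvgn_le ndM cM n; rewrite {1}seriesEord.
move=> /choice[A hA]; exists A; split; first by rewrite divr_gt0.
  by apply: (half_series_cvg r0) => k; exact: (hA k).2.
move=> w wr2; have wr : cmod (w - z) <= r.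
  by rewrite (le_trans wr2)// ler_pdivrMr// ler_peMr ?(ltW r0)//; lra.
apply: (ccvg_squeeze _ (half_cvg0 (limn (series M)))); near=> K.
apply: (@ccvg_le _ (fun N => \sum_(k < K) psum (fun n => a n k) N * (w - z) ^+ k -
   psum (fun n => F n w) N)).
  apply: ccvgB (Ff w wr); apply: (@ccvg_sum (fun k N => psum (fun n => a n k) N * (w - z) ^+ k)) => k.
  by apply: ccvgM (hA k).1 _; exact: ccvg_cst.
near=> N.
have -> : \sum_(k < K) psum (fun n => a n k) N * (w - z) ^+ k =
    \sum_(n < N) psum (fun k => a n k * (w - z) ^+ k) K.
  rewrite exchange_big/=; apply: eq_bigr => k _; by rewrite mulr_suml.
rewrite -sumrB (le_trans (cmod_sum _ _))//.
apply: (@le_trans _ _ (\sum_(n < N) M n * (2 * 2^-1 ^+ K))).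
  apply: ler_sum => n _; apply: half_tail => [|k].
    by have [_ _] := pa n; apply.
  exact: pser_coef_le (pa n) (est n k) wr2.
rewrite -mulr_suml ler_wpM2r ?mulr_ge0 ?exprn_ge0 ?invr_ge0//.
by have := nondecreasing_cvgn_le ndM cM N; rewrite {1}seriesEord.
Unshelve. all: by end_near. Qed.

(** The argument of [is_pser_sum] with an integral in place of the sum. The bound is put on the
    coefficients directly, because for the integrand of Gamma they are explicit. *)
Lemma is_pser_integral (D : set T) (F : R -> R[i] -> R[i]) (a : R -> nat -> R[i])
    (M : R -> R) z r : measurable D -> 0 < r ->
  (forall x, D x -> pser (F x) z r (a x)) ->
  (forall x k, D x -> cmod (a x k) * r ^+ k <= M x) ->
  mu.-integrable D (EFin \o M) -> (forall k, cmeasurable D (a ^~ k)) ->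
  (forall w, cmod (w - z) <= r -> cmeasurable D (F ^~ w)) ->
  is_pser (fun w => cintegral D (F ^~ w)) z (r / 2).
Proof.
move=> mD r0 pa est iM ma mF.
have tail w K x : D x -> cmod (w - z) <= r / 2 ->
    cmod (psum (fun k => a x k * (w - z) ^+ k) K - F x w) <= M x * (2 * 2^-1 ^+ K).
  move=> Dx wr; apply: half_tail => [|k]; last exact: pser_coef_le (pa x Dx) (est x k Dx) wr.
  have [_ _] := pa x Dx; apply; rewrite (le_trans wr)//.
  by rewrite ler_pdivrMr// ler_peMr ?(ltW r0)//; lra.
have iMZ c : mu.-integrable D (EFin \o (fun x => M x * c)).
  have := integrableZr mD c iM; apply: eq_integrable => // x _.
have iF w : cmod (w - z) <= r / 2 -> cintegrable D (F ^~ w).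
  move=> wr; apply: (cintegrable_le mD _ (iMZ (2 * 2^-1 ^+ 0))).
    apply: mF; rewrite (le_trans wr)//.
    by rewrite ler_pdivrMr// ler_peMr ?(ltW r0)//; lra.
  by move=> x Dx; have := tail w 0%N x Dx wr; rewrite /psum big_ord0 sub0r cmodN.
have ia k : cintegrable D (a ^~ k).
  have rk : 0 < r ^+ k by rewrite exprn_gt0.
  apply: (cintegrable_le mD (ma k) (iMZ (r ^+ k)^-1)) => x Dx.
  by rewrite ler_pdivlMr// est.
pose A k := cintegral D (a ^~ k).
have AM k : cmod (A k) * r ^+ k <= \int[mu]_(x in D) M x.
  have rk : 0 < r ^+ k by rewrite exprn_gt0.
  rewrite -ler_pdivlMr// -RintegralZr//.
  by apply: le_cintegral => // x Dx; rewrite ler_pdivlMr// est.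
exists A; split; first by rewrite divr_gt0.
  exact: half_series_cvg r0 AM.
move=> w wr; apply: (ccvg_squeeze _ (half_cvg0 (\int[mu]_(x in D) M x))); near=> K.
have -> : psum (fun k => A k * (w - z) ^+ k) K =
    cintegral D (fun x => psum (fun k => a x k * (w - z) ^+ k) K).
  rewrite /psum cintegral_sum//; last first.
    move=> k; under eq_fun do rewrite mulrC; exact: cintegrableZ.
  apply: eq_bigr => k _; rewrite mulrC -cintegralZ//.
  by apply: eq_cintegral => x _; rewrite mulrC.
have iS : cintegrable D (fun x => psum (fun k => a x k * (w - z) ^+ k) K).
  apply: cintegrable_sum => // k; under eq_fun do rewrite mulrC; exact: cintegrableZ.
rewrite -cintegralB//; last exact: iF.
rewrite -RintegralZr//; apply: le_cintegral => //.
  by apply: cintegrableB => //; exact: iF.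
by move=> x Dx; exact: tail.
Unshelve. all: by end_near. Qed.

End Weierstrass.

(** * Isolated zeros and uniqueness of the continuation *)

Section IdentityTheorem.
Variable R : realType.
Implicit Types (f : R[i] -> R[i]) (z w : R[i]) (r : R).

(** If some coefficient is nonzero, the first such term a_m (w - z)^m dominates the rest of the
    series close to z. *)
Lemma pser_zeros_isolated f z r (a : nat -> R[i]) : 0 < r ->
  (forall w, cmod (w - z) < r -> has_csum (fun k => a k * (w - z) ^+ k) (f w)) ->
  (exists2 d, 0 < d & forall w, cmod (w - z) < d -> f w = 0) \/
  (exists2 d, 0 < d & forall w, 0 < cmod (w - z) < d -> f w != 0).
Proof.
move=> r0 sa.
have [a0|/existsNP[m0 /eqP am0]] := pselect (forall k, a k = 0).
  left; exists r => // w wr; apply: (ccvg_unique (sa w wr)).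
  rewrite (_ : psum _ = fun=> 0); first exact: ccvg_cst.
  by apply/funext => n; rewrite /psum big1// => i _; rewrite a0 mul0r.
have exm : exists k, a k != 0 by exists m0.
case: (ex_minnP exm) => m am mmin; right.
have az k : (k < m)%N -> a k = 0.
  by move=> km; apply/eqP; apply: contraTT km => /mmin; rewrite leqNgt.
(* At a point inside the disc of convergence the terms of the series tend to 0, which provides the
   uniform coefficient bound [C] / [rho]^k. *)
pose rho := r / 2; have rho0 : 0 < rho by rewrite divr_gt0.
have rr : rho < r by rewrite /rho ltr_pdivrMr// ltr_pMr//; lra.
have zr : cmod ((z + rho%:C) - z) = rho.
  by rewrite addrC addKr cmod_real ger0_norm// ltW.
have [C C0 aC] : exists2 C, 0 < C & forall k, cmod (a k) * rho ^+ k <= C.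
  have sz := sa (z + rho%:C); rewrite zr in sz; have {sz} := sz rr => sz.
  have tc : ccvg (fun k => a k * (z + rho%:C - z) ^+ k) 0.
    have := ccvgB ((ccvg_shiftS _ _).2 sz) sz; rewrite subrr.
    rewrite (_ : (fun n => _ - _) = fun k => a k * (z + rho%:C - z) ^+ k)//.
    by apply/funext => n; rewrite /psum big_ord_recr/= addrAC subrr add0r.
  have : cvgn (fun k => cmod (a k * (z + rho%:C - z) ^+ k)).
    by apply/cvg_ex; eexists; exact: ccvg_mod tc.
  move=> /cvg_seq_bounded/pinfty_ex_gt0[M M0 /= HM]; exists M => // k.
  have := HM k I; rewrite cmodM cmodX zr ger0_norm// mulr_ge0// exprn_ge0//.
  exact: ltW.
have am0' : 0 < cmod (a m) by rewrite cmod_gt0.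
(* The first bound makes the ratio q = |w - z| / [rho] less than 1/2, so the tail after order m is
   at most 2 C q^(m+1). The second makes this smaller than |a_m| |w - z|^m. *)
pose d := Num.min (rho / 2) (cmod (a m) * rho ^+ m.+1 / (2 * C)).
have rm0 : 0 < rho ^+ m.+1 by rewrite exprn_gt0.
exists d; first by rewrite lt_min !divr_gt0// ?mulr_gt0.
move=> w /andP[w0]; rewrite lt_min => /andP[w1 w2].
have wr : cmod (w - z) < r.
  by apply: (lt_trans w1); rewrite (lt_trans _ rr)// ltr_pdivrMr// ltr_pMr//; lra.
pose q := cmod (w - z) / rho.
have q0 : 0 <= q by rewrite divr_ge0// ltW.
have q12 : q < 2^-1 by rewrite ltr_pdivrMr// mulrC.
have q1 : `|q| < 1 by rewrite ger0_norm//; lra.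
have cg := cvg_geometric_series (a := C) q1.
have ub k : cmod (a k * (w - z) ^+ k) <= geometric C q k.
  rewrite /geometric/= cmodM cmodX /q expr_div_n mulrA ler_pdivlMr ?exprn_gt0//.
  by rewrite -mulrA [_ * rho ^+ k]mulrC mulrA ler_wpM2r// exprn_ge0.
have := csum_tail m.+1 (sa w wr) ub (cvgP _ cg).
rewrite (cvg_lim _ cg)// geometric_seriesE; last by lra.
have -> : psum (fun k => a k * (w - z) ^+ k) m.+1 = a m * (w - z) ^+ m.
  rewrite /psum big_ord_recr/= big1 ?add0r// => i _.
  by rewrite az ?mul0r.
move=> tl; apply/eqP => fw0; move: tl; rewrite fw0 sub0r cmodN cmodM cmodX/=.
apply/negP; rewrite -ltNge.
have -> : C / (1 - q) - C * (1 - q ^+ m.+1) / (1 - q) = C * q ^+ m.+1 / (1 - q).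
  by set x := q ^+ _; field; lra.
apply: (@le_lt_trans _ _ (2 * C * q ^+ m.+1)).
  rewrite ler_pdivrMr; last by lra.
  have qm : 0 <= C * q ^+ m.+1 by rewrite mulr_ge0 ?exprn_ge0// ltW.
  rewrite -mulrA; set y := C * _ in qm *; nra.
rewrite /q expr_div_n mulrA ltr_pdivrMr// exprS.
rewrite [ltLHS](_ : _ = cmod (w - z) ^+ m * (cmod (w - z) * (2 * C))); last by ring.
rewrite [ltRHS](_ : _ = cmod (w - z) ^+ m * (cmod (a m) * rho ^+ m.+1)); last by ring.
by rewrite ltr_pM2l ?exprn_gt0// -ltr_pdivlMr ?mulr_gt0.
Qed.

Lemma analytic_zeros_isolated (D : set R[i]) F1 F2 z : analytic_on D F1 ->
  analytic_on D F2 -> D z ->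
  (exists2 d, 0 < d & forall w, cmod (w - z) < d -> F1 w = F2 w) \/
  (exists2 d, 0 < d & forall w, 0 < cmod (w - z) < d -> F1 w != F2 w).
Proof.
move=> a1 a2 Dz; have [a [r1 [r10 s1]]] := a1 z Dz; have [b [r2 [r20 s2]]] := a2 z Dz.
have r0 : 0 < Num.min r1 r2 by rewrite lt_min r10.
have h w : cmod (w - z) < Num.min r1 r2 ->
    has_csum (fun k => (a k - b k) * (w - z) ^+ k) (F1 w - F2 w).
  rewrite lt_min => /andP[w1 w2]; move: (s1 w w1) (s2 w w2) => /ccvgE h1 /ccvgE h2.
  have := ccvgB h1 h2.
  rewrite (_ : (fun n => _ - _) = psum (fun k => (a k - b k) * (w - z) ^+ k))//.
  apply/funext => n; rewrite -!psumE /psum -sumrB; apply: eq_bigr => k _.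
  by rewrite mulrBl.
have [[d d0 H]|[d d0 H]] := pser_zeros_isolated r0 h; [left|right]; exists d => // w wd.
  by apply/eqP; rewrite -subr_eq0; apply/eqP; exact: H.
by rewrite -subr_eq0; exact: H.
Qed.

(* The segment from [s] to [2 +/- i] chosen below avoids the pole [1], so the
   two functions agree along it, starting from the far end. *)
Lemma analytic_punctured_unique F1 F2 s :
  analytic_on [set s : R[i] | s != 1] F1 -> analytic_on [set s : R[i] | s != 1] F2 ->
  (forall s : R[i], 1 < cRe s -> F1 s = F2 s) -> s != 1 -> F1 s = F2 s.
Proof.
move=> a1 a2 F12 s1.
(* The shift is directed away from the real axis, so the imaginary part of [g u] is nonzero as soon
   as u > 0. *)
pose e : R := if 0 <= cIm s then 1 else -1.
pose g (u : R) : R[i] := s + u%:C * (2 +i* (cIm s + e) - s).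
have gRe u : cRe (g u) = cRe s + u * (2 - cRe s).
  by rewrite /g; case: (s) => x y /=; ring.
have gIm u : cIm (g u) = cIm s + u * e.
  by rewrite /g /e; case: (s) => x y /=; case: ifP => _; ring.
have gdist u v : cmod (g u - g v) = `|u - v| * cmod (2 +i* (cIm s + e) - s).
  rewrite -cmod_real -cmodM; congr cmod; rewrite /g rmorphB/=; ring.
set L := cmod (_ - s) in gdist.
have L0 : 0 < L.
  rewrite /L cmod_gt0 subr_eq0; apply/eqP => /(congr1 (@complex.Im R))/=.
  by rewrite /e; case: ifP => _; lra.
have g1 u : 0 <= u <= 1 -> g u != 1.
  move=> /andP[u0 u1]; apply/eqP => gu1.
  have := gIm u; rewrite gu1/= /e.
  have [u00|un0] := eqVneq u 0.
    by move: gu1; rewrite u00 /g mul0r addr0 => /eqP; rewrite (negbTE s1).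
  have up : 0 < u by rewrite lt_def un0.
  by case: (leP 0 (cIm s)) => hs; nra.
(* Real induction from the far end: the infimum [u0] of the parameters from which agreement holds up
   to 1 will turn out to be 0, and agreement to hold there as well. *)
pose S := [set u : R | 0 <= u <= 1 /\ forall v, u <= v <= 1 -> F1 (g v) = F2 (g v)].
(* For 1 - v <= [eta] the product (1 - v) (2 - Re s) is below 1, hence Re (g v) > 1 and the
   hypothesis applies. This gives [S] an element. *)
pose eta := (1 + `|2 - cRe s|)^-1.
have eta0 : 0 < eta by rewrite invr_gt0 ltr_pwDl.
have eta1 : eta <= 1 by rewrite invf_le1 ?lerDl// ltr_pwDl.
have Seta : S (1 - eta / 2).
  split; first by apply/andP; split; lra.
  move=> v /andP[v0 v1]; apply: F12; rewrite gRe.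
  have : (1 - v) * (2 - cRe s) < 1.
    apply: (@le_lt_trans _ _ ((1 - v) * `|2 - cRe s|)).
      by rewrite ler_wpM2l ?ler_norm//; lra.
    apply: (@le_lt_trans _ _ (eta * `|2 - cRe s|)).
      by rewrite ler_wpM2r//; lra.
    rewrite /eta mulrC ltr_pdivrMr ?mul1r ?ltrDr// ltr_pwDl//.
  by lra.
have hS : has_inf S.
  by split; [exists (1 - eta / 2)|exists 0 => u [/andP[]]].
have Slow u : S u -> inf S <= u by move=> Su; apply: ge_inf => //; exact: hS.2.
pose u0 := inf S.
have u00 : 0 <= u0 by apply: lb_le_inf; [exists (1 - eta / 2)|move=> u [/andP[]]].
have u01 : u0 < 1 by apply: le_lt_trans (Slow _ Seta) _; lra.
have above v : u0 < v <= 1 -> F1 (g v) = F2 (g v).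
  move=> /andP[u0v v1]; have e0 : 0 < v - u0 by lra.
  have [u Su uv] := inf_adherent e0 hS; have [_] := Su; apply.
  rewrite v1 andbT; move: uv; rewrite -/u0; lra.
have g1u0 : g u0 != 1 by apply: g1; rewrite u00 ltW.
(* Agreement around [g u0] would extend [S] below its infimum unless [u0] is 0; disagreement on a
   punctured disc is refuted by a parameter just after [u0]. *)
have [[d d0 H]|[d d0 H]] := analytic_zeros_isolated a1 a2 g1u0.
- have near0 v : `|v - u0| < d / L -> F1 (g v) = F2 (g v).
    by move=> vd; apply: H; rewrite gdist -ltr_pdivlMr.
  have dL : 0 < d / L by rewrite divr_gt0.
  have [u0e|un0] := eqVneq u0 0.
    have := near0 0; rewrite u0e subrr normr0 => /(_ dL).
    by rewrite /g mul0r addr0.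
  have up : 0 < u0 by rewrite lt_def un0.
  pose u1 := Num.max 0 (u0 - d / L / 2).
  have u1u : u1 < u0 by rewrite gt_max up/=; lra.
  have u1d : u0 - d / L < u1 by rewrite lt_max; apply/orP; right; lra.
  have : S u1.
    split; first by rewrite le_max lexx/= (le_trans (ltW u1u))// ltW.
    move=> v /andP[u1v v1]; have [vu|uv] := leP v u0.
      by apply: near0; rewrite ler0_norm; lra.
    by apply: above; rewrite uv.
  by move/Slow; rewrite leNgt u1u.
- pose v := Num.min 1 (u0 + d / L / 2).
  have dL : 0 < d / L by rewrite divr_gt0.
  have uv : u0 < v by rewrite lt_min u01/=; lra.
  have vd : v < u0 + d / L by rewrite gt_min; apply/orP; right; lra.
  have := H (g v); rewrite gdist gtr0_norm ?subr_gt0// mulr_gt0 ?subr_gt0//=.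
  rewrite -ltr_pdivlMr// => /(_ _)/eqP; case; first by lra.
  by apply: above; rewrite uv ge_min lexx.
Qed.

(** [xget] falls back on the zero function when there is no continuation; exhibiting [F] excludes
    this, and the identity theorem forces the selected function to equal [F] off the pole. *)
Lemma hurwitz_zeta_unique (alpha : R) F s : hurwitz_continuation alpha F ->
  s != 1 -> hurwitz_zeta s alpha = F s.
Proof.
move=> hF s1; rewrite /hurwitz_zeta.
set F' := xget _ _; have hF' : hurwitz_continuation alpha F'.
  by apply: (@xgetPex _ (fun=> 0) [set F | hurwitz_continuation alpha F]); exists F.
have [a h] := hF; have [a' h'] := hF'.
apply: analytic_punctured_unique a' a _ s1 => w w1.
by apply: ccvg_unique; apply/ccvgE; [exact: h'|exact: h].
Qed.

End IdentityTheorem.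

(** * Convergence of the p-series *)

Section PSeries.
Variable R : realType.
Implicit Types (p x : R).

(** A discrete substitute for comparison with an integral, which makes the p-series telescope. It
    combines ln b - ln a >= 1 / b for b = a + 1 with e^x >= 1 + x. *)
Lemma powR_succ_le p n : 1 < p ->
  (p - 1) * n.+2%:R `^ (- p) <= n.+1%:R `^ (1 - p) - n.+2%:R `^ (1 - p).
Proof.
move=> p1; set a : R := n.+1%:R; set b : R := n.+2%:R.
have a0 : 0 < a by rewrite ltr0n.
have b0 : 0 < b by rewrite ltr0n.
have ab : b = a + 1 by rewrite /a /b -[n.+2]addn1 natrD.
clearbody a b.
rewrite lerBrDr.
have -> : a `^ (1 - p) = b `^ (1 - p) * expR ((p - 1) * (ln b - ln a)).
  rewrite /powR !ifF ?gt_eqF// -expRD; congr expR; ring.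
have lnba : 1 / b <= ln b - ln a.
  have ab0 : 0 < a / b by rewrite divr_gt0.
  have : ln (a / b) <= a / b - 1.
    by have := @le_ln1Dx R (a / b - 1); rewrite [1 + _]addrC subrK; apply; lra.
  rewrite ln_div ?posrE//; rewrite [X in X - 1](_ : a / b = 1 - 1 / b); first by lra.
  by rewrite ab; field; rewrite -ab gt_eqF.
have bp : b `^ (- p) = b `^ (1 - p) * (1 / b).
  have -> : b `^ (1 - p) = b * b `^ (- p).
    by rewrite powRD ?powRr1 ?(ltW b0)// (gt_eqF b0) implybT.
  by field; rewrite (gt_eqF b0).
rewrite bp mulrCA -[X in _ + X]mulr1 -mulrDr ler_wpM2l ?powR_ge0//.
rewrite (le_trans _ (expR_ge1Dx _))// addrC lerD2l ler_wpM2l//; lra.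
Qed.

Definition pterm p (n : nat) : R := n.+1%:R `^ (- p).

Lemma pterm_ge0 p n : 0 <= pterm p n. Proof. exact: powR_ge0. Qed.

Lemma pseries_cvg p : 1 < p -> cvgn (series (pterm p)).
Proof.
move=> p1; apply: nondecreasing_is_cvgn.
  by apply: nondecreasing_series => k _ _; exact: pterm_ge0.
exists (1 + (p - 1)^-1) => _ [n _ <-].
have p10 : 0 < p - 1 by lra.
case: n => [|n]; first by rewrite seriesEord/= big_ord0 addr_ge0// invr_ge0 ltW.
suff : series (pterm p) n.+1 <= 1 + (p - 1)^-1 * (1 - n.+1%:R `^ (1 - p)).
  move=> /le_trans; apply; rewrite lerD2l ler_piMr ?invr_ge0 ?ltW// gerBl powR_ge0//.
elim: n => [|n IH].
  by rewrite seriesEord/= big_ord1 /pterm powR1 subrr mulr0 addr0.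
rewrite seriesSr (le_trans (lerD IH (lexx _)))// -addrA lerD2l addrC -lerBrDr -mulrBr.
rewrite [X in _ <= _ * X](_ : _ = n.+1%:R `^ (1 - p) - n.+2%:R `^ (1 - p)); last by ring.
by rewrite mulrC ler_pdivlMr// mulrC powR_succ_le.
Qed.

Lemma pterm_cvg0 p : 0 < p -> pterm p @ \oo --> (0 : R).
Proof.
move=> p0; apply/cvgrPdist_lt => e e0; near=> n.
rewrite sub0r normrN ger0_norm ?pterm_ge0// /pterm powRN.
rewrite invf_plt ?posrE ?powR_gt0//.
have -> : e^-1 = (e^-1 `^ p^-1) `^ p.
  by rewrite -powRrM mulVf ?gt_eqF// powRr1// invr_ge0 ltW.
rewrite gt0_ltr_powR// ?nnegrE ?powR_ge0//.
near: n; exists (Num.bound (e^-1 `^ p^-1)) => // n /= hn.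
apply: (lt_le_trans (archi_boundP (powR_ge0 _ _))).
by rewrite ler_nat (leq_trans hn).
Unshelve. all: by end_near. Qed.

Lemma pterm_le p (x : R) n : 0 <= p -> n.+1%:R <= x -> x `^ (- p) <= pterm p n.
Proof.
move=> p0 nx; have n0 : (0 : R) < n.+1%:R by rewrite ltr0n.
rewrite /pterm !powRN lef_pV2 ?posrE ?powR_gt0//; last exact: lt_le_trans nx.
by apply: ge0_ler_powR; rewrite ?nnegrE ?(ltW n0)// (le_trans (ltW n0)).
Qed.

End PSeries.

(** * Continuation to Re s > -1 by the trapezoidal rule *)

Section EulerMaclaurin.
Variable R : realType.
Implicit Types (s z w : R[i]) (x y : R).

Lemma cderive_rpow_shift (a : R) z x : 0 < a + x ->
  cderive (fun y => rpow (a + y) z) x (z * rpow (a + x) (z - 1)).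
Proof.
move=> ax0.
have dl : is_derive x 1 (fun y => ln (a + y)) (a + x)^-1.
  have h := is_derive1_ln ax0.
  have h2 : is_derive x 1 (fun y => a + y) 1.
    by apply: is_derive_eq' (is_deriveD _ _) _; rewrite add0r.
  by apply: (is_derive_eq' (is_derive1_comp h h2)); rewrite mulr1.
apply: (cderive_eq (cderive_cexp (cderiveZ z (cderive_real dl)))).
rewrite -[LHS]/(z * (a + x)^-1%:C * rpow (a + x) z) -[in LHS](subrK 1 z) rpowS//.
rewrite subrK -mulrA; congr (_ * _).
by rewrite mulrA -rmorphM/= mulVf ?gt_eqF// mul1r.
Qed.

(** As a function of the right endpoint y, the error [e] and its derivative [d] vanish at x, and [d]
    has derivative (y - x) / 2 times f''. Two mean value inequalities over an interval of length 1
    give a constant that is crude but sufficient. *)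
Lemma trapezoid_error (F f f1 f2 : R -> R[i]) x (K : R) : 0 <= K ->
  (forall y, x <= y <= x + 1 -> cderive F y (f y)) ->
  (forall y, x <= y <= x + 1 -> cderive f y (f1 y)) ->
  (forall y, x <= y <= x + 1 -> cderive f1 y (f2 y)) ->
  (forall y, x <= y <= x + 1 -> cmod (f2 y) <= K) ->
  cmod ((f x + f (x + 1)) / 2 - (F (x + 1) - F x)) <= K.
Proof.
move=> K0 dF df df1 f2K.
pose c (y : R) : R[i] := (y - x)%:C / 2.
have dc y : cderive c y 2^-1.
  have d1 : is_derive y 1 (fun y => y - x) 1.
    by apply: is_derive_eq' (is_deriveB _ _) _; rewrite subr0.
  apply: (cderive_eq (cderiveM (cderive_real d1) (cderive_cst 2^-1 y))).
  by rewrite mulr0 addr0 mul1r.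
pose d y := (f x - f y) / 2 + c y * f1 y.
pose e y := c y * (f x + f y) - (F y - F x).
have de y : x <= y <= x + 1 -> cderive e y (d y).
  move=> h; apply: (cderive_eq (cderiveB (cderiveM (dc y)
    (cderiveD (cderive_cst (f x) y) (df y h))) (cderiveB (dF y h) (cderive_cst (F x) y)))).
  by rewrite /d; field.
have dd y : x <= y <= x + 1 -> cderive d y (c y * f2 y).
  move=> h; apply: (cderive_eq (cderiveD (cderiveM (cderiveB (cderive_cst (f x) y) (df y h))
    (cderive_cst 2^-1 y)) (cderiveM (dc y) (df1 y h)))).
  by field.
have dlin y : is_derive y 1 (fun y => K * y) K.
  rewrite (_ : (fun _ => _) = K *: (@id R))//.
  by apply: is_derive_eq; rewrite /GRing.scale/= mulr1.
have cK y : x <= y <= x + 1 -> cmod (c y) <= 1.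
  move=> /andP[xy yx]; rewrite cmodM cmodV cmod_nat cmod_real ger0_norm; last by lra.
  by rewrite ler_pdivrMr//; lra.
have xx : x <= x <= x + 1 by rewrite lexx/=; lra.
have c0 : c x = 0 by rewrite /c subrr (_ : 0%:C = 0 :> R[i])// mul0r.
have d0 : d x = 0 by rewrite /d c0 subrr !mul0r addr0.
have dK y : x <= y <= x + 1 -> cmod (d y) <= K.
  move=> /andP[xy yx1]; rewrite -[d y]subr0 -d0.
  apply: le_trans (mean_value_le (G := fun y => K * y) (F' := fun u => c u * f2 u)
    (G' := fun=> K) xy _ _ _) _ => [u /andP[xu uy]|u /andP[xu uy]|].
  - by apply: dd; rewrite xu (le_trans uy).
  - have hu : x <= u <= x + 1 by rewrite xu (le_trans uy).
    by rewrite cmodM -[K]mul1r ler_pM// ?cK ?f2K.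
  - by rewrite -mulrBr ler_piMr//; lra.
have e0 : e x = 0 by rewrite /e c0 subrr mul0r subr0.
have -> : (f x + f (x + 1)) / 2 - (F (x + 1) - F x) = e (x + 1) - e x.
  by rewrite e0 subr0 /e /c addrAC subrr add0r mul1r mulrC.
have x1 : x <= x + 1 by lra.
apply: (le_trans (mean_value_le x1 de (fun y _ => dlin y) dK)).
by rewrite -mulrBr addrAC subrr add0r mulr1.
Qed.

(* The error of the trapezoidal rule for [x ^ (- s)] on [n + a, n + 1 + a] is
   O(n ^ (- Re s - 2)), so the corrected partial sums [hzT] converge for
   -1 < Re s; their limit [hzeta] continues the Dirichlet series. *)
Definition hzE s (a : R) n : R[i] :=
  (rpow (n%:R + a) (- s) + rpow (n.+1%:R + a) (- s)) / 2 +
  (rpow (n.+1%:R + a) (1 - s) - rpow (n%:R + a) (1 - s)) / (s - 1).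

(** For Re s > 1 the last term is \int_(N + a)^oo x^(-s) dx; the half term is the end weight of the
    trapezoidal rule. *)
Definition hzT s (a : R) N : R[i] :=
  \sum_(n < N) rpow (n%:R + a) (- s) + rpow (N%:R + a) (- s) / 2 +
  rpow (N%:R + a) (1 - s) / (s - 1).

Lemma hzTS s a N : hzT s a N.+1 = hzT s a N + hzE s a N.
Proof.
rewrite /hzT /hzE big_ord_recr/=; set S := \sum_(_ < _) _.
by set q := (s - 1)^-1; field.
Qed.

Lemma hzT_shift s a N : hzT s a N.+1 = rpow a (- s) + hzT s (1 + a) N.
Proof.
have e n : n.+1%:R + a = n%:R + (1 + a) by rewrite -natr1 addrA.
rewrite /hzT big_ord_recl/= add0r -!addrA; congr (_ + _).
by rewrite e; congr (_ + _); apply: eq_bigr => i _; rewrite -e.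
Qed.

Lemma le_rpow_neg z x y : 0 < x -> x <= y -> cRe z <= 0 ->
  cmod (rpow y z) <= cmod (rpow x z).
Proof.
move=> x0 xy z0; have y0 := lt_le_trans x0 xy; rewrite !cmod_rpow//.
rewrite -[cRe z]opprK !(powRN _ (- _)) lef_pV2 ?posrE ?powR_gt0//.
by apply: ge0_ler_powR; rewrite ?nnegrE ?oppr_ge0// ltW.
Qed.

(** The trapezoidal rule for x^(-s), with antiderivative - x^(1 - s) / (s - 1). The bound -2 <= Re s
    places the maximum of the second derivative at the left end. *)
Lemma cmod_hzE s a n : s != 1 -> 0 < n%:R + a -> -2 <= cRe s ->
  cmod (hzE s a n) <= cmod s * cmod (s + 1) * cmod (rpow (n%:R + a) (- s - 2)).
Proof.
move=> s1 x0 s2; set x := n%:R + a in x0 *.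
have -> : hzE s a n = (rpow x (- s) + rpow (x + 1) (- s)) / 2 -
    (- (s - 1)^-1 * rpow (x + 1) (1 - s) - - (s - 1)^-1 * rpow x (1 - s)).
  rewrite /hzE -/x (_ : n.+1%:R + a = x + 1); first by ring.
  by rewrite /x -natr1; ring.
have s10 : s - 1 != 0 by rewrite subr_eq0.
have pos y : x <= y <= x + 1 -> 0 < y by move=> /andP[+ _]; exact: lt_le_trans.
apply: (@trapezoid_error (fun y => - (s - 1)^-1 * rpow y (1 - s)) (fun y => rpow y (- s))
  (fun y => - s * rpow y (- s - 1)) (fun y => s * (s + 1) * rpow y (- s - 2))) => //.
- by rewrite !mulr_ge0.
- move=> y /pos y0; apply: (cderive_eq (cderiveZ _ (cderive_rpow (1 - s) y0))).
  rewrite (_ : 1 - s - 1 = - s); last by ring.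
  by field.
- by move=> y /pos y0; exact: cderive_rpow.
- move=> y /pos y0; apply: (cderive_eq (cderiveZ _ (cderive_rpow (- s - 1) y0))).
  rewrite (_ : - s - 1 - 1 = - s - 2); first by ring.
  by ring.
- move=> y h; rewrite !cmodM ler_wpM2l ?mulr_ge0//; apply: le_rpow_neg => //.
    by have /andP[] := h.
  by move: s2; rewrite !cReD !cReN /=; lra.
Qed.

(** Differentiating [hzE] in its parameter gives another trapezoidal error, that of - s x^(-s - 1)
    with antiderivative x^(-s). One more power of decay is gained, and the sum of these bounds
    enters the Lipschitz constant of zeta(s, a) in a. *)
Lemma cmod_dhzE s x : 0 < x -> -3 <= cRe s ->
  cmod (- s * (rpow x (- s - 1) + rpow (x + 1) (- s - 1)) / 2 -
     (rpow (x + 1) (- s) - rpow x (- s))) <=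
  cmod s * cmod (s + 1) * cmod (s + 2) * cmod (rpow x (- s - 3)).
Proof.
move=> x0 s3.
have pos y : x <= y <= x + 1 -> 0 < y by move=> /andP[+ _]; exact: lt_le_trans.
rewrite mulrDr.
apply: (@trapezoid_error (fun y => rpow y (- s)) (fun y => - s * rpow y (- s - 1))
  (fun y => s * (s + 1) * rpow y (- s - 2))
  (fun y => - (s * (s + 1) * (s + 2)) * rpow y (- s - 3))) => //.
- by rewrite !mulr_ge0.
- by move=> y /pos y0; exact: cderive_rpow.
- move=> y /pos y0; apply: (cderive_eq (cderiveZ _ (cderive_rpow (- s - 1) y0))).
  rewrite (_ : - s - 1 - 1 = - s - 2); first by ring.
  by ring.
- move=> y /pos y0; apply: (cderive_eq (cderiveZ _ (cderive_rpow (- s - 2) y0))).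
  rewrite (_ : - s - 2 - 1 = - s - 3); first by ring.
  by ring.
- move=> y h; rewrite cmodM cmodN !cmodM ler_wpM2l ?mulr_ge0//; apply: le_rpow_neg => //.
    by have /andP[] := h.
  by move: s3; rewrite !cReD !cReN /=; lra.
Qed.

Lemma cmod_rpow_le s (p x : R) n : 0 <= p -> p <= - cRe s -> n.+1%:R <= x ->
  cmod (rpow x s) <= pterm p n.
Proof.
move=> p0 ps nx; have n0 : (1 : R) <= n.+1%:R by rewrite ler1n.
have x1 := le_trans n0 nx.
rewrite cmod_rpow ?(lt_le_trans _ x1)//; apply: le_trans (pterm_le p0 nx).
by apply: ler_powR => //; lra.
Qed.

(** [C] and [p] are separate from s so that the bound can be made uniform over a disc of values of
    s. The index n.+1 keeps the base at least 1 even for a = 0. *)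
Lemma cmod_hzE_le s a n (C p : R) : s != 1 -> 0 <= a -> -2 <= cRe s ->
  0 <= p -> p <= cRe s + 2 -> cmod s * cmod (s + 1) <= C ->
  cmod (hzE s a n.+1) <= C * pterm p n.
Proof.
move=> s1 a0 s2 p0 ps sC.
have na : n.+1%:R <= n.+1%:R + a by rewrite lerDl.
apply: (le_trans (cmod_hzE s1 _ s2)); first by rewrite (lt_le_trans _ na).
rewrite ler_pM ?mulr_ge0//; apply: cmod_rpow_le => //.
by rewrite cReD !cReN/=; lra.
Qed.

Definition hzeta s (a : R) : R[i] := limn (hzT s a : nat -> R[i]^o).

Definition ptail (p : R) n : R := limn (series (pterm p)) - series (pterm p) n.

Lemma hzT_psum s a N : hzT s a N.+1 = hzT s a 1 + psum (fun n => hzE s a n.+1) N.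
Proof.
elim: N => [|N IH]; first by rewrite /psum big_ord0 addr0.
by rewrite [LHS]hzTS IH /psum big_ord_recr/= -addrA.
Qed.

Lemma hzeta_csum s a : s != 1 -> 0 <= a -> -1 < cRe s ->
  has_csum (fun n => hzE s a n.+1) (hzeta s a - hzT s a 1).
Proof.
move=> s1 a0 sr.
pose C := cmod s * cmod (s + 1); pose p := cRe s + 2.
have p1 : 1 < p by rewrite /p; lra.
have cb : cvgn (series (fun n => C * pterm p n)).
  rewrite (_ : (fun n => _) = C *: pterm p)//; apply: is_cvg_seriesZ.
  exact: pseries_cvg.
have ub n : cmod (hzE s a n.+1) <= C * pterm p n.
  by apply: cmod_hzE_le => //; rewrite ?/p; lra.
have [l hl _] := has_csum_dominated ub cb.
suff -> : hzeta s a = l + hzT s a 1 by rewrite addrK.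
apply: (@cvg_lim R[i]^o); first exact: norm_hausdorff.
apply/ccvgE/ccvg_shiftS.
rewrite (_ : (fun n => _) = fun n => psum (fun n => hzE s a n.+1) n + hzT s a 1).
  by apply: ccvgD => //; exact: ccvg_cst.
by apply/funext => n; rewrite hzT_psum addrC.
Qed.

Lemma hzT_cvg s a : s != 1 -> 0 <= a -> -1 < cRe s -> ccvg (hzT s a) (hzeta s a).
Proof.
move=> s1 a0 sr; apply/ccvg_shiftS.
have := ccvgD (hzeta_csum s1 a0 sr) (ccvg_cst (hzT s a 1)); rewrite subrK.
rewrite (_ : (fun n => _ + _) = fun n => hzT s a n.+1)//.
by apply/funext => n; rewrite [RHS]hzT_psum addrC.
Qed.

Lemma hzT_tail s a N : s != 1 -> 0 <= a -> -1 < cRe s ->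
  cmod (hzT s a N.+1 - hzeta s a) <= cmod s * cmod (s + 1) * ptail (cRe s + 2) N.
Proof.
move=> s1 a0 sr; set C := cmod s * _; set p := cRe s + 2.
have p1 : 1 < p by rewrite /p; lra.
have cp : cvgn (series (pterm p)) by exact: pseries_cvg.
have cb : cvgn (series (C *: pterm p)) by exact: is_cvg_seriesZ.
rewrite cmodBC hzT_psum opprD addrA.
apply: (le_trans (csum_tail _ (hzeta_csum s1 a0 sr) _ cb)).
  by move=> n; apply: cmod_hzE_le => //; rewrite ?/p; lra.
have -> : limn (series (C *: pterm p)) = C * limn (series (pterm p)).
  rewrite lim_seriesZ//.
by rewrite /ptail mulrBr !seriesEord/= mulr_sumr.
Qed.

(** Isolates the term a^(-s), the only one that can be singular as a tends to 0. For a in [0, 1]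
    what remains has its parameter in [1, 2], where [hzeta_lipschitz] applies. *)
Lemma hzeta_shift s a : s != 1 -> 0 <= a -> -1 < cRe s ->
  hzeta s a = rpow a (- s) + hzeta s (1 + a).
Proof.
move=> s1 a0 sr; have a10 : 0 <= 1 + a by lra.
apply: (ccvg_unique ((ccvg_shiftS _ _).2 (hzT_cvg s1 a0 sr))).
rewrite (_ : (fun n => _) = fun n => rpow a (- s) + hzT s (1 + a) n).
  by apply: ccvgD; [exact: ccvg_cst|exact: hzT_cvg].
by apply/funext => n; rewrite hzT_shift.
Qed.

End EulerMaclaurin.

(** * Regularity of the continuation in a and in s *)

Section HurwitzRegularity.
Variable R : realType.
Implicit Types (s z w : R[i]) (x y a b : R).

Lemma is_derive_linear (K x : R) : is_derive x 1 (fun y => K * y) K.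
Proof.
rewrite (_ : (fun _ => _) = K *: (@id R))//.
by apply: is_derive_eq; rewrite /GRing.scale/= mulr1.
Qed.

Lemma lipschitz_cderive (f f' : R -> R[i]) a b (K : R) : a <= b ->
  (forall x, a <= x <= b -> cderive f x (f' x)) ->
  (forall x, a <= x <= b -> cmod (f' x) <= K) ->
  cmod (f b - f a) <= K * (b - a).
Proof.
move=> ab df fK; rewrite mulrBr.
exact: (mean_value_le ab df (fun x _ => is_derive_linear K x) fK).
Qed.

Lemma hzE_lipschitz s a b n : s != 1 -> -1 < cRe s -> 1 <= a -> a <= b ->
  cmod (hzE s b n - hzE s a n) <=
  cmod s * cmod (s + 1) * cmod (s + 2) * pterm (cRe s + 3) n * (b - a).
Proof.
move=> s1 sr a1 ab; have s10 : s - 1 != 0 by rewrite subr_eq0.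
pose g z x := z * rpow (n%:R + x) (z - 1) : R[i].
pose h z x := z * rpow (n.+1%:R + x) (z - 1) : R[i].
have pos x : a <= x <= b -> 0 < n%:R + x.
  by move=> /andP[ax _]; rewrite ltr_wpDl// (lt_le_trans _ ax)// (lt_le_trans _ a1).
have pos1 x : a <= x <= b -> 0 < n.+1%:R + x.
  by move=> /andP[ax _]; rewrite ltr_wpDl// (lt_le_trans _ ax)// (lt_le_trans _ a1).
apply: (@lipschitz_cderive (fun x => hzE s x n)
  (fun x => (g (- s) x + h (- s) x) / 2 + (h (1 - s) x - g (1 - s) x) / (s - 1))) => // x hx.
  have mc (c : R[i]) f l : cderive f x l -> cderive (fun y => f y * c) x (l * c).
    move=> d; apply: (cderive_eq (cderiveM d (cderive_cst c x))).
    by rewrite mulr0 addr0.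
  rewrite /hzE; apply: cderiveD; apply: mc.
    by apply: cderiveD; apply: cderive_rpow_shift; [exact: pos|exact: pos1].
  by apply: cderiveB; apply: cderive_rpow_shift; [exact: pos1|exact: pos].
have nx : n.+1%:R <= n%:R + x.
  by have /andP[ax _] := hx; rewrite -natr1 lerD2l (le_trans a1).
have -> : (g (- s) x + h (- s) x) / 2 + (h (1 - s) x - g (1 - s) x) / (s - 1) =
  - s * (rpow (n%:R + x) (- s - 1) + rpow (n%:R + x + 1) (- s - 1)) / 2 -
  (rpow (n%:R + x + 1) (- s) - rpow (n%:R + x) (- s)).
  rewrite /g /h (_ : n%:R + x + 1 = n.+1%:R + x); last by rewrite -natr1; ring.
  rewrite (_ : 1 - s - 1 = - s); last by ring.
  by field.
apply: le_trans (cmod_dhzE (pos _ hx) _) _; first by lra.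
rewrite ler_wpM2l ?mulr_ge0//; apply: cmod_rpow_le => //; first by lra.
by rewrite cReD !cReN/=; lra.
Qed.

Lemma hzT0_lipschitz s a b : s != 1 -> -1 < cRe s -> 1 <= a -> a <= b -> b <= 2 ->
  cmod (hzT s b 0 - hzT s a 0) <= (cmod s + 2) * (b - a).
Proof.
move=> s1 sr a1 ab b2; have s10 : s - 1 != 0 by rewrite subr_eq0.
apply: (@lipschitz_cderive (fun x => hzT s x 0)
  (fun x => (- s * rpow x (- s - 1)) / 2 - rpow x (- s))) => // x /andP[ax xb].
  have x0 : 0 < 0 + x by rewrite add0r (lt_le_trans _ ax)// (lt_le_trans _ a1).
  rewrite /hzT; have mc (c : R[i]) f l : cderive f x l -> cderive (fun y => f y * c) x (l * c).
    move=> d; apply: (cderive_eq (cderiveM d (cderive_cst c x))).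
    by rewrite mulr0 addr0.
  apply: (@cderive_ext _ (fun x => rpow (0 + x) (- s) / 2 + rpow (0 + x) (1 - s) / (s - 1))).
    by move=> y; congr (_ + _); rewrite big_ord0 [RHS]add0r.
  apply: (cderive_eq (cderiveD (mc _ _ _ (cderive_rpow_shift (- s) x0))
     (mc _ _ _ (cderive_rpow_shift (1 - s) x0)))).
  rewrite add0r (_ : 1 - s - 1 = - s); last by ring.
  by field.
have x1 : 1 <= x by exact: le_trans ax.
have x0 : 0 < x by exact: lt_le_trans x1.
apply: le_trans (cmodB _ _) _; apply: lerD.
  rewrite cmodM cmodV cmod_nat cmodM cmodN ler_pdivrMr// ler_wpM2l//.
  rewrite cmod_rpow// (@le_trans _ _ 1)//; last by rewrite ler1n.
  by rewrite -[leRHS](powRr0 x) ler_powR// cReD !cReN/=; lra.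
rewrite cmod_rpow// (@le_trans _ _ (x `^ 1))//; last by rewrite powRr1 ?(ltW x0)// (le_trans xb).
by rewrite ler_powR// cReN; lra.
Qed.

Lemma hzeta_lipschitz s : s != 1 -> -1 < cRe s ->
  exists2 L, 0 <= L & forall a b, 1 <= a <= 2 -> 1 <= b <= 2 ->
    cmod (hzeta s b - hzeta s a) <= L * `|b - a|.
Proof.
move=> s1 sr; have p1 : 1 < cRe s + 3 by lra.
have cp := pseries_cvg p1.
have ndp : nondecreasing_seq (series (pterm (cRe s + 3))).
  by apply: nondecreasing_series => k _ _; exact: pterm_ge0.
have lp0 n : series (pterm (cRe s + 3)) n <= limn (series (pterm (cRe s + 3))).
  exact: nondecreasing_cvgn_le.
set K := cmod s * cmod (s + 1) * cmod (s + 2).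
have K0 : 0 <= K by rewrite !mulr_ge0.
have l0 : 0 <= limn (series (pterm (cRe s + 3))).
  by apply: le_trans (lp0 0%N); rewrite seriesEord/= big_ord0.
pose L := cmod s + 2 + K * limn (series (pterm (cRe s + 3))).
exists L; first by rewrite !addr_ge0// mulr_ge0.
move=> a b ha hb; wlog ab : a b ha hb / a <= b.
  move=> H; have [ab|/ltW ba] := leP a b; first exact: H.
  by rewrite cmodBC distrC; exact: H.
move: ha hb => /andP[a1 a2] /andP[b1 b2]; rewrite ger0_norm ?subr_ge0//.
have a0 : 0 <= a by lra.
have b0 : 0 <= b by lra.
apply: (ccvg_le (ccvgB (hzT_cvg s1 b0 sr) (hzT_cvg s1 a0 sr))); near=> N.
have e x : hzT s x N = hzT s x 0 + psum (hzE s x) N.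
  elim: (N) => [|m IH]; first by rewrite /psum big_ord0 addr0.
  by rewrite [LHS]hzTS IH /psum big_ord_recr/= -addrA.
rewrite !e opprD addrACA; apply: le_trans (cmodD _ _) _.
rewrite /L mulrDl; apply: lerD; first exact: hzT0_lipschitz.
rewrite /psum -sumrB; apply: le_trans (cmod_sum _ _) _.
apply: (@le_trans _ _ (\sum_(n < N) K * (b - a) * pterm (cRe s + 3) n)).
  apply: ler_sum => n _; apply: le_trans (hzE_lipschitz n s1 sr a1 ab) _.
  by rewrite -/K mulrAC.
rewrite -mulr_sumr [K * limn _ * _]mulrAC ler_wpM2l//.
  by rewrite mulr_ge0// subr_ge0.
by have := lp0 N; rewrite {1}seriesEord.
Unshelve. all: by end_near. Qed.

Lemma rpow_cvg0 z a : 0 <= a -> cRe z < 0 -> ccvg (fun n => rpow (n%:R + a) z) 0.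
Proof.
move=> a0 z0; apply/ccvg_shiftS.
apply: (ccvg_squeeze (b := pterm (- cRe z))); last by apply: pterm_cvg0; lra.
near=> n; rewrite subr0; apply: cmod_rpow_le => //; first by lra.
by rewrite lerDl.
Unshelve. all: by end_near. Qed.

(** For Re s > 1 both corrections in [hzT] tend to 0, so its limit is that of the plain partial
    sums. *)
Lemma hzeta_series s a : 0 <= a -> 1 < cRe s ->
  has_csum (fun n => rpow (n%:R + a) (- s)) (hzeta s a).
Proof.
move=> a0 sr; have s1 : s != 1 by apply: contraTneq sr => ->; rewrite /= ltxx.
have sr' : -1 < cRe s by lra.
have h1 : ccvg (fun n => rpow (n%:R + a) (- s)) 0 by apply: rpow_cvg0; rewrite // cReN; lra.
have h2 : ccvg (fun n => rpow (n%:R + a) (1 - s)) 0.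
  by apply: rpow_cvg0; rewrite // cReD cReN/=; lra.
have := ccvgB (hzT_cvg s1 a0 sr') (ccvgD (ccvgZ 2^-1 h1) (ccvgZ (s - 1)^-1 h2)).
rewrite !mulr0 addr0 subr0.
rewrite (_ : (fun n => _ - _) = psum (fun n => rpow (n%:R + a) (- s)))//.
by apply/funext => n; rewrite /hzT /psum; ring.
Qed.

Lemma is_pser_rpow x c z r : 0 < r -> is_pser (fun w => rpow x (c - w)) z r.
Proof.
move=> r0; apply: is_pser_ext (is_pserZ (rpow x c) (is_pser_cexp (- (ln x)%:C) z r0)).
by move=> w _; rewrite rpowD; congr (_ * _); rewrite /rpow; congr cexp; ring.
Qed.

Lemma is_pser_rpowN x z r : 0 < r -> is_pser (fun w => rpow x (- w)) z r.
Proof.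
move=> r0; apply: is_pser_ext (is_pser_rpow x 0 z r0) => w _.
by rewrite sub0r.
Qed.

Lemma is_pser_hzE x n z r : z != 1 -> 0 < r <= cmod (z - 1) / 2 ->
  is_pser (fun w => hzE w x n) z r.
Proof.
move=> z1 r0; have inv := is_pser_shrink r0 (is_pser_inv z1).
have /andP[{}r0 _] := r0; rewrite /hzE.
apply: is_pserD.
  apply: is_pser_ext (is_pserZ 2^-1 (is_pserD (is_pser_rpowN (n%:R + x) z r0)
    (is_pser_rpowN (n.+1%:R + x) z r0))) => w _.
  by rewrite mulrC.
apply: is_pserM inv.
apply: is_pser_ext (is_pserD (is_pser_rpow (n.+1%:R + x) 1 z r0)
   (is_pserZ (-1) (is_pser_rpow (n%:R + x) 1 z r0))) => w _.
by rewrite mulN1r.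
Qed.

Lemma is_pser_hzT1 x z r : z != 1 -> 0 < r <= cmod (z - 1) / 2 ->
  is_pser (fun w => hzT w x 1) z r.
Proof.
move=> z1 r0; have inv := is_pser_shrink r0 (is_pser_inv z1).
have /andP[{}r0 _] := r0; rewrite /hzT.
apply: is_pserD; last by apply: is_pserM inv; exact: is_pser_rpow.
apply: is_pser_ext (is_pserD (is_pser_rpowN (0 + x) z r0)
   (is_pserZ 2^-1 (is_pser_rpowN (1 + x) z r0))) => w _.
by rewrite big_ord1 mulrC.
Qed.

Lemma cRe_ball z w (r : R) : cmod (w - z) <= r -> cRe z - r <= cRe w <= cRe z + r.
Proof.
move=> wr; have := le_trans (cRe_cmod _) wr; rewrite cReD cReN ler_norml.
by move=> /andP[]; lra.
Qed.

Lemma cmod_ball z w (r : R) : cmod (w - z) <= r -> cmod w <= cmod z + r.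
Proof. by move=> wr; have := cmodD (w - z) z; rewrite subrK; lra. Qed.

Lemma is_pser_hzeta x z : 0 <= x -> z != 1 -> -1 < cRe z ->
  exists2 r, 0 < r & is_pser (fun w => hzeta w x) z r.
Proof.
move=> x0 z1 zr; have m0 : 0 < cmod (z - 1) by rewrite cmod_gt0 subr_eq0.
(* Half the distance to the pole, so that [is_pser_inv] applies, and half the distance to the line
   Re = -1, so that the exponent [cRe z - r + 2] of the majorant exceeds 1. *)
pose r := Num.min (cmod (z - 1) / 2) ((cRe z + 1) / 2).
have r0 : 0 < r by rewrite lt_min; apply/andP; split; lra.
have rz : r <= cmod (z - 1) / 2 by rewrite ge_min lexx.
have rr : r <= (cRe z + 1) / 2 by rewrite ge_min lexx orbT.
have r0z : 0 < r <= cmod (z - 1) / 2 by rewrite r0.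
exists (r / 2); first by rewrite divr_gt0.
have w1 w : cmod (w - z) <= r -> w != 1.
  move=> wr; apply: contraTneq wr => ->; rewrite -ltNge cmodBC.
  by apply: (le_lt_trans rz); lra.
have p1 : 1 < cRe z - r + 2 by lra.
apply: is_pser_ext (is_pserD (is_pser_shrink _ (is_pser_hzT1 x z1 r0z))
  (is_pser_sum (r := r) (f := fun w => hzeta w x - hzT w x 1)
   (M := fun n => (cmod z + r) * (cmod z + r + 1) * pterm (cRe z - r + 2) n)
   (fun n => is_pser_hzE x n.+1 z1 r0z) _ _ _)).
- by move=> w _; rewrite addrC subrK.
- by rewrite divr_gt0//=; lra.
- move=> n w wr; have /andP[wr1 wr2] := cRe_ball wr; have mw := cmod_ball wr.
  apply: cmod_hzE_le => //; [exact: w1|lra|lra|lra|].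
  rewrite ler_pM// (le_trans (cmodD _ _))// cmod1; lra.
- rewrite (_ : (fun n => _) = ((cmod z + r) * (cmod z + r + 1)) *: pterm (cRe z - r + 2))//.
  by apply: is_cvg_seriesZ; exact: pseries_cvg.
- move=> w wr; have /andP[wr1 wr2] := cRe_ball wr.
  by apply: hzeta_csum => //; [exact: w1|lra].
Qed.

End HurwitzRegularity.

(** * Integrals as limits over exhausting sets *)

Section Exhaustion.
Variable R : realType.
Notation mu := (@lebesgue_measure R).
Notation T := (measurableTypeR R).
Implicit Types (D : set T) (f g : R -> R[i]).

(** Monotone convergence. It settles integrability near 0 and at infinity from explicit
    antiderivatives on segments. *)
Lemma integrable_exhaust D (Dn : nat -> set T) (h : R -> R) (C : R) :
  nondecreasing_seq Dn -> (forall n, measurable (Dn n)) -> D = \bigcup_n Dn n ->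
  (forall x, D x -> 0 <= h x) -> measurable_fun (setT : set T) h ->
  (forall n, \int[mu]_(x in Dn n) (h x)%:E <= C%:E)%E -> mu.-integrable D (EFin \o h).
Proof.
move=> nd mDn DE h0 mh hC.
have mD : measurable D by rewrite DE; exact: bigcup_measurable.
have mhE E : measurable_fun (E : set T) (EFin \o h).
  by apply/measurable_EFinP; exact: measurable_funTS.
have DnD n : Dn n `<=` D by rewrite DE => x Dx; exists n.
apply/integrableP; split => //.
have -> : (\int[mu]_(x in D) `|(EFin \o h) x| = \int[mu]_(x in D) (h x)%:E)%E.
  by apply: eq_integral => x; rewrite inE => Dx; rewrite /= ger0_norm// h0.
have := @ge0_nondecreasing_set_cvg_integral _ _ R Dn (EFin \o h) mu nd mDn
  (fun n => mhE (Dn n)) (fun n x Dx => (h0 x (DnD n x Dx) : (0 <= (h x)%:E)%E)).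
rewrite -DE => cv; rewrite (le_lt_trans (y := C%:E))// ?ltry//.
rewrite -(cvg_lim _ cv)//; apply: lime_le; first by apply/cvg_ex; eexists; exact: cv.
by near=> n; exact: hC.
Unshelve. all: by end_near. Qed.

Lemma cintegral_exhaust D (Dn : nat -> set T) f : measurable D ->
  (forall n, measurable (Dn n)) -> (forall n, Dn n `<=` D) ->
  (forall x, D x -> \forall n \near \oo, Dn n x) -> cintegrable D f ->
  ccvg (fun n => cintegral (Dn n) f) (cintegral D f).
Proof.
move=> mD mDn DnD Dnear [ir ii].
have key (h : R -> R) : mu.-integrable D (EFin \o h) ->
    (fun n => \int[mu]_(x in Dn n) h x) @ \oo --> \int[mu]_(x in D) h x.
  move=> ih; have mh : measurable_fun D (EFin \o h) := measurable_int mu ih.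
  have ia := integrable_abse ih.
  have [|||_ _ cv] := @dominated_convergence _ _ _ mu D mD
    (fun n => (EFin \o h) \_ (Dn n)) (EFin \o h) (abse \o (EFin \o h)) _ mh _ ia _.
  - move=> n; apply/(measurable_restrict _ (mDn n) mD).
    by apply: measurable_funS mh.
  - apply: aeW => x Dx; apply: cvg_near_cst.
    by have := Dnear x Dx; apply: filterS => n Dnx; rewrite patchE mem_set.
  - apply: aeW => x n Dx; rewrite patchE; case: ifP => // _.
    by rewrite abse0 abse_ge0.
  rewrite /Rintegral; apply: fine_cvg.
  rewrite fineK; last exact: integrable_fin_num.
  apply: cvg_trans cv; apply: near_eq_cvg; near=> n.
  by rewrite /= -integral_mkcondr setIidr.
by apply/ccvg_parts; split => /=; exact: key.
Unshelve. all: by end_near. Qed.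

End Exhaustion.

(** * Integrability of x^(-p) e^(-c x) *)

Section GammaIntegrals.
Variable R : realType.
Notation mu := (@lebesgue_measure R).
Notation T := (measurableTypeR R).

Lemma le_eqLR (x y z : \bar R) : x = y -> (y <= z -> x <= z)%E.
Proof. by move=> ->. Qed.

Lemma integral_FTC (F f : R -> R) (a b : R) : a <= b ->
  (forall x, a <= x <= b -> is_derive x 1 F (f x)) ->
  (forall x, a <= x <= b -> {for x, continuous f}) ->
  (\int[mu]_(x in `[a, b]) (f x)%:E)%E = (F b - F a)%:E.
Proof.
move=> ab dF cf.
have [||[ir _] /(congr1 (@complex.Re R))] :=
  @cintegral_FTC R a b (fun x => (F x)%:C) (fun x => (f x)%:C) ab.
- by move=> x /dF; exact: cderive_real.
- by move=> x /cf h; split => //=; exact: cst_continuous.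
rewrite cReD cReN /= => <-; rewrite /Rintegral fineK//.
by apply: integrable_fin_num ir.
Qed.

Lemma rpow_real (x p : R) : 0 < x -> rpow x p%:C = (x `^ p)%:C.
Proof.
by move=> x0; rewrite /rpow -rmorphM/= cexp_real /powR gt_eqF.
Qed.

Lemma is_derive_powR (x p : R) : 0 < x ->
  is_derive x 1 (fun y => y `^ p) (p * x `^ (p - 1)).
Proof.
move=> x0; have xI : x \in `]0, +oo[ by rewrite in_itv/= x0.
apply: DeriveDef; first exact: derivable_powR.
by rewrite -derive1E powR_derive1.
Qed.

Lemma is_derive_continuous (f : R -> R) (x l : R) : is_derive x 1 f l -> {for x, continuous f}.
Proof.
by move=> [h _]; apply: differentiable_continuous; exact/derivable1_diffP.
Qed.

Lemma integrable_powR (p X : R) : p < 1 -> 0 < X ->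
  mu.-integrable `]0, X] (EFin \o (fun x => x `^ (- p))).
Proof.
move=> p1 X0; have q0 : 0 < 1 - p by lra.
pose Dn n : set T := `[X / n.+1%:R, X]%classic.
have xn0 n : 0 < X / n.+1%:R by rewrite divr_gt0.
have xnX n : X / n.+1%:R <= X by rewrite ler_pdivrMr// ler_peMr ?(ltW X0)// ler1n.
apply: (@integrable_exhaust _ _ Dn _ (X `^ (1 - p) / (1 - p))) => //.
- apply/nondecreasing_seqP => n; apply/subsetPset => x /=; rewrite /Dn/= !in_itv/=.
  move=> /andP[h ->]; rewrite andbT; apply: le_trans h.
  by rewrite ler_pM2l// lef_pV2 ?posrE// ler_nat.
- by move=> n; exact: measurable_itv.
- apply/seteqP; split => [x /=|x [n _]]; rewrite /Dn/= !in_itv/=.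
    move=> /andP[x0 xX]; exists (Num.bound (X / x)) => //=; rewrite /Dn/= in_itv/= xX andbT.
    rewrite ler_pdivrMr// mulrC -ler_pdivrMr//.
    apply: ltW; apply: (lt_trans (archi_boundP _)); first by rewrite divr_ge0// ltW.
    by rewrite ltr_nat.
  by move=> /andP[h ->]; rewrite andbT (lt_le_trans _ h).
- by move=> x _; exact: powR_ge0.
- move=> n; have := @integral_FTC (fun x => x `^ (1 - p) / (1 - p))
    (fun x => x `^ (- p)) _ _ (xnX n).
  move=> /(_ _ _)/le_eqLR; apply => [x /andP[xn _]|x /andP[xn _]|].
  - have x0 : 0 < x by exact: lt_le_trans (xn0 n) xn.
    have h := is_derive_powR (1 - p) x0.
    have -> : (fun x => x `^ (1 - p) / (1 - p)) = (1 - p)^-1 *: (fun x => x `^ (1 - p)).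
      by apply/funext => y; rewrite fctE /GRing.scale/= mulrC.
    apply: is_derive_eq; rewrite /GRing.scale/= mulKf ?gt_eqF//.
    by rewrite addrAC subrr add0r.
  - have x0 : 0 < x by exact: lt_le_trans (xn0 n) xn.
    exact: is_derive_continuous (is_derive_powR (- p) x0).
  - by rewrite lee_fin gerBl divr_ge0 ?powR_ge0// ltW.
Qed.

Lemma is_derive_expNM (c x : R) :
  is_derive x 1 (fun x : R => expR (- (c * x))) (- c * expR (- (c * x))).
Proof.
have dl : is_derive x 1 (fun x : R => - (c * x)) (- c).
  rewrite (_ : (fun x => _) = (- c) *: (@id R)).
    by apply: is_derive_eq; rewrite /GRing.scale/= mulr1.
  by apply/funext => y; rewrite fctE /GRing.scale/= mulNr.
apply: is_derive_eq' (is_derive1_comp (is_derive_expR _) dl) _.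
by rewrite mulrC.
Qed.

Lemma measurable_expNM (c : R) (D : set T) : measurable_fun D (fun x : R => expR (- (c * x))).
Proof.
apply: measurable_funTS; apply: continuous_measurable_fun => x.
exact: is_derive_continuous (is_derive_expNM c x).
Qed.

Lemma integrable_expN (c : R) : 0 < c ->
  mu.-integrable `[1, +oo[ (EFin \o (fun x => expR (- (c * x)))).
Proof.
move=> c0; pose Dn n : set T := `[1, 1 + n%:R]%classic.
have de x := is_derive_expNM c x.
apply: (@integrable_exhaust _ _ Dn _ (expR (- c) / c)) => //.
- apply/nondecreasing_seqP => n; apply/subsetPset => x /=; rewrite /Dn/= !in_itv/=.
  by move=> /andP[-> h]/=; apply: (le_trans h); rewrite lerD2l ler_nat.
- by move=> n; exact: measurable_itv.
- apply/seteqP; split => [x /=|x [n _]]; rewrite /Dn/= !in_itv/=.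
    rewrite andbT => x1; exists (Num.bound x) => //=; rewrite /Dn/= in_itv/= x1/=.
    rewrite (le_trans (ltW (archi_boundP _)))//; first by rewrite (le_trans _ x1).
    by rewrite lerDr.
  by move=> /andP[->].
- exact: measurable_expNM.
- move=> n; have n1 : 1 <= 1 + n%:R :> R by rewrite lerDl.
  have := @integral_FTC (fun x => - c^-1 * expR (- (c * x)))
    (fun x => expR (- (c * x))) _ _ n1.
  move=> /(_ _ _)/le_eqLR; apply => [x _|x _|].
  - have h := de x.
    have -> : (fun x => - c^-1 * expR (- (c * x))) = (- c^-1) *: (fun x => expR (- (c * x))).
      by apply/funext => y; rewrite fctE.
    by apply: is_derive_eq; rewrite /GRing.scale/= mulrA mulrNN mulVf ?gt_eqF// mul1r.
  - exact: is_derive_continuous (de x).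
  - rewrite lee_fin mulr1 !mulNr opprK addrC mulrC.
    by rewrite gerBl mulr_ge0 ?expR_ge0// invr_ge0 ltW.
Qed.

Lemma powR_le_exp (q c : R) : 0 < c ->
  exists2 K, 0 < K & forall x, 1 <= x -> x `^ q <= K * expR (c * x).
Proof.
(* The scale d is chosen so that multiplying ln (d x) <= d x - 1 by |q| + 1 produces exactly c x;
   the added 1 keeps the divisor nonzero when q = 0. *)
move=> c0; pose d := c / (`|q| + 1); have q0 : 0 < `|q| + 1 by rewrite ltr_wpDl.
have d0 : 0 < d by rewrite divr_gt0.
exists (expR (- (`|q| + 1) * (1 + ln d))) => [|x x1]; first exact: expR_gt0.
have x0 : 0 < x by exact: lt_le_trans x1.
rewrite -expRD /powR gt_eqF// ler_expR.
have lx : 0 <= ln x by exact: ln_ge0.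
apply: (@le_trans _ _ ((`|q| + 1) * ln x)).
  by rewrite ler_wpM2r// (le_trans (ler_norm _))// lerDl.
have : ln (d * x) <= d * x - 1.
  have dx0 : 0 < d * x by rewrite mulr_gt0.
  have := @le_ln1Dx R (d * x - 1); rewrite [1 + _]addrC subrK; apply; lra.
rewrite lnM ?posrE// => h.
have -> : c * x = (`|q| + 1) * (d * x) by rewrite /d; field; rewrite gt_eqF.
rewrite mulNr -mulrN -mulrDr ler_wpM2l ?(ltW q0)//; lra.
Qed.

Lemma integrable_gamma (p c : R) : p < 1 -> 0 < c ->
  mu.-integrable `]0, +oo[ (EFin \o (fun x => x `^ (- p) * expR (- (c * x)))).
Proof.
move=> p1 c0.
have mh (D : set T) : measurable_fun D (EFin \o (fun x => x `^ (- p) * expR (- (c * x)))).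
  apply/measurable_EFinP; apply: measurable_funM; last exact: measurable_expNM.
  exact: measurable_funTS.
have m1 : measurable (`]0, 1]%classic : set T) by exact: measurable_itv.
have m2 : measurable (`]1, +oo[%classic : set T) by exact: measurable_itv.
have -> : `]0, +oo[%classic = `]0, 1] `|` `]1, +oo[ :> set R.
  by rewrite -itv_bndbnd_setU// bnd_simp.
have i1 : mu.-integrable `]0, 1] (EFin \o (fun x => x `^ (- p) * expR (- (c * x)))).
  apply: (le_integrable m1 (mh _) _ (integrable_powR p1 ltr01)) => x /=.
  rewrite in_itv/= => /andP[x0 _]; rewrite lee_fin.
  rewrite !ger0_norm ?mulr_ge0 ?powR_ge0 ?expR_ge0// ler_piMr ?powR_ge0//.
  by rewrite expR_le1 oppr_le0 mulr_ge0// ltW.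
(* Half of the exponential decay absorbs the power of x, and the other half is still integrable. *)
have c20 : 0 < c / 2 by rewrite divr_gt0.
have i2 : mu.-integrable `]1, +oo[ (EFin \o (fun x => x `^ (- p) * expR (- (c * x)))).
  have [K K0 HK] := powR_le_exp (- p) c20.
  have i3 := integrableZl m2 K (integrableS _ m2 _ (integrable_expN c20)).
  apply: (le_integrable m2 (mh _) _ (i3 _ _)) => // x /=.
    rewrite in_itv/= andbT => x1; rewrite lee_fin.
    rewrite !ger0_norm ?mulr_ge0 ?powR_ge0 ?expR_ge0// ?(ltW K0)//.
    have -> : expR (- (c / 2 * x)) = expR (c / 2 * x) * expR (- (c * x)).
      by rewrite -expRD; congr expR; field.
    by rewrite mulrA ler_wpM2r ?expR_ge0// HK// ltW.
  by rewrite !in_itv/= !andbT => /ltW.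
apply/integrableP; split; first exact: mh.
rewrite ge0_integral_setU//=; last 2 first.
- apply/measurable_EFinP; apply: measurableT_comp => //.
  by have /measurable_EFinP := mh (`]0, 1]%classic `|` `]1, +oo[%classic).
- apply/disj_setPS => x /= []; rewrite !in_itv/= andbT => /andP[_ x1].
  by rewrite ltNge x1.
by move/integrableP: i1 => [_ ?]; move/integrableP: i2 => [_ ?]; exact: lte_add_pinfty.
Qed.

End GammaIntegrals.

(** * The Gamma integral: analyticity and truncation *)

Section GammaFunction.
Variable R : realType.
Notation mu := (@lebesgue_measure R).
Notation T := (measurableTypeR R).
Implicit Types (s w z : R[i]) (x X : R).

(** For w = 1 this is the integrand of Gamma(1 - s); for w = 2 pi i m it is the unfolded integrand
    of the m-th Fourier coefficient. The rotation moves w from the first value to the second. *)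
Definition gint s w x : R[i] := rpow x (- s) * cexp (- (w * x%:C)).

Lemma cmod_gint s w x : 0 < x -> cmod (gint s w x) = x `^ (- cRe s) * expR (- (cRe w * x)).
Proof.
move=> x0; rewrite /gint cmodM cmod_rpow// cmod_cexp !cReN; congr (_ * expR (- _)).
by rewrite cReM/= mulr0 subr0.
Qed.

Lemma cmeasurable_gint (D : set T) s w : cmeasurable D (gint s w).
Proof.
apply: cmeasurableM; first exact: cmeasurable_rpow.
by apply: cmeasurable_cexp; apply: cmeasurableN; apply: cmeasurableZ; exact: cmeasurable_id.
Qed.

Lemma cderive_gint s w x : 0 < x ->
  cderive (gint s w) x (- s * gint (s + 1) w x - w * gint s w x).
Proof.
move=> x0; apply: (cderive_eq (cderiveM (cderive_rpow (- s) x0)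
  (cderive_cexp (cderiveN (cderiveZ w (cderive_id x)))))).
by rewrite /gint opprD; ring.
Qed.

Lemma ccontinuous_gint s w x : 0 < x -> ccontinuous (gint s w) x.
Proof. by move=> x0; exact: cderive_ccontinuous (cderive_gint s w x0). Qed.

Lemma cintegrable_gint_y s w : cRe s < 1 -> 0 < cRe w ->
  cintegrable `]0, +oo[ (gint s w).
Proof.
move=> s1 w0; have mI : measurable (`]0, +oo[%classic : set T) by exact: measurable_itv.
apply: (cintegrable_le mI (cmeasurable_gint _ _ _) (integrable_gamma s1 w0)) => x Dx.
have x0 : 0 < x by move: Dx; rewrite /= in_itv/= andbT.
by rewrite cmod_gint.
Qed.

Lemma gint_le s w x X : 0 < x <= X ->
  cmod (gint s w x) <= expR (cmod w * X) * x `^ (- cRe s).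
Proof.
move=> /andP[x0 xX]; rewrite cmod_gint// mulrC ler_wpM2r ?powR_ge0// ler_expR.
rewrite -mulNr; apply: (@le_trans _ _ (cmod w * x)).
  by rewrite ler_wpM2r ?(ltW x0)// -cReN (le_trans (ler_norm _))// (le_trans (cRe_cmod _))// cmodN.
by rewrite ler_wpM2l.
Qed.

Lemma cintegrable_gint s w X : cRe s < 1 -> 0 < X -> cintegrable `]0, X] (gint s w).
Proof.
move=> s1 X0; have mI : measurable (`]0, X]%classic : set T) by exact: measurable_itv.
have ih := integrableZl mI (expR (cmod w * X)) (integrable_powR s1 X0).
apply: (cintegrable_le mI (cmeasurable_gint _ _ _) ih) => x Dx.
by apply: gint_le; move: Dx; rewrite /= in_itv.
Qed.

Lemma cgammaE s : cgamma (1 - s) = cintegral `]0, +oo[ (gint s 1).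
Proof.
apply: eq_cintegral => x; rewrite inE/= in_itv/= andbT => x0.
rewrite cpow_pos// (_ : 1 - s - 1 = - s); last by ring.
by rewrite /gint mul1r -rmorphN cexp_real.
Qed.

Lemma exp_coeff_le x k : 0 <= x -> exp_coeff x k <= expR x.
Proof.
move=> x0; case: k => [|k].
  by rewrite /exp_coeff/= expr0 fact0 divr1 -expR0 ler_expR.
by apply: le_trans (expR_ge1Dxn k x0); rewrite /exp_coeff/= lerDr.
Qed.

Lemma exp_coeffM x (r : R) k : exp_coeff x k * r ^+ k = exp_coeff (x * r) k.
Proof. by rewrite /exp_coeff/= exprMn; ring. Qed.

(** Under the integral x^(-w) is expanded in powers of w - z. Its coefficients contain |ln x|^k /
    k!, and |ln x|^k r^k / k! <= e^(r |ln x|) <= x^r + x^(-r): the majorant is a sum of two Gamma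
    integrands with exponents Re z + r and Re z - r, both below 1. *)
Lemma is_pser_cgamma z : cRe z < 1 ->
  exists2 r, 0 < r & is_pser (fun w => cgamma (1 - w)) z r.
Proof.
move=> z1; pose r := (1 - cRe z) / 2; have r0 : 0 < r by rewrite divr_gt0//; lra.
exists (r / 2); first by rewrite divr_gt0.
apply: (@is_pser_ext _ (fun w => cintegral `]0, +oo[ (gint w 1))).
  by move=> w _; rewrite cgammaE.
have mI : measurable (`]0, +oo[%classic : set T) by exact: measurable_itv.
pose h (p x : R) := x `^ (- p) * expR (- (1 * x)).
apply: (@is_pser_integral _ _ (fun x w => gint w 1 x)
  (fun x k => cexp (- x%:C) * (cexp (- (ln x)%:C * z) * expc (- (ln x)%:C) k))
  (fun x => h (cRe z + r) x + h (cRe z - r) x)) => //.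
- move=> x _; apply: pser_ext (pserZ (cexp (- x%:C)) (pser_cexp (- (ln x)%:C) z r0)) => w _.
  by rewrite /gint mul1r mulrC; congr (_ * _); rewrite /rpow; congr cexp; ring.
- move=> x k Dx; have x0 : 0 < x by move: Dx; rewrite /= in_itv/= andbT.
  rewrite cmodM cmodM cmod_expc cmodN cmod_real.
  rewrite [leLHS](_ : _ = cmod (cexp (- x%:C)) *
    (cmod (cexp (- (ln x)%:C * z)) * exp_coeff (`|ln x| * r) k)); last first.
    by rewrite -exp_coeffM; ring.
  have -> : cmod (cexp (- x%:C)) = expR (- (1 * x)) by rewrite cmod_cexp cReN mul1r.
  have -> : cmod (cexp (- (ln x)%:C * z)) = x `^ (- cRe z).
    by rewrite mulrC mulrN -mulNr -/(rpow x (- z)) cmod_rpow// cReN.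
  rewrite /h -mulrDl mulrC ler_wpM2r ?expR_ge0//.
  have -> : - (cRe z + r) = - cRe z - r by ring.
  have -> : - (cRe z - r) = - cRe z + r by ring.
  have xn0 : x != 0 by rewrite gt_eqF.
  rewrite !powRD ?xn0 ?implybT// -mulrDr ler_wpM2l ?powR_ge0//.
  apply: le_trans (exp_coeff_le _ _) _; first by rewrite mulr_ge0// ltW.
  rewrite /powR (negbTE xn0) mulrC; case: (ger0P (ln x)) => _.
    by rewrite lerDr expR_ge0.
  by rewrite mulrN -mulNr lerDl expR_ge0.
- have i1 : mu.-integrable `]0, +oo[ (EFin \o h (cRe z + r)).
    by apply: integrable_gamma => //; rewrite /r; lra.
  have i2 : mu.-integrable `]0, +oo[ (EFin \o h (cRe z - r)).
    by apply: integrable_gamma => //; rewrite /r; lra.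
  exact: (integrableD mI i1 i2).
- move=> k; apply: cmeasurableM.
    by apply: cmeasurable_cexp; apply: cmeasurableN; exact: cmeasurable_id.
  have ml : cmeasurable (`]0, +oo[%classic : set T) (fun x => - (ln x)%:C).
    by apply: cmeasurableN; apply: cmeasurable_real; exact: measurable_funTS.
  apply: cmeasurableM.
    by apply: cmeasurable_cexp; apply: cmeasurableM => //; exact: cmeasurable_cst.
  by apply: cmeasurableM; [exact: cmeasurableX|exact: cmeasurable_cst].
- by move=> w _; exact: cmeasurable_gint.
Qed.

(** An incomplete Gamma integral. The range is cut at X because for imaginary w and Re s < 1 the
    integrand is not absolutely integrable at infinity. *)
Definition lower s w X : R[i] := cintegral `]0, X] (gint s w).

Lemma cderive_lower s w X : cRe s < 1 -> 0 < X -> cderive (lower s w) X (gint s w X).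
Proof.
move=> s1 X0; have X1 : X < X + 1 by rewrite ltrDl.
have X10 : 0 < X + 1 by exact: lt_trans X1.
have [ir ii] := cintegrable_gint w s1 X10.
have [cr ci] := ccontinuous_gint s w X0.
have aX : (BRight 0 < BRight X)%O by rewrite bnd_simp.
have [dr er] := @continuous_FTC1 _ _ (BRight 0) _ _ X1 ir aX cr.
have [di ei] := @continuous_FTC1 _ _ (BRight 0) _ _ X1 ii aX ci.
split; apply: DeriveDef; rewrite /lower /cintegral/=.
- exact: dr.
- by rewrite -derive1E er.
- exact: di.
- by rewrite -derive1E ei.
Qed.

(** The combined integrand is the derivative of x^(1 - s) e^(-w x), which tends to 0 at 0 since Re
    (1 - s) > 0. The fundamental theorem is applied on [X / (n + 1), X], away from the singularity,
    before n tends to infinity. *)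
Lemma lower_by_parts s w X : cRe s < 1 -> 0 < X ->
  (1 - s) * lower s w X - w * lower (s - 1) w X = rpow X (1 - s) * cexp (- (w * X%:C)).
Proof.
move=> s1 X0; have s1' : cRe (s - 1) < 1 by rewrite cReD cReN/=; lra.
have mI : measurable (`]0, X]%classic : set T) by exact: measurable_itv.
have i1 := cintegrableZ (1 - s) mI (cintegrable_gint w s1 X0).
have i2 := cintegrableZ w mI (cintegrable_gint w s1' X0).
rewrite -!cintegralZ//; try exact: cintegrable_gint.
rewrite -cintegralB//; set f := (fun x => _ - _).
pose F x : R[i] := rpow x (1 - s) * cexp (- (w * x%:C)).
pose Dn n : set T := `[X / n.+1%:R, X]%classic.
have xn0 n : 0 < X / n.+1%:R by rewrite divr_gt0.
have xnX n : X / n.+1%:R <= X by rewrite ler_pdivrMr// ler_peMr ?(ltW X0)// ler1n.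
have dF x : 0 < x -> cderive F x (f x).
  move=> x0; apply: (cderive_eq (cderiveM (cderive_rpow (1 - s) x0)
    (cderive_cexp (cderiveN (cderiveZ w (cderive_id x)))))).
  rewrite /f /gint (_ : 1 - s - 1 = - s); last by ring.
  by rewrite (_ : - (s - 1) = 1 - s); ring.
have cf x : 0 < x -> ccontinuous f x.
  move=> x0; apply: cderive_ccontinuous.
  exact: (cderiveB (cderiveZ _ (cderive_gint s w x0)) (cderiveZ _ (cderive_gint (s - 1) w x0))).
have FI n : cintegral (Dn n) f = F X - F (X / n.+1%:R).
  have [||_ ->//] := @cintegral_FTC R _ _ F f (xnX n).
    by move=> x /andP[h _]; apply: dF; exact: lt_le_trans h.
  by move=> x /andP[h _]; apply: cf; exact: lt_le_trans h.
have F0 : ccvg (fun n => F (X / n.+1%:R)) 0.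
  apply: (ccvg_squeeze (b := fun n => expR (cmod w * X) * X `^ (1 - cRe s) * pterm (1 - cRe s) n)).
    near=> n; rewrite subr0.
    have -> : F (X / n.+1%:R) = gint (s - 1) w (X / n.+1%:R).
      by rewrite /F /gint opprB.
    apply: le_trans (gint_le _ _ (X := X) _) _; first by rewrite xn0 xnX.
    rewrite -mulrA ler_wpM2l ?expR_ge0// cReD cReN/= opprB.
    rewrite powRM ?(ltW X0)// /pterm powRN -powR_inv1// -powRrM mulN1r.
    by rewrite powRN.
  rewrite -(mulr0 (expR (cmod w * X) * X `^ (1 - cRe s))); apply: cvgM; first exact: cvg_cst.
  by apply: pterm_cvg0; lra.
have cI : ccvg (fun n => cintegral (Dn n) f) (cintegral `]0, X] f).
  apply: cintegral_exhaust => //.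
  - by move=> n; exact: measurable_itv.
  - move=> n x; rewrite /Dn/= !in_itv/= => /andP[h ->]; rewrite andbT.
    exact: lt_le_trans h.
  - move=> x; rewrite /Dn/= in_itv/= => /andP[x0 xX].
    exists (Num.bound (X / x)) => // n /= hn; rewrite in_itv/= xX andbT.
    rewrite ler_pdivrMr// mulrC -ler_pdivrMr//.
    apply: ltW; apply: (lt_trans (archi_boundP _)); first by rewrite divr_ge0// ltW.
    by rewrite ltr_nat.
  - exact: cintegrableB.
apply: (ccvg_unique cI).
rewrite (_ : (fun n => _) = fun n => F X - F (X / n.+1%:R)); last exact/funext.
by rewrite -[X in ccvg _ X]subr0; apply: ccvgB => //; exact: ccvg_cst.
Unshelve. all: by end_near. Qed.

End GammaFunction.

(** * Rotating the ray of integration *)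

Section Rotation.
Variable R : realType.
Notation mu := (@lebesgue_measure R).
Notation T := (measurableTypeR R).
Implicit Types (s w z : R[i]) (x X : R).

Lemma cderive_under_integral (D : set T) (F F' : R -> R -> R[i]) (G : R -> R) (u a b : R) :
  measurable D -> a < u < b ->
  (forall v, a < v < b -> cintegrable D (F v)) ->
  (forall v x, a < v < b -> D x -> cderive (F ^~ x) v (F' v x)) ->
  (forall x, 0 <= G x) -> mu.-integrable D (EFin \o G) ->
  (forall v x, a < v < b -> D x -> cmod (F' v x) <= G x) ->
  cderive (fun v => cintegral D (F v)) u (cintegral D (F' u)).
Proof.
move=> mD aub iF dF G0 iG FG.
have key (f f' : R -> R -> R) :
    (forall v, a < v < b -> mu.-integrable D (EFin \o f v)) ->
    (forall v x, a < v < b -> D x -> is_derive v 1 (f ^~ x) (f' v x)) ->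
    (forall v x, a < v < b -> D x -> `|f' v x| <= G x) ->
    is_derive u 1 (fun v => \int[mu]_(x in D) f v x) (\int[mu]_(x in D) f' u x).
  move=> i_f df fG; have uI : `]a, b[%classic u by rewrite /= in_itv.
  have i1 v : `]a, b[%classic v -> mu.-integrable D (EFin \o f v).
    by rewrite /= in_itv; exact: i_f.
  have pE v x : `]a, b[%classic v -> D x -> partial1of2 f v x = f' v x.
    rewrite /= in_itv/= => h Dx; rewrite partial1of2E.
    by have [_ ->] := df v x h Dx.
  have d1 v x : `]a, b[%classic v -> D x -> derivable (f ^~ x) v 1.
    by rewrite /= in_itv/= => h Dx; have [] := df v x h Dx.
  have b1 v x : `]a, b[%classic v -> D x -> `|partial1of2 f v x| <= G x.
    by move=> h Dx; rewrite pE//; apply: fG => //; move: h; rewrite /= in_itv.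
  apply: DeriveDef; first exact: (derivable_under_integral mD uI i1 d1 G0 iG b1).
  rewrite -derive1E (differentiation_under_integral mD uI i1 d1 G0 iG b1).
  by apply: eq_Rintegral => x xD; rewrite pE//; exact: set_mem.
split => /=.
  apply: (key (fun v x => cRe (F v x)) (fun v x => cRe (F' v x))) => [v h|v x h Dx|v x h Dx].
  - by have [] := iF v h.
  - by have [] := dF v x h Dx.
  - exact: le_trans (cRe_cmod _) (FG v x h Dx).
apply: (key (fun v x => cIm (F v x)) (fun v x => cIm (F' v x))) => [v h|v x h Dx|v x h Dx].
- by have [] := iF v h.
- by have [] := dF v x h Dx.
- exact: le_trans (cIm_cmod _) (FG v x h Dx).
Qed.

Lemma cderive_Zid z u : cderive (fun v : R => v%:C * z) u z.
Proof.
apply: (cderive_eq (cderiveM (cderive_id u) (cderive_cst z u))).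
by rewrite mulr0 addr0 mul1r.
Qed.

Lemma gint_succ s w x : 0 < x -> x%:C * gint s w x = gint (s - 1) w x.
Proof.
move=> x0; rewrite /gint mulrA -rpowS//; congr (rpow _ _ * _); ring.
Qed.

(** The parameter runs over an open interval around [0, 1], so that two-sided derivatives exist at
    both ends; [W] bounds |e^(v z)| there and yields the dominating function. *)
Lemma cderive_lower_param s z X (u : R) : cRe s < 1 -> 0 < X -> -1 < u < 2 ->
  cderive (fun v => lower s (cexp (v%:C * z)) X) u
    (- (z * cexp (u%:C * z)) * lower (s - 1) (cexp (u%:C * z)) X).
Proof.
move=> s1 X0 hu; have s1' : cRe (s - 1) < 1 by rewrite cReD cReN/=; lra.
have mI : measurable (`]0, X]%classic : set T) by exact: measurable_itv.
pose W := expR (2 * cmod z).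
have wW (v : R) : -1 < v < 2 -> cmod (cexp (v%:C * z)) <= W.
  move=> /andP[v1 v2]; apply: (le_trans (cmod_cexp_le _)); rewrite ler_expR.
  rewrite cmodM ler_wpM2r// cmod_real; case: (ger0P v) => _; lra.
rewrite /lower -cintegralZ//; last exact: cintegrable_gint.
pose C := cmod z * W * X * expR (W * X).
have C0 : 0 <= C by rewrite /C !mulr_ge0 ?expR_ge0// ltW.
apply: (@cderive_under_integral _ (fun v => gint s (cexp (v%:C * z)))
  (fun v x => - (z * cexp (v%:C * z)) * gint (s - 1) (cexp (v%:C * z)) x)
  (fun x => C * x `^ (- cRe s)) u (-1) 2 mI hu) => //.
- by move=> v _; exact: cintegrable_gint.
- move=> v x _ /=; rewrite in_itv/= => /andP[x0 _].
  rewrite -gint_succ//; apply: (cderive_eq (cderiveM (cderive_cst (rpow x (- s)) v)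
    (cderive_cexp (cderiveN (cderiveM (cderive_cexp (cderive_Zid z v)) (cderive_cst x%:C v)))))).
  by rewrite /gint; ring.
- by move=> x; rewrite mulr_ge0 ?powR_ge0.
- by have := integrableZl mI C (integrable_powR s1 X0).
- move=> v x hv Dx; have /andP[x0 xX] : 0 < x <= X by move: Dx; rewrite /= in_itv.
  have hW := wW v hv.
  rewrite -gint_succ// cmodM cmodN cmodM [cmod (x%:C * _)]cmodM cmod_real gtr0_norm// /C -!mulrA.
  rewrite ler_wpM2l// ler_pM//.
    by rewrite mulr_ge0// ltW.
  rewrite ler_pM// ?(ltW x0)//.
  have h : 0 < x <= X by rewrite x0.
  apply: le_trans (gint_le _ _ h) _; rewrite ler_wpM2r ?powR_ge0// ler_expR.
  by rewrite ler_wpM2r// ltW.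
Qed.

(* [rotated s z X 0] tends to Gamma(1 - s) and [rotated s z X 1] is
   [e^(z (1 - s)) (\int_0^X x^(- s) e^(- w x) dx + X^(- s) e^(- w X) / w)] for
   [w = e^z]: the path [u |-> e^(u z)] turns the ray of integration. *)
Definition rotated s z X (u : R) : R[i] :=
  cexp (u%:C * (z * (1 - s))) * lower s (cexp (u%:C * z)) X +
  rpow X (- s) * cexp (- (cexp (u%:C * z) * X%:C) - u%:C * (z * s)).

(** By [lower_by_parts] the integrals collapse to a term of size X^(1 - Re s), and the second
    summand of [rotated] is designed to cancel it, leaving X^(- Re s). Without this gain of one
    power the arc would contribute X^(- Re s) after Jordan's lemma, which does not tend to 0 for Re
    s <= 0. *)
Lemma cderive_rotated s z X u : cRe s < 1 -> 0 < X -> -1 < u < 2 ->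
  cderive (rotated s z X) u
    (- (z * s) * rpow X (- s) * cexp (- (cexp (u%:C * z) * X%:C) - u%:C * (z * s))).
Proof.
move=> s1 X0 hu; rewrite /rotated.
apply: (cderive_eq (cderiveD
  (cderiveM (cderive_cexp (cderive_Zid (z * (1 - s)) u)) (cderive_lower_param z s1 X0 hu))
  (cderiveZ (rpow X (- s)) (cderive_cexp (cderiveB (cderiveN (cderiveM
     (cderive_cexp (cderive_Zid z u)) (cderive_cst X%:C u))) (cderive_Zid (z * s) u)))))).
set w := cexp (u%:C * z); set E := cexp (u%:C * _); set E2 := cexp (_ - _).
have h := lower_by_parts w s1 X0.
have E2E : E2 * w = cexp (- (w * X%:C)) * E.
  rewrite /E2 /E /w -!cexpD; congr cexp; ring.
have rX : rpow X (1 - s) = X%:C * rpow X (- s) by rewrite -rpowS//; congr rpow; ring.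
have -> : z * (1 - s) * E * lower s w X + E * (- (z * w) * lower (s - 1) w X) =
   z * E * ((1 - s) * lower s w X - w * lower (s - 1) w X) by ring.
rewrite h rX mulr0 addr0.
have -> : z * E * (X%:C * rpow X (- s) * cexp (- (w * X%:C))) =
   z * X%:C * rpow X (- s) * (cexp (- (w * X%:C)) * E) by ring.
by rewrite -E2E; ring.
Qed.

Lemma xexpN_le1 x : 0 <= x -> x * expR (- x) <= 1.
Proof.
move=> x0; rewrite expRN ler_pdivrMr ?expR_gt0// mul1r.
by apply: le_trans (expR_ge1Dx x); rewrite lerDr.
Qed.

(* Jordan's lemma: [1 <= sin + cos] on the first quadrant, [e^(- X cos) sin] has
   an explicit antiderivative and [X cos e^(- X cos) <= 1]. *)
Lemma rotated_diff_le s z X : cRe s < 1 -> 1 <= X -> 0 <= cRe z -> `|cIm z| = pi / 2 ->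
  cmod (rotated s z X 1 - rotated s z X 0) <=
  2 * (cmod (z * s) * expR (cmod (z * s))) * X `^ (- cRe s - 1).
Proof.
move=> s1 X1 zr zi; have X0 : 0 < X by exact: lt_le_trans X1.
set K := cmod (z * s) * _.
pose phi u : R := u * (pi / 2).
pose K' := K * X `^ (- cRe s).
have K0 : 0 <= K by rewrite mulr_ge0// expR_ge0.
have K'0 : 0 <= K' by rewrite mulr_ge0// powR_ge0.
pose G u : R := K' * (2 / pi / X * expR (- (X * cos (phi u))) + u / X).
pose G' u : R := K' * (expR (- (X * cos (phi u))) * sin (phi u) + X^-1).
have dG (u : R) : is_derive u 1 G (G' u).
  have dphi : is_derive u 1 phi (pi / 2).
    rewrite (_ : phi = (pi / 2) *: (@id R)).
      by apply: is_derive_eq; rewrite /GRing.scale/= mulr1.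
    by apply/funext => v; rewrite fctE /GRing.scale/= mulrC.
  have dc : is_derive u 1 (fun v => cos (phi v)) (- sin (phi u) * (pi / 2)).
    exact: is_derive_eq' (is_derive1_comp (is_derive_cos _) dphi) _.
  have dXc : is_derive u 1 (fun v => - (X * cos (phi v))) (X * (sin (phi u) * (pi / 2))).
    rewrite (_ : (fun v => _) = (- X) *: (fun v => cos (phi v))).
      by apply: is_derive_eq; rewrite /GRing.scale/=; ring.
    by apply/funext => v; rewrite fctE /GRing.scale/= mulNr.
  pose g (v : R) : R := - (X * cos (phi v)).
  have de : is_derive u 1 (fun v => expR (- (X * cos (phi v))))
      (expR (- (X * cos (phi u))) * (X * (sin (phi u) * (pi / 2)))).
    exact: (@is_derive1_comp _ expR g u _ _ (is_derive_expR (g u)) dXc).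
  rewrite /G (_ : (fun v => _) =
    K' *: ((2 / pi / X) *: (fun v => expR (- (X * cos (phi v)))) + X^-1 *: (@id R))).
    apply: is_derive_eq; rewrite /G' /GRing.scale/= mulr1.
    have p0 : (pi : R) != 0 by rewrite gt_eqF ?pi_gt0.
    by move: p0; set p := (pi : R); clearbody p => p0; field; rewrite (gt_eqF X0) p0.
  by apply/funext => v; rewrite !fctE /GRing.scale/= [_ * v]mulrC.
have dF u : 0 <= u <= 1 -> cderive (rotated s z X) u
    (- (z * s) * rpow X (- s) * cexp (- (cexp (u%:C * z) * X%:C) - u%:C * (z * s))).
  by move=> /andP[u0 u1]; apply: cderive_rotated => //; apply/andP; split; lra.
apply: (@le_trans _ _ (G 1 - G 0)).
  apply: (mean_value_le ler01 dF (fun u _ => dG u)) => u /andP[u0 u1].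
  have phi0 : 0 <= phi u by rewrite mulr_ge0// divr_ge0// pi_ge0.
  have phi1 : phi u <= pi / 2 by rewrite /phi ler_piMl// divr_ge0// pi_ge0.
  have cos0 : 0 <= cos (phi u) by apply: cos_ge0_pihalf; apply/andP; split; lra.
  have sin0 : 0 <= sin (phi u) by apply: sin_ge0_pi; apply/andP; split => //; have := pi_ge0 R; lra.
  rewrite !cmodM cmodN -!cmodM /G' /K' /K.
  rewrite [cmod (_ * rpow _ _ * _)]cmodM [cmod (_ * rpow _ _)]cmodM cmod_rpow// cReN.
  rewrite -!mulrA ler_wpM2l// [leRHS]mulrCA [leLHS]mulrC -[leLHS]mulrC ler_wpM2l ?powR_ge0//.
  rewrite cexpD cmodM mulrC ler_pM//.
    apply: le_trans (cmod_cexp_le _) _; rewrite ler_expR cmodN cmodM cmod_real ger0_norm//.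
    by rewrite ler_piMl.
  (* Since Re z >= 0 the modulus of e^(u z) is at least 1, and since cosine is even the sign of Im z
     does not matter: both half-turns of the ray are treated at once. *)
  have rew : cos (phi u) <= cRe (cexp (u%:C * z)).
    have -> : cRe (cexp (u%:C * z)) = expR (u * cRe z) * cos (phi u).
      rewrite /cexp cReM cImM /= !mul0r subr0 addr0; congr (_ * _).
      by rewrite -cos_norm normrM (ger0_norm u0) zi.
    by rewrite ler_peMl// -expR0 ler_expR mulr_ge0.
  rewrite cmod_cexp cReN cReM/= mulr0 subr0.
  apply: (@le_trans _ _ (expR (- (X * cos (phi u))))).
    by rewrite ler_expR lerN2 mulrC ler_wpM2r// ltW.
  have sc : 1 <= sin (phi u) + cos (phi u).
    rewrite -(ler_pXn2r (n:=2))// ?nnegrE ?addr_ge0// expr1n sqrrD.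
    by rewrite addrAC [sin _ ^+ 2 + _]addrC cos2Dsin2 lerDl mulrn_wge0// mulr_ge0.
  apply: (@le_trans _ _ (expR (- (X * cos (phi u))) * (sin (phi u) + cos (phi u)))).
    by rewrite ler_peMr// expR_ge0.
  rewrite mulrDr lerD2l -(ler_pM2l X0) mulfV ?gt_eqF//.
  rewrite [leLHS](_ : _ = X * cos (phi u) * expR (- (X * cos (phi u)))); last by ring.
  by apply: xexpN_le1; rewrite mulr_ge0// ltW.
rewrite /G -mulrBr.
(* The antiderivative contributes at most (2 / pi) / X <= 1 / X and the linear part 1 / X, whence
   the factor 2. *)
have -> : 2 * K * X `^ (- cRe s - 1) = K' * (2 / X).
  rewrite powRD; last by rewrite (gt_eqF X0) implybT.
  by rewrite powR_inv1 ?(ltW X0)// /K'; ring.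
rewrite ler_wpM2l// mul0r addr0.
have E1 : expR (- (X * cos (phi 1))) = 1 by rewrite /phi mul1r cos_pihalf mulr0 oppr0 expR0.
rewrite E1 mulr1 mul1r.
have p2 : 2 / pi <= 1 :> R by rewrite ler_pdivrMr ?pi_gt0// mul1r pi_ge2.
have : 0 <= 2 / pi / X * expR (- (X * cos (phi 0))).
  by rewrite mulr_ge0 ?expR_ge0// divr_ge0 ?(ltW X0)// divr_ge0// pi_ge0.
have : 2 / pi / X <= 1 / X by rewrite ler_wpM2r// invr_ge0 ltW.
rewrite mul1r; lra.
Qed.

Lemma lower_gamma_cvg s : -1 < cRe s < 1 ->
  ccvg (fun n => lower s 1 n.+1%:R) (cgamma (1 - s)).
Proof.
move=> /andP[s0 s1]; rewrite cgammaE.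
have mI : measurable (`]0, +oo[%classic : set T) by exact: measurable_itv.
apply: (@cintegral_exhaust _ _ (fun n => `]0, n.+1%:R]%classic) _ mI).
- by move=> n; exact: measurable_itv.
- by move=> n x; rewrite /= !in_itv/= => /andP[-> _].
- move=> x; rewrite /= in_itv/= andbT => x0; exists (Num.bound x) => // n /= hn.
  rewrite in_itv/= x0/=; apply: (le_trans (ltW (archi_boundP (ltW x0)))).
  by rewrite ler_nat (leq_trans hn).
- exact: cintegrable_gint_y.
Qed.

Lemma rotated_cvg s z : -1 < cRe s < 1 -> 0 <= cRe z -> `|cIm z| = pi / 2 ->
  ccvg (fun n => rotated s z n.+1%:R 1) (cgamma (1 - s)).
Proof.
move=> hs zr zi; have /andP[s0 s1] := hs.
have c0 : ccvg (fun n => rotated s z n.+1%:R 0) (cgamma (1 - s)).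
  rewrite -[X in ccvg _ X]addr0 /rotated.
  rewrite (_ : (fun n => _) = fun n : nat => lower s 1 n.+1%:R +
     rpow n.+1%:R (- s) * cexp (- n.+1%:R%:C)); last first.
    by apply/funext => n; rewrite !mul0r cexp0 subr0 !mul1r.
  apply: ccvgD; first exact: lower_gamma_cvg.
  apply: (ccvg_squeeze (b := pterm (1 + cRe s))); last by apply: pterm_cvg0; lra.
  near=> n; rewrite subr0 cmodM cmod_rpow// cmod_cexp !cReN/=.
  have n0 : (0 : R) < n.+1%:R by [].
  rewrite /pterm opprD powRD; last by rewrite (gt_eqF n0) implybT.
  rewrite mulrC ler_wpM2r ?powR_ge0// powR_inv1 ?(ltW n0)//.
  by rewrite -(ler_pM2l n0) mulfV ?gt_eqF// xexpN_le1.
rewrite -[X in ccvg _ X]add0r.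
rewrite (_ : (fun n => _) = fun n : nat => (rotated s z n.+1%:R 1 - rotated s z n.+1%:R 0) +
   rotated s z n.+1%:R 0); last by apply/funext => n; rewrite subrK.
apply: ccvgD => //.
set K := cmod (z * s) * expR (cmod (z * s)).
apply: (ccvg_squeeze (b := fun n => 2 * K * pterm (1 + cRe s) n)).
  near=> n; rewrite subr0 /pterm (_ : - (1 + cRe s) = - cRe s - 1); last by ring.
  by apply: rotated_diff_le => //; rewrite ler1n.
rewrite -(mulr0 (2 * K)); apply: cvgM; first exact: cvg_cst.
by apply: pterm_cvg0; lra.
Unshelve. all: by end_near. Qed.

End Rotation.

(** * Fourier coefficients for -1 < Re s < 1 by unfolding *)

Section HurwitzFourier.
Variable R : realType.
Notation mu := (@lebesgue_measure R).
Notation T := (measurableTypeR R).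
Implicit Types (s w z : R[i]) (x X : R) (m : int).

Lemma carg_two_pi_i m : carg (two_pi_i R m) = if 0 <= m then pi / 2 else - (pi / 2).
Proof.
rewrite /carg /= mul0r acos0 pmulr_rge0; last by rewrite mulr_gt0// pi_gt0.
by rewrite ler0z.
Qed.

Lemma cexp_clog_two_pi_i m : m != 0 -> cexp (clog (two_pi_i R m)) = two_pi_i R m.
Proof.
move=> m0; rewrite /clog carg_two_pi_i.
have r0 : 0 < cmod (two_pi_i R m) by rewrite cmod_gt0 two_pi_i_eq0.
have rE := cmod_two_pi_i R m; move: r0 rE; set r := cmod _; clearbody r => r0 rE.
rewrite /cexp/= lnK// rE.
case: (leP 0 m) => hm; apply: complexP => /=.
- by rewrite cos_pihalf mulr0.
- by rewrite sin_pihalf mulr1 ger0_norm// ler0z.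
- by rewrite cosN cos_pihalf mulr0.
- by rewrite sinN sin_pihalf mulrN1 ltr0_norm ?ltrz0// mulrN opprK.
Qed.

(** Here |2 pi m| >= 1, so that z = log (2 pi i m) meets the condition Re z >= 0 under which the
    rotation was estimated. *)
Lemma clog_two_pi_i_Re m : m != 0 -> 0 <= cRe (clog (two_pi_i R m)).
Proof.
move=> m0; have -> : cRe (clog (two_pi_i R m)) = ln (cmod (two_pi_i R m)) by [].
apply: ln_ge0; rewrite cmod_two_pi_i.
have : (1 : R) <= `|m%:~R| by rewrite -intr_norm -[1]/(1%:~R) ler_int -gtz0_ge1 normr_gt0.
have := pi_ge2 R; set p := pi; set k := `|_|; nra.
Qed.

Lemma clog_two_pi_i_Im m : `|cIm (clog (two_pi_i R m))| = pi / 2.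
Proof.
rewrite /clog/= carg_two_pi_i; have p0 : 0 <= pi / 2 :> R by rewrite divr_ge0// pi_ge0.
by case: ifP => _; rewrite ?normrN ger0_norm.
Qed.

Lemma measurable_oc (a b : R) : measurable (`]a, b]%classic : set T).
Proof. exact: measurable_itv. Qed.

Lemma measurable_oo (a b : R) : measurable (`]a, b[%classic : set T).
Proof. exact: measurable_itv. Qed.

Lemma subset_oo_oc (a b : R) : `]a, b[%classic `<=` (`]a, b]%classic : set T).
Proof. by move=> x /=; rewrite !in_itv/= => /andP[-> /ltW]. Qed.

Lemma cintegrable_rpow_shift s n : cRe s < 1 ->
  cintegrable `]0, 1[ (fun a => rpow (n%:R + a) (- s)).
Proof.
move=> s1; have mI : measurable (`]0, 1[%classic : set T) by exact: measurable_itv.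
have mf k : cmeasurable (`]0, 1[%classic : set T) (fun a => rpow (k%:R + a) (- s)).
  by apply: cmeasurableS (cmeasurable_shift (- s) k%:R).
case: n => [|n].
  have ih := integrableS (measurable_oc _ _) mI (@subset_oo_oc 0 1) (integrable_powR s1 ltr01).
  apply: (cintegrable_le mI (mf 0%N) ih) => x Dx; have /andP[x0 _] : 0 < x < 1 by move: Dx; rewrite /= in_itv.
  by rewrite add0r cmod_rpow// cReN.
apply: (cintegrable_bounded (C := n.+2%:R `^ `|cRe s|)) => // x Dx.
have /andP[x0 x1] : 0 < x < 1 by move: Dx; rewrite /= in_itv.
have nx : 1 <= n.+1%:R + x by rewrite -natr1; have := ler0n R n; lra.
rewrite cmod_rpow ?(lt_le_trans _ nx)// cReN.
apply: (@le_trans _ _ ((n.+1%:R + x) `^ `|cRe s|)).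
  by rewrite ler_powR// (le_trans (ler_norm _))// normrN.
rewrite ge0_ler_powR// ?nnegrE//; first by rewrite (le_trans _ nx).
by rewrite -[n.+2]addn1 natrD lerD2l ltW.
Qed.

Definition htail s x : R[i] := rpow x (- s) / 2 + rpow x (1 - s) / (s - 1).

Definition htail' s x : R[i] := - s / 2 * rpow x (- s - 1) - rpow x (- s).

(** The corrections at N + 1 + a need not tend to 0 in this strip; their first-order expansion in a
    is kept, and the remainder does vanish. The two terms of the constant bound the second
    derivatives of x^(-s) / 2 and of x^(1 - s) / (s - 1). *)
Lemma htail_taylor s N a : s != 1 -> -1 < cRe s -> 0 <= a <= 1 ->
  cmod (htail s (N.+1%:R + a) - (htail s N.+1%:R + a%:C * htail' s N.+1%:R)) <=
  (cmod s * cmod (s + 1) + cmod s) * pterm (cRe s + 1) N.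
Proof.
move=> s1 sr /andP[a0 a1]; set K := (X in _ <= X).
have N0 : (0 : R) < N.+1%:R by rewrite ltr0n.
have pos x : N.+1%:R <= x -> 0 < x by exact: lt_le_trans.
have K0 : 0 <= K by rewrite /K mulr_ge0 ?addr_ge0 ?mulr_ge0 ?pterm_ge0.
pose h2 x : R[i] := s * (s + 1) / 2 * rpow x (- s - 2) + s * rpow x (- s - 1).
have dh' x : 0 < x -> cderive (htail' s) x (h2 x).
  move=> x0; apply: (cderive_eq (cderiveB (cderiveZ (- s / 2) (cderive_rpow (- s - 1) x0))
    (cderive_rpow (- s) x0))).
  rewrite /h2 (_ : - s - 1 - 1 = - s - 2); first by field.
  by ring.
have h2K x : N.+1%:R <= x -> cmod (h2 x) <= K.
  move=> Nx; apply: le_trans (cmodD _ _) _; rewrite /K mulrDl; apply: lerD.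
    rewrite cmodM cmodM cmodV cmod_nat cmodM ler_pM ?mulr_ge0//.
      by rewrite ler_piMr ?mulr_ge0//; lra.
    by apply: cmod_rpow_le => //; rewrite ?cReD ?cReN/=; lra.
  rewrite cmodM ler_wpM2l//; apply: cmod_rpow_le => //; first by lra.
  by rewrite cReD !cReN/=; lra.
have h'K x : N.+1%:R <= x <= N.+1%:R + 1 -> cmod (htail' s x - htail' s N.+1%:R) <= K.
  move=> /andP[Nx xN].
  have := @lipschitz_cderive R (htail' s) h2 N.+1%:R x K Nx.
  move=> /(_ _ _)/le_trans; apply => [y /andP[Ny _]|y /andP[Ny _]|].
  - exact/dh'/pos.
  - exact: h2K.
  - by rewrite ler_piMr//; lra.
pose D b : R[i] := htail s (N.+1%:R + b) - b%:C * htail' s N.+1%:R.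
have -> : htail s (N.+1%:R + a) - (htail s N.+1%:R + a%:C * htail' s N.+1%:R) = D a - D 0.
  by rewrite /D addr0 mul0r subr0 opprD [- _ - _]addrC addrA.
have dshift b : 0 <= b -> cderive (fun b => htail s (N.+1%:R + b)) b (htail' s (N.+1%:R + b)).
  move=> b0; have Nb0 : 0 < N.+1%:R + b by rewrite ltr_wpDr.
  have s10 : s - 1 != 0 by rewrite subr_eq0.
  apply: (cderive_eq (cderiveD
    (cderiveM (cderive_rpow_shift (- s) Nb0) (cderive_cst 2^-1 b))
    (cderiveM (cderive_rpow_shift (1 - s) Nb0) (cderive_cst (s - 1)^-1 b)))).
  rewrite /htail' !mulr0 !addr0 (_ : 1 - s - 1 = - s); last by ring.
  by field.
have := @lipschitz_cderive R D (fun b => htail' s (N.+1%:R + b) - htail' s N.+1%:R) 0 a K a0.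
move=> /(_ _ _)/le_trans; apply => [y /andP[y0 ya]|y /andP[y0 ya]|].
- apply: (cderive_eq (cderiveB (dshift y y0)
    (cderiveM (cderive_id y) (cderive_cst (htail' s N.+1%:R) y)))).
  by rewrite mulr0 addr0 mul1r.
- by apply: h'K; apply/andP; split; lra.
- by rewrite subr0 ler_piMr.
Qed.

Lemma cintegral_id_echar m : cintegral `]0, 1[ (fun a : R => a%:C * echar (- m) a) =
  if m == 0 then 2^-1 else - (two_pi_i R m)^-1.
Proof.
have i0 : cintegrable `]0, 1[ (fun a : R => a%:C * echar (- m) a).
  apply: (@cintegrable_bounded R 0 1 false true _ 1).
    by apply: cmeasurableM; [exact: cmeasurable_id|exact: cmeasurable_echar].
  move=> x Dx; have /andP[x0 x1] : 0 < x < 1 by move: Dx; rewrite /= in_itv.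
  by rewrite cmodM cmod_echar mulr1 cmod_real ger0_norm ltW.
have [_ <-] := cintegral_itvoo (@ltr01 R) i0.
have cf x : ccontinuous (fun a : R => a%:C * echar (- m) a) x.
  exact: cderive_ccontinuous (cderiveM (cderive_id x) (cderive_echar (- m) x)).
case: eqVneq => [->|m0].
  have [||_] := @cintegral_FTC R 0 1 (fun x => x%:C * x%:C / 2)
    (fun a : R => a%:C * echar (- 0) a) ler01.
  - move=> x _; apply: (cderive_eq (cderiveM (cderiveM (cderive_id x) (cderive_id x))
      (cderive_cst 2^-1 x))).
    by rewrite oppr0 echar0; field.
  - move=> x _; exact: cderive_ccontinuous (cderiveM (cderive_id x) (cderive_echar (- 0) x)).
  - by move=> ->; rewrite (_ : 0%:C = 0 :> R[i])// !mul0r subr0 (_ : 1%:C = 1 :> R[i])// !mul1r.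
set w := two_pi_i R m; have w0 : w != 0 by rewrite two_pi_i_eq0.
have [||_] := @cintegral_FTC R 0 1
  (fun x => (- w^-1) * (x%:C * echar (- m) x) - w^-1 ^+ 2 * echar (- m) x)
  (fun a : R => a%:C * echar (- m) a) ler01.
- move=> x _; apply: (cderive_eq (cderiveB (cderiveZ _ (cderiveM (cderive_id x) (cderive_echar (- m) x)))
    (cderiveZ _ (cderive_echar (- m) x)))).
  by rewrite two_pi_iN -/w; field.
- by move=> x _; exact: cf.
- move=> ->; rewrite echarx0 echarx1 (_ : 0%:C = 0 :> R[i])// (_ : 1%:C = 1 :> R[i])//.
  by ring.
Qed.

(** Because e^(-2 pi i m n) = 1, the character at a is also the character at n + a. This is what
    lets the unit intervals be joined into one integral. *)
Lemma echar_gint s m n (a : R) :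
  rpow (n%:R + a) (- s) * echar (- m) a = gint s (two_pi_i R m) (n%:R + a).
Proof.
rewrite /gint; congr (_ * _); rewrite /echar two_pi_iN.
have -> : - (two_pi_i R m * (n%:R + a)%:C) = n%:R * (- two_pi_i R m) + - two_pi_i R m * a%:C.
  by rewrite rmorphD/= rmorph_nat; ring.
by rewrite cexpD cexpM_natl -two_pi_iN cexp_two_pi_i expr1n mul1r.
Qed.

Lemma cintegral_gint_shift s m n : cRe s < 1 ->
  cintegral `]0, 1[ (fun a => rpow (n%:R + a) (- s) * echar (- m) a) =
  lower s (two_pi_i R m) n.+1%:R - (if n is 0 then 0 else lower s (two_pi_i R m) n%:R).
Proof.
move=> s1; set w := two_pi_i R m.
under eq_cintegral do rewrite echar_gint.
case: n => [|n].
  rewrite subr0 /lower; under eq_cintegral do rewrite add0r.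
  have i1 := cintegrable_gint w s1 ltr01.
  have [ir ii] := cintegrableS (measurable_oc 0 1) (measurable_oo 0 1) (@subset_oo_oc 0 1) i1.
  by rewrite /cintegral; congr (_ +i* _); exact: Rintegral_itv_bndo_bndc.
have i0 : cintegrable `]0, 1[ (fun a => gint s w (n.+1%:R + a)).
  have := cintegrableMl (measurable_oo 0 1) (cintegrable_rpow_shift n.+1 s1)
    (cmeasurable_echar _ (- m)) (C := 1).
  have -> : (fun a => rpow (n.+1%:R + a) (- s) * echar (- m) a) = (fun a => gint s w (n.+1%:R + a)).
    by apply/funext => a; rewrite echar_gint.
  by apply => x _; rewrite cmod_echar.
have [_ <-] := cintegral_itvoo (@ltr01 R) i0.
have dsh (F f : R -> R[i]) a : cderive F (n.+1%:R + a) (f (n.+1%:R + a)) ->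
    cderive (fun b => F (n.+1%:R + b)) a (f (n.+1%:R + a)).
  have h2 : is_derive a 1 (fun y : R => n.+1%:R + y) 1.
    by apply: is_derive_eq' (is_deriveD _ _) _; rewrite add0r.
  move=> [d1 d2]; split.
    by apply: is_derive_eq' (@is_derive1_comp _ (fun y => cRe (F y)) _ _ _ _ d1 h2) _; rewrite mulr1.
  by apply: is_derive_eq' (@is_derive1_comp _ (fun y => cIm (F y)) _ _ _ _ d2 h2) _; rewrite mulr1.
have [||_ ->] := @cintegral_FTC R 0 1 (fun a => lower s w (n.+1%:R + a))
   (fun a => gint s w (n.+1%:R + a)) ler01.
- move=> x /andP[x0 _]; apply: dsh; apply: cderive_lower => //.
  by rewrite ltr_wpDr.
- move=> x /andP[x0 _]; apply: cderive_ccontinuous.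
  apply: (dsh (gint s w) (fun y => - s * gint (s + 1) w y - w * gint s w y)).
  by apply: cderive_gint; rewrite ltr_wpDr.
- by rewrite addr0 natr1.
Qed.

(** The sum unfolds into [lower] up to N + 1. Of the expanded corrections, the constant part is
    orthogonal to every character but the trivial one, while the linear part contributes to all
    coefficients. *)
Lemma cintegral_hzT s m N : -1 < cRe s < 1 ->
  cintegrable `]0, 1[ (fun a => hzT s a N.+1 * echar (- m) a) /\
  cmod (cintegral `]0, 1[ (fun a => hzT s a N.+1 * echar (- m) a) -
    (lower s (two_pi_i R m) N.+1%:R + (m == 0)%:R * htail s N.+1%:R +
     htail' s N.+1%:R * (if m == 0 then 2^-1 else - (two_pi_i R m)^-1))) <=
  (cmod s * cmod (s + 1) + cmod s) * pterm (cRe s + 1) N.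
Proof.
move=> /andP[sr s1]; have s11 : s != 1 by apply: contraTneq s1 => ->; rewrite /= ltxx.
have mI : measurable (`]0, 1[%classic : set T) by exact: measurable_itv.
set w := two_pi_i R m; set K := (X in _ /\ _ <= X).
pose f0 n a := rpow (n%:R + a) (- s) * echar (- m) a.
have if0 n : cintegrable `]0, 1[ (f0 n).
  apply: (cintegrableMl mI (cintegrable_rpow_shift n s1) (cmeasurable_echar _ (- m)) (C := 1)) => x _.
  by rewrite cmod_echar.
pose rho a := (htail s (N.+1%:R + a) - (htail s N.+1%:R + a%:C * htail' s N.+1%:R)) * echar (- m) a.
have rhoK a : `]0, 1[%classic a -> cmod (rho a) <= K.
  move=> Da; have /andP[a0 a1] : 0 < a < 1 by move: Da; rewrite /= in_itv.
  rewrite cmodM cmod_echar mulr1.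
  by apply: htail_taylor => //; rewrite !ltW.
have mr z : cmeasurable (`]0, 1[%classic : set T) (fun a => rpow (N.+1%:R + a) z).
  by apply: cmeasurableS (cmeasurable_shift z N.+1%:R).
have irho : cintegrable `]0, 1[ rho.
  apply: (@cintegrable_bounded R 0 1 false true _ K) => //.
  apply: cmeasurableM; last exact: cmeasurable_echar.
  apply: cmeasurableB.
    by apply: cmeasurableD; apply: cmeasurableM => //; exact: cmeasurable_cst.
  apply: cmeasurableD; first exact: cmeasurable_cst.
  by apply: cmeasurableM; [exact: cmeasurable_id|exact: cmeasurable_cst].
pose f1 a := htail s N.+1%:R * echar (- m) a : R[i].
have if1 : cintegrable `]0, 1[ f1 by apply: cintegrableZ => //; exact: cintegrable_echar.
have iid : cintegrable `]0, 1[ (fun a : R => a%:C * echar (- m) a).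
  apply: (@cintegrable_bounded R 0 1 false true _ 1).
    by apply: cmeasurableM; [exact: cmeasurable_id|exact: cmeasurable_echar].
  move=> x Dx; have /andP[x0 x1] : 0 < x < 1 by move: Dx; rewrite /= in_itv.
  by rewrite cmodM cmod_echar mulr1 cmod_real ger0_norm ltW.
pose f2 a := htail' s N.+1%:R * (a%:C * echar (- m) a) : R[i].
have if2 : cintegrable `]0, 1[ f2 by exact: cintegrableZ.
have E : (fun a => hzT s a N.+1 * echar (- m) a) =
    fun a => \sum_(n < N.+1) f0 n a + (f1 a + f2 a + rho a).
  apply/funext => a; rewrite /hzT -addrA -/(htail s (N.+1%:R + a)) mulrDl mulr_suml.
  by congr (_ + _); rewrite /f1 /f2 /rho; ring.
have iS : cintegrable `]0, 1[ (fun a => \sum_(n < N.+1) f0 n a) by exact: cintegrable_sum.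
have if12 := cintegrableD mI if1 if2.
have ifr := cintegrableD mI if12 irho.
rewrite E; split; first exact: cintegrableD.
rewrite (cintegralD mI iS ifr) (cintegralD mI if12 irho) (cintegralD mI if1 if2) cintegral_sum//.
have -> : \sum_(n < N.+1) cintegral `]0, 1[ (f0 n) = lower s w N.+1%:R.
  elim: (N) => [|k IH]; first by rewrite big_ord1 cintegral_gint_shift// subr0.
  by rewrite big_ord_recr/= IH cintegral_gint_shift// addrC subrK.
rewrite /f1 /f2 !cintegralZ//; last exact: cintegrable_echar.
rewrite cintegral_id_echar cintegral_echar oppr_eq0 [htail s _ * _]mulrC.
rewrite !addrA [X in X - _]addrC addrK.
apply: le_trans (le_cintegral mI irho (integrable_cst_itv 0 1 false true K) rhoK) _.
rewrite Rintegral_cst//.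
suff -> : fine (mu `]0%R, 1%R[%classic) = 1 by rewrite mulr1.
by have -> := @lebesgue_measure_itv R `]0, 1[; rewrite /= lte_fin ltr01 oppr0 adde0.
Qed.

(** The corrections left by [cintegral_hzT] are what makes the limit exist. For m = 0 they cancel
    the elementary integral of x^(-s); for other m they equal the boundary term of [rotated], up to
    a multiple of X^(-s - 1) that vanishes because Re s > -1. *)
Lemma hzeta_fourier s m : -1 < cRe s < 1 ->
  cintegrable `]0, 1[ (fun a => hzeta s a * echar (- m) a) /\
  cintegral `]0, 1[ (fun a => hzeta s a * echar (- m) a) =
    if m == 0 then 0 else cgamma (1 - s) * cpow (two_pi_i R m) (s - 1).
Proof.
move=> hs; have /andP[sr s1] := hs.
have s11 : s != 1 by apply: contraTneq s1 => ->; rewrite /= ltxx.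
have Fe n a : 0 < a < 1 -> cmod (hzT s a n.+1 * echar (- m) a - hzeta s a * echar (- m) a) <=
    cmod s * cmod (s + 1) * ptail (cRe s + 2) n.
  move=> /andP[a0 _]; rewrite -mulrBl cmodM cmod_echar mulr1.
  by apply: hzT_tail => //; exact: ltW.
have e0 : (fun n => cmod s * cmod (s + 1) * ptail (cRe s + 2) n) @ \oo --> (0 : R).
  rewrite -(mulr0 (cmod s * cmod (s + 1))); apply: cvgM; first exact: cvg_cst.
  by apply: cvg_tail; apply: pseries_cvg; lra.
have [ih ch] := cintegral_uniform (@ltr01 R) (fun n => (cintegral_hzT m n hs).1) Fe e0.
split => //; apply: (ccvg_unique ch).
set A := fun n => cintegral _ _.
pose B n := lower s (two_pi_i R m) n.+1%:R + (m == 0)%:R * htail s n.+1%:R +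
     htail' s n.+1%:R * (if m == 0 then 2^-1 else - (two_pi_i R m)^-1).
have AB : ccvg (fun n => A n - B n) 0.
  apply: (ccvg_squeeze (b := fun n => (cmod s * cmod (s + 1) + cmod s) * pterm (cRe s + 1) n)).
    by near=> n; rewrite subr0; exact: (cintegral_hzT m n hs).2.
  rewrite -(mulr0 (cmod s * cmod (s + 1) + cmod s)); apply: cvgM; first exact: cvg_cst.
  by apply: pterm_cvg0; lra.
have r0 : ccvg (fun n => rpow n.+1%:R (- s - 1)) 0.
  apply: (ccvg_squeeze (b := pterm (cRe s + 1))); last by apply: pterm_cvg0; lra.
  near=> n; rewrite subr0; apply: cmod_rpow_le => //; first by lra.
  by rewrite cReD !cReN/=; lra.
suff : ccvg B (if m == 0 then 0 else cgamma (1 - s) * cpow (two_pi_i R m) (s - 1)).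
  move=> /(ccvgD AB); rewrite add0r (_ : (fun n => _ + _) = A)//.
  by apply/funext => n; rewrite subrK.
rewrite /B; have [m0|m0] := eqVneq m 0.
  (* With w = 0 [lower] is X^(1 - s) / (1 - s). It cancels the last term of [htail], the terms in
     X^(-s) cancel as well, and only - (s / 4) X^(-s - 1) survives. *)
  rewrite (_ : (fun n => _) = fun n : nat => - s / 4 * rpow n.+1%:R (- s - 1)).
    by rewrite -(mulr0 (- s / 4)); exact: ccvgZ.
  apply/funext => n; rewrite mul1r; have n0 : (0 : R) < n.+1%:R by [].
  have := lower_by_parts (two_pi_i R m) s1 n0; rewrite m0.
  have -> : two_pi_i R 0 = 0 by apply/eqP; rewrite two_pi_i_eq0.
  rewrite !mul0r subr0 oppr0 cexp0 mulr1 => h.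
  have s10 : 1 - s != 0 by rewrite subr_eq0 eq_sym.
  have s10' : s - 1 != 0 by rewrite subr_eq0.
  have -> : lower s 0 n.+1%:R = rpow n.+1%:R (1 - s) / (1 - s) by rewrite -h mulrC mulKf.
  rewrite /htail /htail'; field; rewrite s10 s10'//.
set w := two_pi_i R m; have w0 : w != 0 by rewrite two_pi_i_eq0.
have := rotated_cvg hs (clog_two_pi_i_Re m0) (clog_two_pi_i_Im m).
rewrite -/w; set z := clog w => rc.
have zw : cexp z = w by exact: cexp_clog_two_pi_i.
have -> : cpow w (s - 1) = cexp ((s - 1) * z) by rewrite /cpow (negbTE w0).
rewrite mulrC; have := ccvgD (ccvgZ (cexp ((s - 1) * z)) rc) (ccvgZ (s / 2 / w) r0).
rewrite mulr0 addr0.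
congr ccvg; apply/funext => n.
rewrite /rotated !mul1r zw mul0r addr0 mulrDr mulrA -cexpD.
have -> : (s - 1) * z + z * (1 - s) = 0 by ring.
rewrite cexp0 mul1r -addrA; congr (_ + _).
(* The truncation point is an integer, so the exponential in the boundary term equals 1. After
   multiplication by w^(s - 1) that term is X^(-s) / w, the main part contributed by [htail']. *)
have wn : cexp (- (w * n.+1%:R%:C)) = 1.
  rewrite (_ : n.+1%:R%:C = n.+1%:R :> R[i]); last by rewrite rmorph_nat.
  by rewrite mulrC cexpN cexpM_natl cexp_two_pi_i expr1n invr1.
rewrite cexpD wn mul1r mulrCA -cexpD.
have -> : (s - 1) * z - z * s = - z by ring.
by rewrite cexpN zw /htail'; field.
Unshelve. all: by end_near. Qed.

End HurwitzFourier.

(** * Bessel's inequality, the Riemann-Lebesgue lemma, Dini's criterion *)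

Section FourierSeries.
Variable R : realType.
Notation mu := (@lebesgue_measure R).
Notation T := (measurableTypeR R).
Notation I := (`]0, 1[%classic : set T).
Implicit Types (f g : R -> R[i]) (m n : int) (x a : R).

(** The open interval is used in place of the closed one of [fourier_coeff], because the formulas
    for [hurwitz_zeta] are available for 0 < a <= 1 but not at a = 0. *)
Definition coef f m : R[i] := cintegral I (fun x => f x * echar (- m) x).

Let mI : measurable I. Proof. exact: measurable_itv. Qed.

Lemma cintegrable_mul_echar f m : cintegrable I f -> cintegrable I (fun x => f x * echar m x).
Proof.
move=> fi; apply: (cintegrableMl mI fi (cmeasurable_echar _ m) (C := 1)) => x _.
by rewrite cmod_echar.
Qed.

Lemma cmeasurable_conj (D : set T) f : cmeasurable D f -> cmeasurable D (fun x => (f x)^*%C).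
Proof.
move=> [a b]; split.
  rewrite (_ : (fun x => _) = (fun x => cRe (f x)))//.
  by apply/funext => x; case: (f x).
rewrite (_ : (fun x => _) = (fun x => - cIm (f x))); first exact: measurable_funN.
by apply/funext => x; case: (f x).
Qed.

Lemma mul_conj (z : R[i]) : z * z^*%C = (cmod z ^+ 2)%:C.
Proof. by rewrite cmod_sqr; case: z => a b; apply: complexP => /=; ring. Qed.

Lemma conj_sum (J : Type) (r : seq J) (F : J -> R[i]) :
  (\sum_(i <- r) F i)^*%C = \sum_(i <- r) (F i)^*%C.
Proof. by rewrite rmorph_sum. Qed.

Lemma cmod_sub_sqr (z w : R[i]) :
  cmod (z - w) ^+ 2 = cmod z ^+ 2 - 2 * cRe (z * w^*%C) + cmod w ^+ 2.
Proof. by rewrite !cmod_sqr; case: z => a b; case: w => c d /=; ring. Qed.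

Lemma conjM (z w : R[i]) : (z * w)^*%C = z^*%C * w^*%C.
Proof. by case: z => a b; case: w => c d; apply: complexP => /=; ring. Qed.

Definition trig (c : int -> R[i]) (s : seq int) (x : R) : R[i] := \sum_(m <- s) c m * echar m x.

Lemma cintegrable_trig c s : cintegrable I (trig c s).
Proof. by apply: cintegrable_sum => // m; apply: cintegrableZ => //; exact: cintegrable_echar. Qed.

Lemma cintegral_mul_trig f c s : cintegrable I f ->
  cintegrable I (fun x => f x * (trig c s x)^*%C) /\
  cintegral I (fun x => f x * (trig c s x)^*%C) = \sum_(m <- s) (c m)^*%C * coef f m.
Proof.
move=> fi.
have E : (fun x => f x * (trig c s x)^*%C) =
    fun x => \sum_(m <- s) (c m)^*%C * (f x * echar (- m) x).
  apply/funext => x; rewrite /trig conj_sum mulr_sumr; apply: eq_bigr => m _.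
  by rewrite conjM echar_conj mulrCA.
have im m : cintegrable I (fun x => (c m)^*%C * (f x * echar (- m) x)).
  by apply: cintegrableZ => //; exact: cintegrable_mul_echar.
rewrite E; split; first exact: cintegrable_sum.
rewrite cintegral_sum//; apply: eq_bigr => m _; rewrite cintegralZ//.
exact: cintegrable_mul_echar.
Qed.

Lemma coef_trig c s m : uniq s -> coef (trig c s) m = if m \in s then c m else 0.
Proof.
move=> us; rewrite /coef.
have -> : cintegral I (fun x => trig c s x * echar (- m) x) =
    cintegral I (fun x => \sum_(n <- s) c n * echar (n - m) x).
  apply: eq_cintegral => x _; rewrite /trig mulr_suml; apply: eq_bigr => n _.
  by rewrite echarD mulrA.
have im n : cintegrable I (fun x => c n * echar (n - m) x).
  by apply: cintegrableZ => //; exact: cintegrable_echar.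
rewrite cintegral_sum//.
transitivity (\sum_(n <- s) if n == m then c n else 0).
  apply: eq_bigr => n _; rewrite cintegralZ//; last exact: cintegrable_echar.
  rewrite cintegral_echar subr_eq0; by case: eqP; rewrite ?mulr1 ?mulr0.
case: ifPn => ms.
  rewrite (bigD1_seq m ms us)/= eqxx big1 ?addr0// => n; by case: eqP.
rewrite big1_seq// => n /andP[_ ns]; case: eqP => // nm.
by rewrite -nm ns in ms.
Qed.

Lemma integral_trig_sqr c s : uniq s ->
  mu.-integrable I (EFin \o (fun x => cmod (trig c s x) ^+ 2)) /\
  \int[mu]_(x in I) cmod (trig c s x) ^+ 2 = \sum_(m <- s) cmod (c m) ^+ 2.
Proof.
move=> us; have [it itE] := cintegral_mul_trig c s (cintegrable_trig c s).
have E : (fun x => trig c s x * (trig c s x)^*%C) = fun x => (cmod (trig c s x) ^+ 2)%:C.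
  by apply/funext => x; exact: mul_conj.
rewrite E in it itE; have [ir _] := it; split => //.
have := congr1 (@complex.Re R) itE; rewrite /cintegral [LHS]/= => ->.
rewrite cRe_sum big_seq [RHS]big_seq; apply: eq_bigr => m ms.
by rewrite coef_trig// ms mulrC mul_conj.
Qed.

Lemma bessel f s : uniq s -> cintegrable I f ->
  mu.-integrable I (EFin \o (fun x => cmod (f x) ^+ 2)) ->
  \sum_(m <- s) cmod (coef f m) ^+ 2 <= \int[mu]_(x in I) cmod (f x) ^+ 2.
Proof.
move=> us fi f2; set c := coef f; have [it itE] := integral_trig_sqr c us.
have [ifs ifsE] := cintegral_mul_trig c s fi; have [ir _] := ifs.
have ir2 : mu.-integrable I (EFin \o (fun x => 2 * cRe (f x * (trig c s x)^*%C))).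
  exact: (integrableZl mI 2 ir).
have id : mu.-integrable I (EFin \o (fun x => cmod (f x) ^+ 2 - 2 * cRe (f x * (trig c s x)^*%C))).
  exact: (integrableB mI f2 ir2).
have : 0 <= \int[mu]_(x in I) cmod (f x - trig c s x) ^+ 2.
  by apply: Rintegral_ge0 => x _; rewrite exprn_ge0.
under eq_Rintegral do rewrite cmod_sub_sqr.
rewrite RintegralD// RintegralB// RintegralZl// itE.
have -> : \int[mu]_(x in I) cRe (f x * (trig c s x)^*%C) = \sum_(m <- s) cmod (c m) ^+ 2.
  have := congr1 (@complex.Re R) ifsE; rewrite /cintegral [LHS]/= => ->.
  by rewrite cRe_sum; apply: eq_bigr => m _; rewrite mulrC mul_conj.
lra.
Qed.

Lemma integrable_sqr_bounded f (B : R) : cmeasurable I f -> (forall x, I x -> cmod (f x) <= B) ->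
  cintegrable I f /\ mu.-integrable I (EFin \o (fun x => cmod (f x) ^+ 2)).
Proof.
move=> mf fB; split; first exact: cintegrable_bounded fB.
have ic := integrable_cst_itv 0 1 false true (B ^+ 2).
apply: (le_integrable mI _ _ ic) => [|x Ix].
  by apply/measurable_EFinP; apply: measurable_funX; exact: measurable_cmod.
have B0 : 0 <= B by apply: le_trans (fB x Ix).
rewrite /= lee_fin !ger0_norm ?exprn_ge0// lerXn2r ?nnegrE//.
exact: fB.
Qed.

(** Bessel's inequality bounds every finite sum of squared coefficients along distinct frequencies,
    so these squares are summable and tend to 0. *)
Lemma riemann_lebesgue_bounded f (B : R) (iota : nat -> int) : injective iota ->
  cmeasurable I f -> (forall x, I x -> cmod (f x) <= B) ->
  ccvg (fun k => coef f (iota k)) 0.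
Proof.
move=> inj mf fB; have [fi f2] := integrable_sqr_bounded mf fB.
have cs : cvgn (series (fun k => cmod (coef f (iota k)) ^+ 2)).
  apply: nondecreasing_is_cvgn.
    by apply: nondecreasing_series => k _ _; rewrite exprn_ge0.
  exists (\int[mu]_(x in I) cmod (f x) ^+ 2) => _ [n _ <-].
  have us : uniq [seq iota k | k <- index_iota 0 n] by rewrite map_inj_uniq ?iota_uniq.
  by have := bessel us fi f2; rewrite big_map.
have := cvg_series_cvg_0 cs; move=> /cvgrPdist_lt h.
apply/ccvgP => e e0; have := h _ (exprn_gt0 2 e0); apply: filterS => k.
rewrite sub0r normrN ger0_norm ?exprn_ge0// subr0.
by rewrite ltr_pXn2r// nnegrE ?cmod_ge0 ?ltW.
Qed.

Lemma Rintegral_dominated (u : nat -> R -> R) (v h : R -> R) :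
  (forall k, measurable_fun I (u k)) -> measurable_fun I v ->
  (forall x, I x -> (u ^~ x) @ \oo --> v x) -> mu.-integrable I (EFin \o h) ->
  (forall k x, I x -> `|u k x| <= h x) ->
  (fun k => \int[mu]_(x in I) u k x) @ \oo --> \int[mu]_(x in I) v x.
Proof.
move=> mu_ mv uv ih uh.
have me k : measurable_fun I (EFin \o u k) by exact/measurable_EFinP.
have mve : measurable_fun I (EFin \o v) by exact/measurable_EFinP.
have ce : {ae mu, forall x, I x -> (EFin \o u k) x @[k --> \oo] --> (EFin \o v) x}.
  by apply: aeW => x Ix; apply: cvg_EFin; [exact: nearW|exact: uv].
have be : {ae mu, forall x k, I x -> (`|(EFin \o u k) x| <= (EFin \o h) x)%E}.
  by apply: aeW => x k Ix; rewrite /= lee_fin uh.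
have [iv _ cv] := dominated_convergence mI me mve ce ih be.
rewrite /Rintegral; apply: fine_cvg; rewrite fineK//; last exact: integrable_fin_num.
Qed.

(** Truncation without case distinction: g_n = f e^(-|f| / (n + 1)) is bounded by n + 1, since y
    e^(-y) <= 1, and tends to f in mean by dominated convergence. The error made on a coefficient is
    then uniform in the frequency. *)
Lemma riemann_lebesgue f (iota : nat -> int) : injective iota -> cintegrable I f ->
  ccvg (fun k => coef f (iota k)) 0.
Proof.
move=> inj fi; have mf := cintegrable_measurable fi.
have mcf := measurable_cmod mI mf; have icf := integrable_cmod mI fi.
pose d (n : nat) x : R := expR (- (cmod (f x) / n.+1%:R)).
pose g (n : nat) x : R[i] := f x * (d n x)%:C.
have d01 (n : nat) x : 0 <= 1 - d n x <= cmod (f x) / n.+1%:R.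
  have := @expR_ge1Dx R (- (cmod (f x) / n.+1%:R)); rewrite -/(d n x) => h.
  have : d n x <= 1 by rewrite expR_le1 oppr_le0 divr_ge0.
  by move=> h2; rewrite subr_ge0 h2/= lerBlDr -lerBlDl.
have mdd (n : nat) : measurable_fun I (d n).
  apply: measurableT_comp => //; apply: measurable_funN.
  by apply: measurable_funM => //; exact: measurable_cst.
have mg (n : nat) : cmeasurable I (g n) by apply: cmeasurableM => //; exact: cmeasurable_real.
have gB (n : nat) x : I x -> cmod (g n x) <= n.+1%:R.
  move=> _; rewrite cmodM cmod_real ger0_norm ?expR_ge0//.
  have := @xexpN_le1 R (cmod (f x) / n.+1%:R); rewrite divr_ge0// => /(_ isT) h.
  have := ler_wpM2l (ler0n R n.+1) h.
  by rewrite mulr1 mulrA [_%:R * _]mulrC divfK// pnatr_eq0.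
pose u (n : nat) x : R := cmod (f x) * (1 - d n x).
have u0 : (fun k => \int[mu]_(x in I) u k x) @ \oo --> (0 : R).
  rewrite -[X in _ --> X](_ : \int[mu]_(x in I) 0 = 0); last by rewrite Rintegral_cst// mul0r.
  apply: (Rintegral_dominated (h := fun x => cmod (f x))) => //.
  - move=> n; apply: measurable_funM => //; apply: measurable_funB => //.
  - move=> x Ix; apply: (squeeze_cvgr (f := cst 0) (h := fun n : nat => cmod (f x) ^+ 2 * n.+1%:R^-1)).
    + near=> n; have /andP[h1 h2] := d01 n x; rewrite /u mulr_ge0//= expr2 -mulrA.
      by rewrite ler_wpM2l.
    + exact: cvg_cst.
    + rewrite -(mulr0 (cmod (f x) ^+ 2)); apply: cvgM; first exact: cvg_cst.
      exact: cvg_harmonic.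
  - move=> n x Ix; have /andP[h1 h2] := d01 n x; rewrite /u ger0_norm ?mulr_ge0//.
    by rewrite ler_piMr// gerBl expR_ge0.
apply/ccvgP => e e0; have e2 : 0 < e / 2 by rewrite divr_gt0.
move/cvgrPdist_lt : u0 => /(_ _ e2) [n _ /(_ n (leqnn n))].
rewrite sub0r normrN => un.
have /ccvgP/(_ _ e2) := riemann_lebesgue_bounded inj (mg n) (gB n).
apply: filterS => k; rewrite !subr0 => gk.
have gi : cintegrable I (g n) := cintegrable_bounded (mg n) (gB n).
rewrite -[coef f _](subrK (coef (g n) (iota k))).
apply: (le_lt_trans (cmodD _ _)); rewrite [e](splitr e).
apply: ltrD => //; apply: le_lt_trans un.
rewrite /coef -cintegralB//; try exact: cintegrable_mul_echar.
apply: le_trans (ler_norm _).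
have iu : mu.-integrable I (EFin \o u n).
  apply: (le_integrable mI _ _ icf) => [|x Ix].
    apply/measurable_EFinP; apply: measurable_funM => //; exact: measurable_funB.
  have /andP[h1 h2] := d01 n x.
  rewrite /= lee_fin !ger0_norm ?mulr_ge0// ler_piMr// gerBl expR_ge0//.
apply: le_cintegral => //.
  by apply: cintegrableB => //; exact: cintegrable_mul_echar.
move=> x Ix; have /andP[h1 h2] := d01 n x.
rewrite -mulrBl cmodM cmod_echar mulr1 /g /u.
have -> : f x - f x * (d n x)%:C = f x * (1 - d n x)%:C by rewrite rmorphB/=; ring.
by rewrite cmodM cmod_real ger0_norm.
Unshelve. all: by end_near. Qed.

Fixpoint sym_range (N : nat) : seq int :=
  if N is N'.+1 then [:: N%:Z, - N%:Z & sym_range N'] else [:: 0].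

Lemma mem_sym_range N m : m \in sym_range N -> (`|m| <= N)%N.
Proof.
elim: N => [|N IH]; first by rewrite inE => /eqP->.
by rewrite !inE => /or3P[/eqP->|/eqP->|/IH/leqW]//; rewrite abszN.
Qed.

Lemma sym_range_uniq N : uniq (sym_range N).
Proof.
elim: N => [//|N IH]; rewrite /= IH andbT inE negb_or -andbA; apply/and3P; split => //.
  by apply/negP => /mem_sym_range; rewrite ltnn.
by apply/negP => /mem_sym_range; rewrite abszN ltnn.
Qed.

Lemma sum_sym_range (V : zmodType) (u : int -> V) N :
  \sum_(m <- sym_range N) u m = u 0 + sym_psum u N.
Proof.
elim: N => [|N IH]; first by rewrite big_seq1 /sym_psum big_geq// addr0.
rewrite [sym_range _]/= !big_cons IH /sym_psum [in RHS]big_nat_recr//.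
by rewrite [RHS]addrA [RHS]addrC -[RHS]addrA.
Qed.

(* Chernoff's argument: writing [f - l = g * (e - e(a))] with [g] integrable, the
   partial sums of the Fourier series of [f - l] at [a] telescope to two Fourier
   coefficients of [g], which tend to 0 by Riemann-Lebesgue. *)
Lemma dini f a (l : R[i]) (M : R -> R) : cintegrable I f ->
  mu.-integrable I (EFin \o M) -> (forall x, I x -> 0 <= M x) ->
  (forall x, I x -> cmod (f x - l) <= M x * cmod (echar 1 x - echar 1 a)) ->
  ccvg (fun N => trig (coef f) (sym_range N) a) l.
Proof.
move=> fi iM M0 fM; have mf := cintegrable_measurable fi.
pose d x : R[i] := echar 1 x - echar 1 a.
(* This is (f - l) / d, with the inverse of d written as its conjugate times an exponential so that
   measurability follows by composition. Where d vanishes so does g, in accordance with f = l, which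
   the hypothesis forces there. *)
pose g x : R[i] := (f x - l) * ((d x)^*%C * (expR (- ln (cmod (d x) ^+ 2)))%:C).
have md : cmeasurable I d.
  by apply: cmeasurableB; [exact: cmeasurable_echar|exact: cmeasurable_cst].
have gd x : I x -> f x - l = g x * d x.
  move=> Ix; have := fM x Ix; rewrite -/(d x) /g => h.
  have [d0|d0] := eqVneq (d x) 0.
    rewrite d0 mulr0; apply/eqP; rewrite -cmod_eq0 eq_le cmod_ge0 andbT.
    by move: h; rewrite d0 cmod0 mulr0.
  have dd : 0 < cmod (d x) ^+ 2 by rewrite exprn_gt0// cmod_gt0.
  have e : (d x)^*%C * (expR (- ln (cmod (d x) ^+ 2)))%:C * d x = 1.
    rewrite mulrAC [_^*%C * _]mulrC mul_conj expRN lnK// -rmorphM mulfV//.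
    by rewrite gt_eqF.
  by rewrite -mulrA e mulr1.
have mg : cmeasurable I g.
  apply: cmeasurableM; first by apply: cmeasurableB => //; exact: cmeasurable_cst.
  apply: cmeasurableM; first exact: cmeasurable_conj.
  apply: cmeasurable_real; apply: measurableT_comp => //; apply: measurable_funN.
  apply: measurableT_comp; first exact: measurable_ln.
  by apply: measurable_funX; exact: measurable_cmod.
have gM x : I x -> cmod (g x) <= M x.
  move=> Ix; have [d0|d0] := eqVneq (d x) 0.
    by rewrite /g d0 rmorph0 mul0r mulr0 cmod0 M0.
  have dd : 0 < cmod (d x) by rewrite cmod_gt0.
  by have := fM x Ix; rewrite -/(d x) gd// cmodM ler_pM2r.
have gi : cintegrable I g := cintegrable_le mI mg iM gM.
have rec m : coef f m - (if m == 0 then l else 0) = coef g (m - 1) - echar 1 a * coef g m.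
  have il : cintegrable I (fun x => l * echar (- m) x).
    by apply: cintegrableZ => //; exact: cintegrable_echar.
  have -> : (if m == 0 then l else 0) = cintegral I (fun x => l * echar (- m) x).
    rewrite cintegralZ//; last exact: cintegrable_echar.
    by rewrite cintegral_echar oppr_eq0; case: eqP => _; rewrite ?mulr1 ?mulr0.
  have ig n : cintegrable I (fun x => g x * echar n x) by exact: cintegrable_mul_echar.
  rewrite /coef -cintegralZ// -!cintegralB//; first last.
  - exact: cintegrable_mul_echar.
  - exact: cintegrableZ.
  apply: eq_cintegral => x /set_mem Ix.
  by rewrite -mulrBl gd// /d opprB echarD; ring.
pose t m : R[i] := echar m a * coef g (m - 1).
have tel N : trig (coef f) (sym_range N) a - l = t (- N%:Z) - t (N%:Z + 1).
  have e m : (coef f m - (if m == 0 then l else 0)) * echar m a = t m - t (m + 1).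
    by rewrite rec /t addrK echarD; ring.
  have -> : trig (coef f) (sym_range N) a - l =
      \sum_(m <- sym_range N) (t m - t (m + 1)).
    under [RHS]eq_bigr do rewrite -e mulrBl.
    rewrite sumrB; congr (_ - _).
    rewrite sum_sym_range eqxx echar0 mulr1 /sym_psum big_nat_cond big1 ?addr0//.
    move=> i /andP[/andP[i0 _] _].
    by case: i i0 => // i _; rewrite !mul0r addr0.
  elim: N => [|N IH]; first by rewrite big_seq1.
  rewrite [sym_range _]/= !big_cons IH (_ : N.+1%:Z = N%:Z + 1); last by rewrite -addn1 PoszD.
  rewrite (_ : - (N%:Z + 1) + 1 = - N%:Z); last by rewrite opprD subrK.
  by ring.
have inj0 : injective (fun N : nat => N%:Z) by move=> p q [].
have inj1 : injective (fun N : nat => - N%:Z - 1).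
  by move=> p q /addIr/oppr_inj[].
apply: (ccvg_squeeze (b := fun N => cmod (coef g (- N%:Z - 1)) + cmod (coef g N%:Z))).
  near=> N; rewrite tel; apply: le_trans (cmodB _ _) _.
  by rewrite /t !cmodM !cmod_echar !mul1r addrK.
have h0 := riemann_lebesgue inj0 gi; have h1 := riemann_lebesgue inj1 gi.
rewrite -[X in _ --> X](addr0 (0 : R)); apply: cvgD.
  by have := ccvg_mod h1; rewrite cmod0.
by have := ccvg_mod h0; rewrite cmod0.
Unshelve. all: by end_near. Qed.

End FourierSeries.

(** * Parseval's equation and chords of the unit circle *)

Section ParsevalIdentity.
Variable R : realType.
Notation mu := (@lebesgue_measure R).
Notation T := (measurableTypeR R).
Notation I := (`]0, 1[%classic : set T).
Implicit Types (f g : R -> R[i]) (m n : int) (x a : R).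

Let mI : measurable I. Proof. exact: measurable_itv. Qed.

(** Fatou's lemma comes first, since it yields the square integrability of f that Bessel's
    inequality requires. The extended-valued integral makes the inequality meaningful before
    integrability is known. *)
Lemma parseval f (P : R ^nat) : cintegrable I f ->
  (forall x, I x -> ccvg (fun N => trig (coef f) (sym_range N) x) (f x)) ->
  P = (fun N => \sum_(m <- sym_range N) cmod (coef f m) ^+ 2) -> cvgn P ->
  (\int[mu]_(x in I) (cmod (f x) ^+ 2)%:E = (limn P)%:E)%E.
Proof.
move=> fi fc PE cP; have mf := cintegrable_measurable fi.
have mt k : cmeasurable I (trig (coef f) (sym_range k)).
  exact: cintegrable_measurable (cintegrable_trig _ _).
have mt2 k : measurable_fun I (fun x => (cmod (trig (coef f) (sym_range k) x) ^+ 2)%:E).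
  by apply/measurable_EFinP; apply: measurable_funX; exact: measurable_cmod.
have t0 (k : nat) x : I x -> (0 <= (cmod (trig (coef f) (sym_range k) x) ^+ 2)%:E)%E.
  by move=> _; rewrite lee_fin exprn_ge0.
have Pk k : (\int[mu]_(x in I) (cmod (trig (coef f) (sym_range k) x) ^+ 2)%:E = (P k)%:E)%E.
  have [it itE] := integral_trig_sqr (coef f) (sym_range_uniq k).
  by rewrite PE -itE /Rintegral fineK//; exact: integrable_fin_num.
have le : (\int[mu]_(x in I) (cmod (f x) ^+ 2)%:E <= (limn P)%:E)%E.
  have := fatou mu mI mt2 t0.
  under [X in limn_einf X]eq_fun do rewrite Pk.
  have -> : limn_einf (fun k => (P k)%:E) = (limn P)%:E.
    have /cvg_limn_einf_sup[-> _]// : (fun k => (P k)%:E) @ \oo --> (limn P)%:E.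
    by apply: cvg_EFin => //; exact: nearW.
  apply: le_trans; rewrite le_eqVlt; apply/orP; left; apply/eqP.
  apply: eq_integral => x /set_mem Ix.
  have /cvg_limn_einf_sup[-> _]// :
    (fun k => (cmod (trig (coef f) (sym_range k) x) ^+ 2)%:E) @ \oo --> (cmod (f x) ^+ 2)%:E.
  apply: cvg_EFin; first exact: nearW.
  have h := ccvg_mod (fc x Ix); rewrite expr2.
  rewrite (_ : _ \o _ = fun k => cmod (trig (coef f) (sym_range k) x) * cmod (trig (coef f) (sym_range k) x)).
    exact: (cvgM h h).
  by apply/funext => k /=; rewrite expr2.
have f2 : mu.-integrable I (EFin \o (fun x => cmod (f x) ^+ 2)).
  apply/integrableP; split.
    by apply/measurable_EFinP; apply: measurable_funX; exact: measurable_cmod.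
  apply: le_lt_trans (ltry (limn P)); apply: le_trans le.
  rewrite le_eqVlt; apply/orP; left; apply/eqP; apply: eq_integral => x _.
  by rewrite /= ger0_norm// exprn_ge0.
apply/eqP; rewrite eq_le le/=.
rewrite -[leRHS]fineK; last exact: integrable_fin_num.
rewrite lee_fin; apply: limr_le => //; apply: nearW => N.
rewrite PE; exact: bessel (sym_range_uniq N) fi f2.
Qed.

(** With u = pi x / 2 one has sin u >= u cos u, because cosine decreases, hence sin 2u >= 2 u (cos
    u)^2. This is at least u since cos 2u >= 0, and u >= x since pi >= 2. *)
Lemma le_sin_pi x : 0 <= x <= 2^-1 -> x <= sin (pi * x).
Proof.
move=> /andP[x0 x1]; have p2 := pihalf_ge1 R.
pose u : R := pi / 2 * x.
have p0 : (0 : R) < pi := pi_gt0 R.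
have u0 : 0 <= u by rewrite mulr_ge0// ltW// divr_gt0.
have u1 : u <= pi / 4 by rewrite /u; nra.
have cu v : 0 <= v <= u -> cos u <= cos v.
  move=> /andP[v0]; rewrite le_eqVlt => /predU1P[->//|vu].
  by rewrite ltW// ltr_cos// in_itv/=; apply/andP; split; lra.
have c0 : 0 <= cos u by apply: cos_ge0_pihalf; apply/andP; split; lra.
have := @mean_value_le R (fun v => (cos u)%:C * v%:C) (@sin R) (fun v => (cos u)%:C * 1) (@cos R) 0 u u0.
rewrite mulr0 subr0 sin0 subr0 => h.
have {}h : `|cos u * u| <= sin u.
  have hd v : 0 <= v <= u -> is_derive (v : R) 1 (@sin R) (cos v) by move=> _; exact: is_derive_sin.
  rewrite -cmod_real rmorphM; apply: (h _ hd) => [v _|v vu].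
    exact/cderiveZ/cderive_id.
  by rewrite mulr1 cmod_real ger0_norm// cu.
have hu : 0 <= cos u * u by exact: mulr_ge0.
rewrite ger0_norm// in h.
have -> : pi * x = u *+ 2 by rewrite /u -mulr_natl; field.
rewrite sin_mulr2n -mulr_natl.
have : 0 <= cos (u *+ 2) by apply: cos_ge0_pihalf; rewrite -mulr_natl; apply/andP; split; lra.
rewrite cos_mulr2n -mulr_natl => c2.
have xu : x <= u by rewrite /u; nra.
nra.
Qed.

Lemma min_le_sin_pi x : 0 <= x <= 1 -> Num.min x (1 - x) <= sin (pi * x).
Proof.
move=> /andP[x0 x1]; rewrite ge_min; have [h|h] := leP x 2^-1.
  by rewrite le_sin_pi// x0.
apply/orP; right; have -> : pi * x = - (pi * (1 - x)) + pi by ring.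
rewrite sinDpi sinN opprK le_sin_pi//; apply/andP; split; lra.
Qed.

Lemma cmod_echarB x a : cmod (echar 1 x - echar 1 a) = 2 * `|sin (pi * (x - a))|.
Proof.
have E y : echar 1 y = cos (2 * (pi * y)) +i* sin (2 * (pi * y)).
  rewrite /echar /two_pi_i (_ : _ * _ = 0 +i* (2 * (pi * y))).
    by rewrite /cexp /= expR0 !mul1r.
  by apply: complexP => /=; ring.
have : cmod (echar 1 x - echar 1 a) ^+ 2 = (2 * sin (pi * (x - a))) ^+ 2.
  rewrite cmod_sqr !E [complex.Re _]/= [complex.Im _]/=.
  have : cos ((pi * (x - a)) *+ 2) = cos (2 * (pi * x)) * cos (2 * (pi * a)) +
      sin (2 * (pi * x)) * sin (2 * (pi * a)).
    by rewrite -cosB -mulr_natl; congr cos; ring.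
  rewrite cos_mulr2n cos2sin2 -mulr_natl.
  have := cos2Dsin2 (2 * (pi * x)); have := cos2Dsin2 (2 * (pi * a)).
  set c1 := cos _; set s1 := sin _; set c2 := cos _; set s2 := sin _; set s := sin _.
  clearbody c1 s1 c2 s2 s; nra.
move=> /(congr1 (@Num.sqrt R)); rewrite !sqrtr_sqr ger0_norm// => ->.
by rewrite normrM ger0_norm.
Qed.

(** The minimum is the distance of x to a modulo 1. It converts Lipschitz bounds in |x - a| into the
    form required by [dini], and for a = 1 it accounts for the points x close to 0. *)
Lemma le_cmod_echarB x a : `|x - a| <= 1 ->
  Num.min `|x - a| (1 - `|x - a|) <= cmod (echar 1 x - echar 1 a).
Proof.
move=> h; rewrite cmod_echarB.
have -> : `|sin (pi * (x - a))| = `|sin (pi * `|x - a|)|.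
  by have [d|d] := ger0P (x - a); rewrite // mulrN sinN normrN.
have := @min_le_sin_pi `|x - a|; rewrite normr_ge0 h => /(_ isT) h2.
have := ler_norm (sin (pi * `|x - a|)); have := normr_ge0 (sin (pi * `|x - a|)); lra.
Qed.

End ParsevalIdentity.

(** * Pointwise convergence of the Fourier series for -1 < Re s < 1 *)

Section HurwitzPointwise.
Variable R : realType.
Notation mu := (@lebesgue_measure R).
Notation T := (measurableTypeR R).
Notation I := (`]0, 1[%classic : set T).
Implicit Types (s z : R[i]) (m n : int) (x y a : R).

Let mI : measurable I. Proof. exact: measurable_itv. Qed.

Lemma rpow_lipschitz z b : 0 < b <= 1 -> exists2 K, 0 <= K & forall x y,
  b <= x <= 1 -> b <= y <= 1 -> cmod (rpow y z - rpow x z) <= K * `|y - x|.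
Proof.
(* The exponential bounds t^(Re z - 1) on [b, 1] whatever the sign of the exponent, because |ln t|
   <= - ln b there. *)
move=> /andP[b0 b1]; pose K := cmod z * expR (`|cRe z - 1| * - ln b).
have K0 : 0 <= K by rewrite mulr_ge0// expR_ge0.
have key x y : b <= x -> x <= y -> y <= 1 -> cmod (rpow y z - rpow x z) <= K * (y - x).
  move=> bx xy y1.
  apply: (lipschitz_cderive (f := fun y => rpow y z) (f' := fun y => z * rpow y (z - 1))) => //.
    by move=> t /andP[xt _]; apply: cderive_rpow; lra.
  move=> t /andP[xt ty]; have t0 : 0 < t by lra.
  rewrite cmodM cmod_rpow// /K ler_wpM2l// /powR gt_eqF// ler_expR cReD cReN.
  have lt0 : ln t <= 0 by rewrite -ln1 ler_ln ?posrE//; lra.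
  have bt : ln b <= ln t by rewrite ler_ln ?posrE//; lra.
  rewrite [complex.Re 1]/=; have [q|q] := ger0P (cRe z - 1); nra.
exists K => // x y /andP[bx x1] /andP[b_y y1].
have [xy|yx] := leP x y; first by rewrite ger0_norm ?subr_ge0// key.
by rewrite cmodBC distrC ger0_norm ?subr_ge0 ?key// ltW.
Qed.

Lemma integrable_powR_oo (p : R) : p < 1 -> mu.-integrable I (EFin \o (fun x => x `^ (- p))).
Proof.
move=> p1; have := integrable_powR p1 ltr01.
apply: integrableS => //.
exact: subset_oo_oc.
Qed.

Lemma integrable_dini (p A B : R) : p < 1 ->
  mu.-integrable I (EFin \o (fun x => A + B * x `^ (- p))).
Proof.
move=> p1; have h : mu.-integrable I (EFin \o (fun x => B * x `^ (- p))).
  exact: (integrableZl mI B (integrable_powR_oo p1)).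
exact: (integrableD mI (integrable_cst_itv 0 1 false true A) h).
Qed.

Lemma cintegrable_hzeta s : -1 < cRe s < 1 -> cintegrable I (hzeta s).
Proof.
move=> hs; have [hi _] := hzeta_fourier 0 hs.
by apply: (eq_cintegrable mI _ hi) => x _; rewrite oppr0 echar0 mulr1.
Qed.

(** By [hzeta_shift] the increment of zeta is that of x^(-s) plus a Lipschitz function. For x >= a /
    2 the power is Lipschitz too; for x < a / 2 one has 1 <= (2 / a) |x - a|, so the power is paid
    for by its own size. The resulting majorant A + B x^(- Re s) is integrable since Re s < 1. *)
Lemma hzeta_trig s a : -1 < cRe s < 1 -> 0 < a < 1 ->
  ccvg (fun N => trig (coef (hzeta s)) (sym_range N) a) (hzeta s a).
Proof.
move=> hs /andP[a0 a1]; have /andP[sr s1r] := hs.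
have s1 : s != 1 by apply: contraTneq s1r => ->; rewrite /= ltxx.
have fi := cintegrable_hzeta hs.
have [L L0 hL] := hzeta_lipschitz s1 sr.
have b01 : 0 < a / 2 <= 1 by apply/andP; split; lra.
have [K K0 hK] := rpow_lipschitz (- s) b01.
(* The distance from a to the endpoints: it keeps |x - a| <= 1 - k, so the chord is at least k |x -
   a| with no interference from periodicity. *)
pose k := Num.min a (1 - a).
have k0 : 0 < k by rewrite lt_min a0 subr_gt0.
have ka : k <= a by rewrite ge_min lexx.
have ka1 : k <= 1 - a by rewrite ge_min lexx orbT.
set p := cRe s in sr s1r.
pose A := (K + L + a `^ (- p) * (2 / a)) / k; pose B := (2 / a) / k.
have p0 x : 0 <= x `^ (- p) by exact: powR_ge0.
have ia : 0 < 2 / a by rewrite divr_gt0.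
have A0 : 0 <= A.
  by apply: divr_ge0 (ltW k0); rewrite !addr_ge0// mulr_ge0// ltW.
have B0 : 0 <= B by apply: divr_ge0; exact: ltW.
apply: (@dini R _ _ _ (fun x => A + B * x `^ (- p))) => //; first exact: integrable_dini.
  by move=> x _; apply: addr_ge0 => //; exact: mulr_ge0.
move=> x Ix; have /andP[x0 x1] : 0 < x < 1 by move: Ix; rewrite /= in_itv.
have xa1 : `|x - a| <= 1 by rewrite ler_norml; apply/andP; split; lra.
have xa2 : `|x - a| <= 1 - k by rewrite ler_norml; apply/andP; split; lra.
have := le_cmod_echarB xa1; set E := cmod (echar 1 x - _) => hE.
have {hE} kE : k * `|x - a| <= E.
  apply: le_trans hE; have := normr_ge0 (x - a); rewrite le_min => n0.
  by apply/andP; split; nra.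
have rE : `|x - a| <= E / k by rewrite ler_pdivlMr// mulrC.
have hx := @hzeta_shift _ _ x s1 (ltW x0) sr; have ha := @hzeta_shift _ _ a s1 (ltW a0) sr.
have hg : cmod (hzeta s (1 + x) - hzeta s (1 + a)) <= L * `|x - a|.
  have -> : x - a = (1 + x) - (1 + a) by ring.
  by apply: hL; apply/andP; split; lra.
have hr : cmod (rpow x (- s) - rpow a (- s)) <=
    (K + (a `^ (- p) + x `^ (- p)) * (2 / a)) * `|x - a|.
  have q0 : 0 <= (a `^ (- p) + x `^ (- p)) * (2 / a).
    by rewrite mulr_ge0 ?addr_ge0// ltW.
  have [h|h] := leP (a / 2) x.
    have /le_trans -> // : cmod (rpow x (- s) - rpow a (- s)) <= K * `|x - a|.
      by apply: hK; apply/andP; split; lra.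
    by rewrite mulrDl lerDl mulr_ge0.
  apply: le_trans (cmodB _ _) _; rewrite !cmod_rpow// cReN -/p addrC.
  have h2 : 1 <= (2 / a) * `|x - a|.
    rewrite mulrAC ler_pdivlMr// mul1r ltr0_norm; lra.
  rewrite mulrDl -mulrA -[leLHS]addr0 -[leLHS]add0r addr0 lerD// ?mulr_ge0//.
  by rewrite -[leLHS]mulr1 ler_wpM2l// addr_ge0.
have -> : A + B * x `^ (- p) = (K + L + (a `^ (- p) + x `^ (- p)) * (2 / a)) / k.
  by rewrite /A /B; ring.
rewrite mulrAC mulrC mulrCA [_^-1 * _]mulrC.
have -> : hzeta s x - hzeta s a =
    (rpow x (- s) - rpow a (- s)) + (hzeta s (1 + x) - hzeta s (1 + a)).
  by rewrite hx ha; ring.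
apply: le_trans (cmodD _ _) _; apply: le_trans (lerD hr hg) _.
rewrite -mulrDl addrAC mulrC; apply: ler_pM => //.
  by rewrite !addr_ge0// mulr_ge0 ?addr_ge0// ltW.
by rewrite mulrC.
Qed.

(** On the circle the points near 0 are also near 1, and there zeta(s, x) - zeta(s, 1) is x^(-s)
    plus a Lipschitz increment of order x. Dividing by the chord leaves x^(- Re s - 1), which is
    integrable exactly because Re s < 0. *)
Lemma hzeta_trig1 s : -1 < cRe s < 0 ->
  ccvg (fun N => trig (coef (hzeta s)) (sym_range N) 1) (hzeta s 1).
Proof.
move=> /andP[sr s0r]; have hs : -1 < cRe s < 1 by apply/andP; split; lra.
have s1 : s != 1 by apply: contraTneq s0r => ->; rewrite /= ltNge ler01.
have fi := cintegrable_hzeta hs.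
have [L L0 hL] := hzeta_lipschitz s1 sr.
have b01 : 0 < (2^-1 : R) <= 1 by apply/andP; split; lra.
have [K K0 hK] := rpow_lipschitz (- s) b01.
set p := cRe s in sr s0r hs.
apply: (@dini R _ _ _ (fun x => (K + L) + 1 * x `^ (- (p + 1)))) => //.
- by apply: integrable_dini; lra.
- by move=> x _; rewrite mul1r !addr_ge0// powR_ge0.
move=> x Ix; have /andP[x0 x1] : 0 < x < 1 by move: Ix; rewrite /= in_itv.
have xE : `|x - 1| = 1 - x by rewrite ltr0_norm; lra.
have xa1 : `|x - 1| <= 1 by rewrite xE; lra.
have := le_cmod_echarB xa1; set E := cmod (echar 1 x - _).
rewrite xE (_ : 1 - (1 - x) = x); last by ring.
move=> hE; have hx := @hzeta_shift _ _ x s1 (ltW x0) sr.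
have E0 : 0 <= E by exact: cmod_ge0.
have P0 : 0 <= x `^ (- (p + 1)) by exact: powR_ge0.
have [h|h] := leP 2^-1 x.
  have hE1 : 1 - x <= E by apply: le_trans hE; rewrite le_min lexx/=; lra.
  have h1 := @hzeta_shift _ _ 1 s1 ler01 sr.
  have -> : hzeta s x - hzeta s 1 =
      (rpow x (- s) - rpow 1 (- s)) + (hzeta s (1 + x) - hzeta s (1 + 1)).
    by rewrite hx h1; ring.
  have hg : cmod (hzeta s (1 + x) - hzeta s (1 + 1)) <= L * (1 - x).
    rewrite -xE (_ : x - 1 = (1 + x) - (1 + 1)); last by ring.
    by apply: hL; apply/andP; split; lra.
  have hr : cmod (rpow x (- s) - rpow 1 (- s)) <= K * (1 - x).
    by rewrite -xE; apply: hK; apply/andP; split; lra.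
  apply: le_trans (cmodD _ _) _; nra.
have hE1 : x <= E by apply: le_trans hE; rewrite le_min lexx andbT; lra.
have -> : hzeta s x - hzeta s 1 = rpow x (- s) + (hzeta s (1 + x) - hzeta s 1).
  by rewrite hx; ring.
have hg : cmod (hzeta s (1 + x) - hzeta s 1) <= L * x.
  have x12 : 1 <= 1 + x <= 2 by apply/andP; split; lra.
  have o12 : 1 <= (1 : R) <= 2 by apply/andP; split; lra.
  have := hL _ _ o12 x12; rewrite (_ : 1 + x - 1 = x); last by ring.
  by rewrite ger0_norm// ltW.
have hr : cmod (rpow x (- s)) = x `^ (- (p + 1)) * x.
  rewrite cmod_rpow// cReN -/p -[X in _ * X](powRr1 (ltW x0)) -powRD; last by rewrite (gt_eqF x0) implybT.
  by congr powR; ring.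
apply: le_trans (cmodD _ _) _; rewrite hr; nra.
Qed.

End HurwitzPointwise.

(** * Hurwitz's formula and the glued continuation *)

Section HurwitzFormula.
Variable R : realType.
Implicit Types (s z : R[i]) (m : int) (n N : nat) (x y a p : R).

Lemma cmod_cpow_two_pi_i s m : m != 0 -> cmod (cpow (two_pi_i R m) (s - 1)) =
  (2 * pi * `|m%:~R|) `^ (cRe s - 1) *
  expR (if 0 <= m then - (cIm s * (pi / 2)) else cIm s * (pi / 2)).
Proof.
move=> m0; have r0 : 0 < 2 * pi * `|m%:~R| :> R.
  by rewrite -cmod_two_pi_i cmod_gt0 two_pi_i_eq0.
have reE : cRe (clog (two_pi_i R m)) = ln (2 * pi * `|m%:~R|) by rewrite -cmod_two_pi_i.
have imE : cIm (clog (two_pi_i R m)) = if 0 <= m then pi / 2 else - (pi / 2).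
  by rewrite -carg_two_pi_i.
rewrite /cpow two_pi_i_eq0 (negPf m0) cmod_cexp cReM cReD cReN cImD cImN reE imE.
rewrite /powR gt_eqF// -expRD; congr expR; rewrite [complex.Re 1]/= [complex.Im 1]/= subr0.
by congr (_ + _); case: ifP => _; rewrite ?mulrN ?opprK.
Qed.

Lemma two_pi_mul_ge n : n.+1%:R <= 2 * pi * n.+1%:R :> R.
Proof.
have p2 := pihalf_ge1 R; have n0 : (0 : R) <= n.+1%:R by [].
by rewrite ler_peMl//; lra.
Qed.

Definition fterm s a n : R[i] :=
  cpow (two_pi_i R n.+1%:Z) (s - 1) * echar n.+1%:Z a +
  cpow (two_pi_i R (- n.+1%:Z)) (s - 1) * echar (- n.+1%:Z) a.

(** The exponential factor comes from the arguments pi / 2 and - pi / 2 of 2 pi i m. As in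
    [cmod_hzE_le], [p] and [Y] are separate from s so that the bound is uniform on discs. *)
Lemma cmod_fterm_le s a n p (Y : R) : 0 <= p <= 1 - cRe s -> `|cIm s| <= Y ->
  cmod (fterm s a n) <= 2 * expR (Y * (pi / 2)) * pterm p n.
Proof.
move=> /andP[p0 ps] sY; have pi0 : (0 : R) <= pi / 2 by rewrite divr_ge0// pi_ge0.
have key m : `|m| = n.+1%:Z -> cmod (cpow (two_pi_i R m) (s - 1) * echar m a) <=
    expR (Y * (pi / 2)) * pterm p n.
  move=> mn; have m0 : m != 0 by apply: contra_eq_neq mn => ->; rewrite normr0.
  rewrite cmodM cmod_echar mulr1 cmod_cpow_two_pi_i// mulrC -intr_norm mn.
  apply: ler_pM; rewrite ?expR_ge0 ?powR_ge0//.
    rewrite ler_expR; move: sY; rewrite ler_norml => /andP[sY1 sY2].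
    by case: ifP => _; nra.
  have n1 := two_pi_mul_ge n.
  apply: le_trans (pterm_le p0 n1); apply: ler_powR; last by lra.
  by apply: le_trans n1; rewrite ler1n.
rewrite /fterm; apply: le_trans (cmodD _ _) _; rewrite -mulrA mulr_natl mulr2n.
by apply: lerD; apply: key; rewrite ?normrN.
Qed.

Lemma psum_fterm s a N : psum (fterm s a) N =
  sym_psum (fun m => cpow (two_pi_i R m) (s - 1) * echar m a) N.
Proof. by rewrite /psum /sym_psum big_add1 big_mkord. Qed.

Definition hzD s a : R[i] := xget 0 [set l | has_csum (fterm s a) l].

Lemma hzD_csum s a : cRe s < 0 -> has_csum (fterm s a) (hzD s a).
Proof.
move=> s0; have ps : 0 <= 1 - cRe s <= 1 - cRe s by apply/andP; split; lra.
have [||l hl _] := @has_csum_dominated R (fterm s a)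
  (fun n => 2 * expR (`|cIm s| * (pi / 2)) * pterm (1 - cRe s) n).
- by move=> n; exact: cmod_fterm_le.
- by apply: is_cvg_seriesZ; apply: pseries_cvg; lra.
- by apply: (@xgetPex _ 0 [set l | has_csum (fterm s a) l]); exists l.
Qed.

Lemma is_pser_fterm a n z r : 0 < r -> is_pser (fun s => fterm s a n) z r.
Proof.
move=> r0; have h m : m != 0 -> is_pser (fun s => cpow (two_pi_i R m) (s - 1) * echar m a) z r.
  move=> m0; pose c := clog (two_pi_i R m).
  apply: (is_pser_ext _ (is_pserZ (cexp (- c) * echar m a) (is_pser_cexp c z r0))) => w _.
  rewrite /cpow two_pi_i_eq0 (negPf m0) -/c mulrBl mul1r addrC cexpD mulrAC [w * c]mulrC.
  by [].
by apply: is_pserD; exact: h.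
Qed.

Lemma is_pser_hzD a z : cRe z < 0 -> exists2 r, 0 < r & is_pser (fun s => hzD s a) z r.
Proof.
move=> z0; pose r := - cRe z / 2; have r0 : 0 < r by rewrite divr_gt0// oppr_gt0.
exists (r / 2); first by rewrite divr_gt0.
pose p := 1 - cRe z / 2.
apply: (@is_pser_sum _ (fun n s => fterm s a n)
  (fun n => 2 * expR ((`|cIm z| + r) * (pi / 2)) * pterm p n)).
- by move=> n; exact: is_pser_fterm.
- move=> n w wr; apply: cmod_fterm_le.
    have := le_trans (cRe_cmod _) wr; rewrite cReD cReN ler_norml /p => /andP[h1 h2].
    by apply/andP; split; rewrite /r in h2; lra.
  have := le_trans (cIm_cmod _) wr; rewrite cImD cImN => h1.
  have := ler_normD (cIm z) (cIm w - cIm z); rewrite addrC subrK; lra.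
- by apply: is_cvg_seriesZ; apply: pseries_cvg; rewrite /p; lra.
- move=> w wr; apply: hzD_csum.
  have := le_trans (cRe_cmod _) wr; rewrite cReD cReN ler_norml /r => /andP[h1 h2]; lra.
Qed.

Lemma hzeta_trigE s a N : -1 < cRe s < 1 ->
  trig (coef (hzeta s)) (sym_range N) a = cgamma (1 - s) * psum (fterm s a) N.
Proof.
move=> hs; rewrite /trig sum_sym_range /coef.
have [_ ->] := hzeta_fourier 0 hs; rewrite eqxx mul0r add0r.
rewrite psum_fterm /sym_psum mulr_sumr; apply: eq_big_nat => -[//|n] _.
have [_ ->] := hzeta_fourier n.+1 hs; have [_ ->] := hzeta_fourier (- n.+1%:Z) hs.
by rewrite mulrDr !mulrA.
Qed.

Lemma hzeta_hzD s a : -1 < cRe s < 0 -> 0 < a <= 1 -> hzeta s a = cgamma (1 - s) * hzD s a.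
Proof.
move=> hs /andP[a0 a1]; have /andP[sr s0] := hs.
have hs1 : -1 < cRe s < 1 by rewrite sr/=; lra.
have h : ccvg (fun N => trig (coef (hzeta s)) (sym_range N) a) (hzeta s a).
  move: a1; rewrite le_eqVlt => /predU1P[->|a1]; first exact: hzeta_trig1.
  by apply: hzeta_trig; rewrite // a0.
apply: (ccvg_unique h).
rewrite (funext (fun N => hzeta_trigE a N hs1)).
by apply: ccvgZ; exact: hzD_csum.
Qed.

(* The two branches agree on the strip [-1 < Re s < 0], by [hzeta_hzD]. *)
Definition hzF a s : R[i] := if cRe s < 0 then cgamma (1 - s) * hzD s a else hzeta s a.

Lemma hzF_hzeta s a : -1 < cRe s -> 0 < a <= 1 -> hzF a s = hzeta s a.
Proof. by move=> sr a01; rewrite /hzF; case: ltP => // s0; rewrite hzeta_hzD// sr. Qed.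

Lemma hzF_continuation a : 0 < a <= 1 -> hurwitz_continuation a (hzF a).
Proof.
move=> a01; have /andP[a0 _] := a01; split.
  apply: analytic_on_pser => z z1; have [z0|z0] := ltP (cRe z) 0.
    have [r1 r10 h1] := is_pser_hzD a z0.
    have [r2 r20 h2] : exists2 r, 0 < r & is_pser (fun w => @cgamma R (1 - w)) z r.
      by apply: is_pser_cgamma; lra.
    pose r := Num.min (Num.min r1 r2) (- cRe z).
    have r0 : 0 < r by rewrite !lt_min r10 r20/= oppr_gt0.
    exists (fun s => cgamma (1 - s) * hzD s a), r; split.
      apply: is_pserM; [apply: is_pser_shrink h2|apply: is_pser_shrink h1].
        by rewrite r0/= /r !ge_min lexx orbT.
      by rewrite r0/= /r !ge_min lexx.
    move=> w wr; rewrite /hzF ifT//.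
    have := le_lt_trans (cRe_cmod _) wr; rewrite cReD cReN ltr_norml => /andP[_].
    have : r <= - cRe z by rewrite /r ge_min lexx orbT.
    lra.
  have zr : -1 < cRe z by lra.
  have [r1 r10 h1] := is_pser_hzeta (ltW a0) z1 zr.
  (* Since Re z >= 0 here, a radius of at most 1/2 stays in Re > -1, where the glued function is
     [hzeta] on both sides of the imaginary axis. *)
  pose r := Num.min r1 2^-1; have r0 : 0 < r by rewrite lt_min r10/= invr_gt0.
  exists (fun w => hzeta w a), r; split.
    by apply: is_pser_shrink h1; rewrite r0/= /r ge_min lexx.
  move=> w wr; apply: hzF_hzeta => //.
  have := le_lt_trans (cRe_cmod _) wr; rewrite cReD cReN ltr_norml => /andP[+ _].
  have : r <= 2^-1 by rewrite /r ge_min lexx orbT.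
  lra.
move=> s s1; have := hzeta_series (ltW a0) s1; rewrite hzF_hzeta//; last by lra.
move=> /ccvgE; rewrite (_ : psum _ = series (fun n => cpow (n%:R + a)%:C (- s)))//.
apply/funext => n; rewrite psumE; congr (series _ n); apply/funext => k.
by rewrite cpow_pos// ltr_wpDl.
Qed.

Lemma hurwitz_zetaE s a : s != 1 -> -1 < cRe s -> 0 < a <= 1 -> hurwitz_zeta s a = hzeta s a.
Proof.
by move=> s1 sr a01; rewrite (hurwitz_zeta_unique (hzF_continuation a01) s1) hzF_hzeta.
Qed.

Lemma hurwitz_zetaD s a : cRe s < 0 -> 0 < a <= 1 ->
  hurwitz_zeta s a = cgamma (1 - s) * hzD s a.
Proof.
move=> s0 a01; have s1 : s != 1 by apply: contraTneq s0 => ->; rewrite /= ltNge ler01.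
by rewrite (hurwitz_zeta_unique (hzF_continuation a01) s1) /hzF s0.
Qed.

End HurwitzFormula.

(** * Conditional convergence of the Fourier series *)

Section HurwitzSeries.
Variable R : realType.
Notation mu := (@lebesgue_measure R).
Notation T := (measurableTypeR R).
Notation I := (`]0, 1[%classic : set T).
Implicit Types (s z q : R[i]) (m : int) (n N : nat) (x y a p : R).

Let mI : measurable I. Proof. exact: measurable_itv. Qed.

(** Summation by parts: (1 - q) times the N-th partial sum is w_0 - w_N q^N plus the partial sum of
    (w_(n+1) - w_n) q^(n+1). The latter converges absolutely, and w_N tends to 0. *)
Lemma dirichlet_test (w : nat -> R[i]) (b : nat -> R) q : cmod q = 1 -> q != 1 ->
  ccvg w 0 -> (forall n, cmod (w n.+1 - w n) <= b n) -> cvgn (series b) ->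
  exists l, has_csum (fun n => w n * q ^+ n) l.
Proof.
move=> q1 qn1 w0 wb cb; have qx n : cmod (q ^+ n) = 1 by rewrite cmodX q1 expr1n.
have [||d hd _] := @has_csum_dominated R (fun n => (w n.+1 - w n) * q ^+ n.+1) b.
- by move=> n; rewrite cmodM qx mulr1.
- exact: cb.
have nq : 1 - q != 0 by rewrite subr_eq0 eq_sym.
exists ((1 - q)^-1 * (w 0 - 0 + d)).
have abel N : psum (fun n => w n * q ^+ n) N = (1 - q)^-1 *
    (w 0%N - w N * q ^+ N + psum (fun n => (w n.+1 - w n) * q ^+ n.+1) N).
  apply: (mulfI nq); rewrite mulrA mulfV// mul1r.
  elim: N => [|N IH]; first by rewrite /psum !big_ord0 expr0 mulr0 mulr1 subrr addr0.
  move: IH; rewrite /psum !big_ord_recr/= mulrDr => ->; rewrite exprS; ring.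
rewrite /has_csum (funext abel); apply: ccvgZ; apply: ccvgD => //.
apply: ccvgB; first exact: ccvg_cst.
apply/ccvgP => e e0; have /ccvgP/(_ _ e0) := w0; apply: filterS => n.
by rewrite !subr0 cmodM qx mulr1.
Qed.

Lemma two_pi_iM m n : two_pi_i R (m * n%:Z) = n%:R * two_pi_i R m.
Proof.
apply: complexP; rewrite ?cReM ?cImM -(rmorph_nat (real_complex R)) /=.
  by rewrite !mul0r mulr0 subr0.
by rewrite mul0r addr0 intrM; ring.
Qed.

(** Multiplication by a positive number leaves the principal argument unchanged, so the logarithms
    add without a multiple of 2 pi i. *)
Lemma cpow_two_pi_iM m n z : m != 0 ->
  cpow (two_pi_i R (m * n.+1%:Z)) z = cpow (two_pi_i R m) z * rpow n.+1%:R z.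
Proof.
move=> m0; have mn0 : m * n.+1%:Z != 0 by rewrite mulf_neq0.
rewrite /cpow !two_pi_i_eq0 (negPf m0) (negPf mn0) /rpow -cexpD -mulrDr.
congr (cexp (_ * _)); rewrite /clog !carg_two_pi_i !cmod_two_pi_i.
rewrite intrM normrM mulrA lnM; first last.
- by rewrite posrE normr_gt0 intr_eq0.
- by rewrite posrE -cmod_two_pi_i cmod_gt0 two_pi_i_eq0.
rewrite pmulr_lge0// [`|n.+1%:~R|]ger0_norm ?ler0n//.
by apply: complexP => /=; rewrite ?addr0.
Qed.

Lemma echarM m n a : echar (m * n%:Z) a = echar m a ^+ n.
Proof. by rewrite /echar two_pi_iM -mulrA cexpM_natl. Qed.

Lemma echar_neq1 m a : 0 < a < 1 -> `|m| = 1 -> echar m a != 1.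
Proof.
move=> /andP[a0 a1] m1; have h : echar 1 a != 1.
  have xa : `|a - 0| <= 1 by rewrite subr0 ger0_norm ltW.
  have := le_cmod_echarB xa; rewrite subr0 ger0_norm ?(ltW a0)// => h.
  rewrite echarx0 in h.
  by rewrite -subr_eq0 -cmod_gt0; apply: lt_le_trans h; rewrite lt_min a0 subr_gt0.
have : (m == 1) || (m == -1) by have := eqr_norml m 1; rewrite m1 eqxx ler01 andbT => <-.
case/orP => /eqP-> //; apply: contra_neq h => e.
by rewrite -[LHS]mulr1 -e -echarD subrr echar0.
Qed.

(** Dini's criterion only gives convergence after multiplication by Gamma(1 - s), and dividing would
    require Gamma to be nonzero. Dirichlet's test, applied separately to the positive and the
    negative frequencies, avoids that: the increments of n^(s - 1) are O(n^(Re s - 2)), hence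
    summable. *)
Lemma fterm_cvg s a : cRe s < 1 -> 0 < a < 1 -> exists l, has_csum (fterm s a) l.
Proof.
move=> s1 a01; pose w n : R[i] := rpow n.+1%:R (s - 1).
have w0 : ccvg w 0.
  apply: (ccvg_squeeze (b := pterm (1 - cRe s))).
    apply: nearW => n; rewrite subr0; apply: cmod_rpow_le => //; first by lra.
    by rewrite cReD cReN/=; lra.
  by apply: pterm_cvg0; lra.
have wb n : cmod (w n.+1 - w n) <= cmod (s - 1) * pterm (2 - cRe s) n.
  rewrite -[leRHS]mulr1 (_ : 1 = n.+2%:R - n.+1%:R :> R); last by rewrite -[n.+2%:R]natr1; ring.
  apply: (@lipschitz_cderive R (fun y => rpow y (s - 1)) (fun y => (s - 1) * rpow y (s - 1 - 1))).
  - by rewrite ler_nat.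
  - move=> x /andP[x0 _]; apply: cderive_rpow; apply: lt_le_trans x0; exact: ltr0Sn.
  - move=> x /andP[x0 _]; rewrite cmodM ler_wpM2l//; apply: cmod_rpow_le x0; first by lra.
    by rewrite !cReD cReN/=; lra.
have cb : cvgn (series (fun n => cmod (s - 1) * pterm (2 - cRe s) n)).
  by apply: is_cvg_seriesZ; apply: pseries_cvg; lra.
have e1 m : cmod (echar m a) = 1 := cmod_echar m a.
have [l1 h1] := dirichlet_test (e1 1) (echar_neq1 a01 (normr1 _)) w0 wb cb.
have [l2 h2] := dirichlet_test (e1 (-1)) (echar_neq1 a01 (normrN1 _)) w0 wb cb.
pose c m := cpow (two_pi_i R m) (s - 1) * echar m a.
exists (c 1 * l1 + c (-1) * l2).
have := has_csumD (has_csumZ (c 1) h1) (has_csumZ (c (-1)) h2).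
rewrite (_ : (fun n => _) = fterm s a)//; apply/funext => n.
have F m : m != 0 -> cpow (two_pi_i R (m * n.+1%:Z)) (s - 1) * echar (m * n.+1%:Z) a =
    c m * (w n * echar m a ^+ n).
  by move=> m0; rewrite cpow_two_pi_iM// echarM exprS /c /w; ring.
by rewrite -!F// mulN1r mul1r.
Qed.

End HurwitzSeries.

(** * The Fourier series for all Re s < 1 *)

Section HurwitzCoefficients.
Variable R : realType.
Notation mu := (@lebesgue_measure R).
Notation T := (measurableTypeR R).
Notation I := (`]0, 1[%classic : set T).
Implicit Types (s z q : R[i]) (m : int) (n N : nat) (x y a p : R).

Let mI : measurable I. Proof. exact: measurable_itv. Qed.

Lemma sym_range_mem N m : (`|m| <= N)%N -> m \in sym_range N.
Proof.
elim: N => [|N IH] in m *; first by rewrite leqn0 absz_eq0 inE.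
rewrite leq_eqVlt => /predU1P[mN|]; last first.
  by rewrite ltnS => /IH h; apply/or3P/Or33.
rewrite !inE; case: m mN => k /= kN; first by rewrite kN eqxx.
by rewrite NegzE kN eqxx.
Qed.

Lemma hurwitz_csum s a : cRe s < 1 -> 0 < a < 1 ->
  exists2 l, has_csum (fterm s a) l & hurwitz_zeta s a = cgamma (1 - s) * l.
Proof.
move=> s1 a01; have /andP[a0 a1] := a01; have a01' : 0 < a <= 1 by rewrite a0 ltW.
have [s0|s0] := ltP (cRe s) 0.
  by exists (hzD s a); [exact: hzD_csum|exact: hurwitz_zetaD].
have sn1 : s != 1 by apply: contraTneq s1 => ->; rewrite /= ltxx.
have hs : -1 < cRe s < 1 by apply/andP; split; lra.
have [l hl] := fterm_cvg s1 a01; exists l => //.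
rewrite hurwitz_zetaE//; last by lra.
apply: (ccvg_unique (hzeta_trig hs a01)); rewrite (_ : (fun N => _) =
  fun N => cgamma (1 - s) * psum (fterm s a) N); first exact: ccvgZ.
apply/funext => N; exact: hzeta_trigE.
Qed.

(** For Re s >= 0 the function is [hzeta] on the open interval, with coefficients known from
    unfolding. For Re s < 0 the series converges uniformly, and each coefficient is read off the
    partial sums, where it is constant once N >= |m|. *)
Lemma hurwitz_fourier s m : cRe s < 1 -> cintegrable I (hurwitz_zeta s) /\
  coef (hurwitz_zeta s) m =
    if m == 0 then 0 else cgamma (1 - s) * cpow (two_pi_i R m) (s - 1).
Proof.
move=> s1; set G := cgamma (1 - s).
have sn1 : s != 1 by apply: contraTneq s1 => ->; rewrite /= ltxx.
have [s0|s0] := ltP (cRe s) 0; last first.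
  have hs : -1 < cRe s < 1 by apply/andP; split; lra.
  have E : {in I, hzeta s =1 hurwitz_zeta s}.
    move=> x; rewrite inE/= in_itv/= => /andP[x0 x1].
    by rewrite hurwitz_zetaE//; [lra|rewrite x0 ltW].
  split; first exact: (eq_cintegrable mI E (cintegrable_hzeta hs)).
  have [_ <-] := hzeta_fourier m hs; apply: eq_cintegral => x xI; by rewrite E.
pose c k : R[i] := if k == 0 then 0 else G * cpow (two_pi_i R k) (s - 1).
pose b n := 2 * expR (`|cIm s| * (pi / 2)) * pterm (1 - cRe s) n.
have cb : cvgn (series b) by apply: is_cvg_seriesZ; apply: pseries_cvg; lra.
have key N x : 0 < x < 1 -> cmod (trig c (sym_range N) x - hurwitz_zeta s x) <=
    cmod G * (limn (series b) - series b N).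
  move=> /andP[x0 x1]; rewrite hurwitz_zetaD//; last by rewrite x0 ltW.
  rewrite /trig sum_sym_range /c eqxx mul0r add0r.
  rewrite (_ : sym_psum _ _ = G * psum (fterm s x) N).
    rewrite -mulrBr cmodM cmodBC ler_wpM2l//; apply: csum_tail => //; first exact: hzD_csum.
    by move=> n; apply: cmod_fterm_le => //; apply/andP; split; lra.
  rewrite psum_fterm /sym_psum mulr_sumr; apply: eq_big_nat => -[//|n] _.
  by rewrite mulrDr !mulrA.
have e0 : (fun N => cmod G * (limn (series b) - series b N)) @ \oo --> (0 : R).
  rewrite -[X in _ --> X](mulr0 (cmod G)); apply: cvgM; first exact: cvg_cst.
  exact: cvg_tail.
have iF k N : cintegrable I (fun x => trig c (sym_range N) x * echar (- k) x).
  by apply: cintegrable_mul_echar; exact: cintegrable_trig.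
have ub k N x : 0 < x < 1 -> cmod (trig c (sym_range N) x * echar (- k) x -
    hurwitz_zeta s x * echar (- k) x) <= cmod G * (limn (series b) - series b N).
  by move=> x01; rewrite -mulrBl cmodM cmod_echar mulr1; exact: key.
have [ii _] := cintegral_uniform ltr01 (iF 0) (ub 0) e0.
have [_ cm] := cintegral_uniform ltr01 (iF m) (ub m) e0.
split.
  by apply: (eq_cintegrable mI _ ii) => x _; rewrite oppr0 echar0 mulr1.
apply: (ccvg_unique cm); rewrite -/(c m).
apply: (ccvg_squeeze (b := fun=> 0)); last exact: cvg_cst.
near=> N; rewrite -/(coef _ _) coef_trig ?sym_range_uniq// sym_range_mem ?subrr ?cmod0//.
near: N; exact: nbhs_infty_ge.
Unshelve. all: by end_near. Qed.

Lemma has_fourier_series_hurwitz s : cRe s < 1 -> has_fourier_series (hurwitz_zeta s)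
  (fun m => if m == 0 then 0 else cgamma (1 - s) * cpow (two_pi_i R m) (s - 1)).
Proof.
move=> s1; have [hi _] := hurwitz_fourier 0 s1.
split; first by have [] := cintegral_itvoo ltr01 hi.
move=> k; have [_ <-] := hurwitz_fourier k s1.
have ie := cintegrable_mul_echar (- k) hi.
rewrite /coef; have [_ <-] := cintegral_itvoo ltr01 ie; rewrite /fourier_coeff /echar.
by apply: eq_cintegral => x _; rewrite two_pi_iN mulNr.
Qed.

End HurwitzCoefficients.

(** * Parseval's equation in closed form *)

Section HurwitzParseval.
Variable R : realType.
Notation mu := (@lebesgue_measure R).
Notation T := (measurableTypeR R).
Notation I := (`]0, 1[%classic : set T).
Implicit Types (s z q : R[i]) (m : int) (n N : nat) (x y a p : R).

Let mI : measurable I. Proof. exact: measurable_itv. Qed.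

(** With t = Im s, the frequencies n and - n contribute (2 pi n)^(2 Re s - 2) times e^(- pi t) and
    e^(pi t), because their arguments are pi / 2 and - pi / 2. The sum is 2 cosh (pi t), whose
    factor 2 turns 2^(2 Re s - 2) into 2^(2 Re s - 1). *)
Lemma sym_psum_sqr s N : sym_psum (fun m => cmod (cpow (two_pi_i R m) (s - 1)) ^+ 2) N =
  2 `^ (2 * cRe s - 1) * pi `^ (2 * cRe s - 2) * cosh (pi * cIm s) *
  series (pterm (2 - 2 * cRe s)) N.
Proof.
have p0 : (0 : R) <= pi := pi_ge0 R.
rewrite /sym_psum big_add1 big_mkord seriesEord /= mulr_sumr; apply: eq_bigr => n _.
have sq (x q : R) : (x `^ q) ^+ 2 = x `^ (2 * q).
  by rewrite -powR_mulrn ?powR_ge0// -powRrM mulrC.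
have sqe (q : R) : expR q ^+ 2 = expR (2 * q) by rewrite -expRM_natl.
rewrite !cmod_cpow_two_pi_i// !exprMn !sqe !sq rmorphN normrN.
rewrite [`|n.+1%:~R|]ger0_norm// !powRM ?mulr_ge0//.
rewrite /pterm /cosh (_ : - (2 - 2 * cRe s) = 2 * (cRe s - 1)); last by ring.
rewrite (_ : 2 * cRe s - 2 = 2 * (cRe s - 1)); last by ring.
rewrite (_ : 2 * cRe s - 1 = 2 * (cRe s - 1) + 1); last by ring.
rewrite powRD ?powRr1//; last by rewrite pnatr_eq0 implybT.
rewrite (_ : 2 * - (cIm s * (pi / 2)) = - (pi * cIm s)); last by field.
rewrite (_ : 2 * (cIm s * (pi / 2)) = pi * cIm s); last by field.
by field.
Qed.

Lemma riemann_zeta_real p : 1 < p ->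
  ccvg (fun N => (series (pterm p) N)%:C) (riemann_zeta p%:C).
Proof.
move=> p1; have a01 : 0 < (1 : R) <= 1 by rewrite ltr01 lexx.
have s1 : p%:C != 1 :> R[i] by rewrite eq_complex/= eqxx andbT gt_eqF.
rewrite /riemann_zeta hurwitz_zetaE//=; last by lra.
have := @hzeta_series R p%:C 1 ler01 p1; rewrite /has_csum.
rewrite (_ : psum _ = fun N => (series (pterm p) N)%:C)//.
apply/funext => N; rewrite /psum seriesEord rmorph_sum; apply: eq_bigr => n _.
by rewrite natr1 -rmorphN rpow_real.
Qed.

Lemma hurwitz_parseval s : cRe s < 1 / 2 ->
  let P : nat -> R := sym_psum (fun m => cmod (cpow (two_pi_i R m) (s - 1)) ^+ 2) in
  cvgn P /\ (\int[mu]_(x in I) (cmod (hurwitz_zeta s x) ^+ 2)%:E =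
    (cmod (cgamma (1 - s)) ^+ 2 * limn P)%:E)%E.
Proof.
move=> s2 P; have s1 : cRe s < 1 by lra.
set G := cgamma (1 - s).
have cP : cvgn P.
  rewrite (_ : P = fun N => 2 `^ (2 * cRe s - 1) * pi `^ (2 * cRe s - 2) * cosh (pi * cIm s) *
    series (pterm (2 - 2 * cRe s)) N); last by apply/funext => N; exact: sym_psum_sqr.
  apply: is_cvgM; first exact: is_cvg_cst.
  by apply: pseries_cvg; lra.
split => //; have [hi _] := hurwitz_fourier 0 s1.
have hc m := (hurwitz_fourier m s1).2.
have cGP : cvgn (fun N => cmod G ^+ 2 * P N).
  by apply: is_cvgM => //; exact: is_cvg_cst.
have -> : cmod G ^+ 2 * limn P = limn (fun N => cmod G ^+ 2 * P N).
  by apply/esym/cvg_lim => //; apply: cvgM => //; exact: cvg_cst.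
apply: parseval => //.
  move=> x; rewrite /= in_itv/= => x01; have [l hl ->] := hurwitz_csum s1 x01.
  rewrite (_ : (fun N => _) = fun N => G * psum (fterm s x) N); first exact: ccvgZ.
  apply/funext => N; rewrite /trig sum_sym_range hc eqxx mul0r add0r.
  rewrite psum_fterm /sym_psum mulr_sumr; apply: eq_big_nat => -[//|n] _.
  by rewrite !hc mulrDr !mulrA.
apply/funext => N; rewrite sum_sym_range hc eqxx cmod0 [0 ^+ 2]expr2 mul0r add0r.
rewrite /P /sym_psum mulr_sumr; apply: eq_big_nat => -[//|n] _.
by rewrite !hc !cmodM !exprMn mulrDr.
Qed.

End HurwitzParseval.

Theorem proposition2 (R : realType) (sigma t : R) :
  sigma < 1 ->
  let s : R[i] := sigma +i* t in
  let G : R[i] := cgamma (1 - s) in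
  [/\ has_fourier_series (hurwitz_zeta s)
        (fun n => if n == 0 then 0 else G * cpow (two_pi_i R n) (s - 1)),
      (forall alpha : R, 0 < alpha < 1 ->
        let S : nat -> R[i]^o := sym_psum (fun n : int =>
          cpow (two_pi_i R n) (s - 1) * cexp (two_pi_i R n * alpha%:C)) in
        cvgn S /\ hurwitz_zeta s alpha = G * limn S),
      cintegral `[0, 1] (hurwitz_zeta s) = 0,
      (forall n : int, n != 0 ->
        cintegral `[0, 1] (fun alpha : R =>
          hurwitz_zeta s alpha * cexp (- (two_pi_i R n * alpha%:C)))
        = cpow (two_pi_i R n) (s - 1) * G) &
      (sigma < 1 / 2 ->
        let P : nat -> R := sym_psum (fun n : int =>
          cmod (cpow (two_pi_i R n) (s - 1)) ^+ 2) in
        [/\ cvgn P,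
            (\int[lebesgue_measure]_(alpha in `[0%R, 1%R])
               (cmod (hurwitz_zeta s alpha) ^+ 2)%:E
             = (cmod G ^+ 2 * limn P)%:E)%E &
            (cmod G ^+ 2 * limn P)%:C
            = (2 `^ (2 * sigma - 1) * pi `^ (2 * sigma - 2) * cosh (pi * t)
               * cmod G ^+ 2)%:C
              * riemann_zeta (2 - 2 * sigma)%:C])].
Proof.
move=> s1 s G; have sr : complex.Re s < 1 by [].
have hf := has_fourier_series_hurwitz sr; have [_ hc] := hf.
split.
- exact: hf.
- move=> a a01 S; have [l hl hz] := hurwitz_csum sr a01.
  have cS : S @ \oo --> (l : R[i]^o).
    have /ccvgE := hl; rewrite (_ : psum _ = S)//.
    by apply/funext => N; exact: psum_fterm.
  split; first by apply/cvg_ex; exists l.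
  by rewrite hz (cvg_lim (@norm_hausdorff _ _) cS).
- rewrite -[RHS](hc 0); apply: eq_cintegral => a _.
  by rewrite -mulNr -two_pi_iN oppr0 -/(echar 0 a) echar0 mulr1.
- by move=> n n0; rewrite mulrC; have := hc n; rewrite (negPf n0).
move=> s2 P; have [cP hP] := @hurwitz_parseval R s s2; split => //.
- rewrite integral_itv_bndoo//; apply/measurable_EFinP; apply: measurable_funX.
  apply: measurable_cmod => //; apply: cintegrable_measurable.
  by have [] := hurwitz_fourier 0 sr.
set K := 2 `^ _ * _ * cosh _.
(* The closed form already holds for the partial sums, so the identity follows from uniqueness of
   limits; Re (2 - 2 s) > 1 puts zeta in the range of its Dirichlet series. *)
have hr : ccvg (fun N => (P N)%:C) (K%:C * riemann_zeta (2 - 2 * sigma)%:C).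
  rewrite (_ : (fun N => _) = fun N => K%:C * (series (pterm (2 - 2 * sigma)) N)%:C).
    by apply: ccvgZ; apply: riemann_zeta_real; lra.
  by apply/funext => N; rewrite -rmorphM; congr (_%:C); exact: (sym_psum_sqr s).
have hP' : ccvg (fun N => (P N)%:C) (limn P)%:C.
  apply/ccvgP => e e0; move/cvgrPdist_lt : cP => /(_ _ e0); apply: filterS => N.
  by rewrite -rmorphB cmod_real distrC.
have mulC (x y : R) : (x * y)%:C = x%:C * y%:C :> R[i] by exact: rmorphM.
rewrite [LHS]mulC (ccvg_unique hP' hr) [in RHS]mulC.
by rewrite mulrCA mulrA.
Qed.
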